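(* Let $q=2$, $F=\mathbb F_2(T)$, $A=\mathbb F_2[T]$, and let $\phi:A\to F\{\tau\}$ be a Drinfeld module of rank two over $F$. Write the torsion of the $A$-module ${}^{\phi}F$ as $({}^{\phi}F)_{tors}\cong A/\mathfrak m\oplus A/\mathfrak n$ with nonzero ideals $\mathfrak m,\mathfrak n\triangleleft A$ such that $\mathfrak m$ divides $\mathfrak n$. Then $\deg(\mathfrak m)+\deg(\mathfrak n)\leq 2$.
   Context: $F\{\tau\}$ is the skew polynomial ring over $F$ with $\tau b=b^q\tau$, identified with $\mathbb F_q$-linear endomorphisms of the additive group ($\tau$ acting as $x\mapsto x^q$). A Drinfeld module of rank two over $F$ is an $\mathbb F_q$-algebra homomorphism $\phi:A\to F\{\tau\}$ with $\phi(T)=T+g\tau+\Delta\tau^2$, $g\in F$, $\Delta\in F^*$. It makes the additive group of $F$ into an $A$-module ${}^{\phi}F$; $({}^{\phi}F)_{tors}$ denotes its torsion submodule (which is finite). For a nonzero ideal $\mathfrak a\triangleleft A$, $\deg(\mathfrak a)$ is the degree of its monic generator. *)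

(* Defs.v *)
From HB Require Import structures.
From mathcomp Require Import all_boot all_order all_algebra fraction.
Set Implicit Arguments. Unset Strict Implicit. Unset Printing Implicit Defensive.
Import Order.TTheory GRing.Theory.
Local Open Scope ring_scope.

Notation A := {poly 'F_2}.
Notation F := {fraction A}.

Definition toF (a : A) : F := FracField.tofrac a.
Definition Tvar : F := toF 'X.

(* phi_T = T + g tau + Delta tau^2 acting on F (tau : x |-> x^2) *)
Definition phiT (g D : F) (x : F) : F := Tvar * x + g * x ^+ 2 + D * x ^+ 4.

Definition phi_act (g D : F) (a : A) (x : F) : F :=
  \sum_(i < size a) toF (a`_i)%:P * iter i (phiT g D) x.

Definition phi_torsion (g D : F) (x : F) : Prop :=
  exists a : A, a != 0 /\ phi_act g D a x = 0.

(* A/m (+) A/n, represented by pairs of reduced representatives *)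
Definition inQ (m n : A) (w : A * A) : Prop :=
  (size w.1 < size m)%N /\ (size w.2 < size n)%N.
Definition addQ (m n : A) (w w' : A * A) : A * A :=
  ((w.1 + w'.1) %% m, (w.2 + w'.2) %% n).
Definition actQ (m n : A) (a : A) (w : A * A) : A * A :=
  ((a * w.1) %% m, (a * w.2) %% n).

Definition torsion_iso (g D : F) (m n : A) : Prop :=
  exists f : F -> A * A,
    [/\ forall x, phi_torsion g D x -> inQ m n (f x),
        forall x y, phi_torsion g D x -> phi_torsion g D y -> f x = f y -> x = y,
        forall w, inQ m n w -> exists x, phi_torsion g D x /\ f x = w,
        forall x y, phi_torsion g D x -> phi_torsion g D y ->
          f (x + y) = addQ m n (f x) (f y)
      & forall a x, phi_torsion g D x -> f (phi_act g D a x) = actQ m n a (f x)].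

(* Main.v *)
Require Import Defs.
From HB Require Import structures.
From mathcomp Require Import all_boot all_order all_algebra fraction.
From mathcomp Require Import zify ring.
Set Implicit Arguments. Unset Strict Implicit. Unset Printing Implicit Defensive.
Import Order.TTheory GRing.Theory Num.Theory.
Local Open Scope ring_scope.
Local Open Scope quotient_scope.

(** Let Q = X^2 + X + 1. A torsion module A/m (+) A/n of degree at least 3 contains A/p with p
    irreducible of degree at least 3, or one of A/Q^2, (A/Q)^2, A/Q (+) A/l, or one of A/l^3,
    A/l^2 (+) A/l, A/l^2 (+) A/(l+1), (A/l)^2 (+) A/(l+1), where l is X or X + 1.

    For the modules involving p or Q one rescales to g = 0 or g = 1. Two torsion points have a
    Wronskian W x y = x' y + x y'. At every finite place the Newton polygon of phi bounds the
    valuation of W x y from below in terms of those of the torsion points, and at infinity W x y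
    gains one over x y; the product formula, applied to a suitable product of Wronskians and
    torsion points, gives a contradiction. (A/Q)^2 is already impossible at a finite place with
    residue field F_2.

    For the modules involving only l = t and l + 1, dividing by a t-torsion point turns phi into
    t P + c P^2 with P(y) = y^2 + y. The isogeny P reduces A/l^3 to A/l^2 (+) A/l and
    A/l^2 (+) A/(l+1) to (A/l)^2 (+) A/(l+1). In these two cases the torsion equations define
    plane curves over F_2(t), whose rational points are excluded by infinite descent on the
    degrees of polynomial solutions. *)

(** The product formula does not exclude the torsion points directly: it only shows that their
    Wronskians vanish. The contradiction then comes from a cubic. Four points with pairwise
    vanishing Wronskians, whose images under [phi] stay in the same class, would be four roots of a
    polynomial of degree at most 3 whose constant term is t' = 1. Rescaling makes g a constant,
    integral everywhere, and leaves one bad kind of finite place, g = 1 and v(D) > 0, where phi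
    reduces to rank one and torsion points may have poles. The obstacle there is that
    differentiation raises pole orders. What saves the estimates is that squares have derivative 0:
    (phi z)' = z + t z' + D' z^4, while phi doubles the pole order of z, so a deep torsion point has
    a derivative with only about half its pole order. The exponents of the products are tuned so
    that the remaining local losses are paid for. That q = 2 enters as [k2]: 1 is the only nonzero
    constant, so coprime factors of a square are squares, and at a place with residue field F_2 two
    elements of equal valuation cancel to leading order. *)

Ltac zlia :=
  repeat match goal with
  | H : is_true ?b |- _ =>
      lazymatch b with
      | context [@Order.le] => fail
      | context [@Order.lt] => fail
      | context [leq] => fail
      | _ => clear H
      end
  | H : forall _, _ |- _ => clear H
  end; lia.

(** * Valuations on a field of characteristic 2 *)

Section Valuation.
Variable K : fieldType.
Hypothesis c2 : 2%:R = 0 :> K.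
Implicit Types x y z : K.

Lemma addKK x : x + x = 0.
Proof. by rewrite -mulr2n -mulr_natl c2 mul0r. Qed.

Lemma oppKK x : - x = x.
Proof. by apply/eqP; rewrite eq_sym -subr_eq0 opprK addKK. Qed.

Lemma add_eq0 x y : (x + y == 0) = (x == y).
Proof. by rewrite addr_eq0 oppKK. Qed.

Lemma addK2 x y : x + (x + y) = y.
Proof. by rewrite addrA addKK add0r. Qed.

(* v 0 is a junk value: [vge v m x] is the inequality v x >= m with the convention
   that the valuation of 0 is infinite. *)
Definition is_val (v : K -> int) :=
  (forall x y, x != 0 -> y != 0 -> v (x * y) = v x + v y) /\
  (forall x y, x != 0 -> y != 0 -> x + y != 0 ->
     forall m, m <= v x -> m <= v y -> m <= v (x + y)).

Definition vge (v : K -> int) (m : int) x := (x == 0) || (m <= v x).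

Variable v : K -> int.
Hypothesis hv : is_val v.

Lemma valM x y : x != 0 -> y != 0 -> v (x * y) = v x + v y.
Proof. exact: hv.1. Qed.

Lemma val1 : v 1 = 0.
Proof. by apply: (addrI (v 1)); rewrite addr0 -valM ?oner_neq0 // mulr1. Qed.

Lemma valV x : x != 0 -> v x^-1 = - v x.
Proof.
move=> x0; have := valM x0 (_ : x^-1 != 0); rewrite invr_eq0 => /(_ x0).
rewrite divff // val1; lia.
Qed.

Lemma valX x n : x != 0 -> v (x ^+ n) = n%:Z * v x.
Proof.
move=> x0; elim: n => [|n IH]; first by rewrite expr0 val1; lia.
rewrite exprS valM ?expf_neq0 // IH; lia.
Qed.

Lemma vge0 m : vge v m 0. Proof. by rewrite /vge eqxx. Qed.

Lemma vgeE m x : x != 0 -> vge v m x = (m <= v x).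
Proof. by rewrite /vge => /negbTE ->. Qed.

Lemma vge_val x : vge v (v x) x. Proof. by rewrite /vge lexx orbT. Qed.

Lemma vgeW m m' x : m' <= m -> vge v m x -> vge v m' x.
Proof. by move=> h; rewrite /vge; case: eqP => //= _; exact: le_trans. Qed.

Lemma vgeD m x y : vge v m x -> vge v m y -> vge v m (x + y).
Proof.
have [->|x0] := eqVneq x 0; first by rewrite add0r.
have [->|y0] := eqVneq y 0; first by rewrite addr0.
have [->|s0] := eqVneq (x + y) 0; first by rewrite vge0.
rewrite !vgeE //; exact: hv.2.
Qed.

Lemma vgeM m m' x y : vge v m x -> vge v m' y -> vge v (m + m') (x * y).
Proof.
have [->|x0] := eqVneq x 0; first by rewrite mul0r !vge0.
have [->|y0] := eqVneq y 0; first by rewrite mulr0 !vge0.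
rewrite !vgeE ?mulf_neq0 // valM //; lia.
Qed.

Lemma vgeX m n x : vge v m x -> vge v (n%:Z * m) (x ^+ n).
Proof.
move=> h; elim: n => [|n IH]; first by rewrite expr0 vgeE ?oner_neq0 // val1; lia.
rewrite exprS; apply: vgeW (vgeM h IH); lia.
Qed.

Lemma val_addl x y : x != 0 -> vge v (v x + 1) y -> x + y != 0 /\ v (x + y) = v x.
Proof.
move=> x0 hy; have [->|y0] := eqVneq y 0; first by rewrite addr0.
move: hy; rewrite vgeE // => hy.
have s0 : x + y != 0 by rewrite add_eq0; apply: contraTneq hy => ->; lia.
split=> //; apply/eqP; rewrite eq_le; apply/andP; split; last by apply: hv.2 => //; lia.
have e : (x + y) + y = x by rewrite -addrA addKK addr0.
rewrite leNgt; apply/negP => lt.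
have := hv.2 _ _ s0 y0; rewrite e => /(_ x0 (v x + 1)); lia.
Qed.

End Valuation.

(** * Multiplicity of an irreducible factor in a polynomial *)

Section Multiplicity.
Variable k : fieldType.
Implicit Types (p a b : {poly k}).

(** For p non-constant and a nonzero every j with p^j dividing a is below [size a], so the bounded
    maximum is the true multiplicity. For a = 0 the range is empty and the value is the default
    0. *)
Definition pmult p a : nat := \max_(i < size a | p ^+ i %| a) i.

Lemma pmult_dvd p a : a != 0 -> p ^+ pmult p a %| a.
Proof.
move=> a0; rewrite /pmult.
have sa : (0 < size a)%N by rewrite size_poly_gt0.
have [i ip ->] : {i0 | p ^+ (i0 : 'I_(size a)) %| a & \max_(i < size a | p ^+ i %| a) i = i0}.
  apply: eq_bigmax_cond; apply/card_gt0P; exists (Ordinal sa).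
  by rewrite /in_mem /= expr0; exact: dvd1p.
by [].
Qed.

Lemma pmult_ge p a j : (1 < size p)%N -> a != 0 -> p ^+ j %| a -> (j <= pmult p a)%N.
Proof.
move=> sp a0 ja.
have js : (j < size a)%N.
  have := dvdp_leq a0 ja.
  have p0 : p != 0 by rewrite -size_poly_gt0; lia.
  have : (0 < size (p ^+ j))%N by rewrite size_poly_gt0 expf_neq0.
  have : (j <= (size (p ^+ j)).-1)%N.
    by rewrite size_exp leq_pmull // -subn1 subn_gt0.
  case: (size (p ^+ j)) => // n jn _ na; exact: leq_ltn_trans jn na.
exact: (leq_bigmax_cond (Ordinal js)).
Qed.

Lemma pmult_factor p a : (1 < size p)%N -> a != 0 ->
  exists2 a1, a = p ^+ pmult p a * a1 & ~~ (p %| a1).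
Proof.
move=> sp a0; have := pmult_dvd p a0; rewrite dvdp_eq => /eqP e.
exists (a %/ p ^+ pmult p a); first by rewrite mulrC.
apply/negP => h; suff : (pmult p a < pmult p a)%N by rewrite ltnn.
by apply: pmult_ge => //; rewrite [X in _ %| X]e exprS dvdp_mul.
Qed.

Lemma pmult_eq p a j : irreducible_poly p -> ~~ (p %| a) ->
  pmult p (p ^+ j * a) = j.
Proof.
move=> ip pa; have sp := ip.1; have p0 := irredp_neq0 ip.
have a0 : a != 0 by apply: contra pa => /eqP ->; rewrite dvdp0.
have m0 : p ^+ j * a != 0 by rewrite mulf_neq0 ?expf_neq0.
have jm : (j <= pmult p (p ^+ j * a))%N by rewrite pmult_ge // dvdp_mulr.
apply/eqP; rewrite eqn_leq jm andbT leqNgt; apply/negP => lt.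
have : p ^+ j.+1 %| p ^+ j * a by apply: dvdp_trans (pmult_dvd p m0); rewrite dvdp_exp2l.
by rewrite exprS mulrC dvdp_mul2l ?expf_neq0 // (negbTE pa).
Qed.

Lemma irredp_dvdM p a b : irreducible_poly p -> (p %| a * b) = (p %| a) || (p %| b).
Proof.
move=> ip; apply/idP/idP => [h|/orP[h|h]]; last 2 first.
- by rewrite dvdp_mulr.
- by rewrite dvdp_mull.
have [//|pa] := boolP (p %| a); rewrite /=.
by rewrite -(@Gauss_dvdpr _ b a p) // irreducible_poly_coprime.
Qed.

Lemma pmultM p a b : irreducible_poly p -> a != 0 -> b != 0 ->
  pmult p (a * b) = (pmult p a + pmult p b)%N.
Proof.
move=> ip a0 b0.
have [a1 {1}-> pa] := pmult_factor ip.1 a0.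
have [b1 {1}-> pb] := pmult_factor ip.1 b0.
rewrite mulrACA -exprD pmult_eq //.
by rewrite irredp_dvdM // negb_or pa pb.
Qed.

Lemma pmultD p a b : irreducible_poly p -> a != 0 -> b != 0 -> a + b != 0 ->
  (minn (pmult p a) (pmult p b) <= pmult p (a + b))%N.
Proof.
move=> ip a0 b0 ab0; apply: pmult_ge => //; first exact: ip.1.
apply: dvdp_add; [apply: dvdp_trans (pmult_dvd p a0)|apply: dvdp_trans (pmult_dvd p b0)].
all: by apply: dvdp_exp2l; lia.
Qed.

Lemma pmult_gt0 p a : irreducible_poly p -> a != 0 -> (0 < pmult p a)%N = (p %| a).
Proof.
move=> ip a0; apply/idP/idP => [h|h]; last by apply: pmult_ge; rewrite ?expr1 //; exact: ip.1.
by apply: dvdp_trans (pmult_dvd p a0); rewrite -{1}(expr1 p) dvdp_exp2l.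
Qed.

Lemma pmult_deriv p a : irreducible_poly p -> a != 0 -> a^`() != 0 ->
  (pmult p a <= (pmult p a^`()).+1)%N.
Proof.
move=> ip a0 da0; have [a1 e pa] := pmult_factor ip.1 a0.
case: (pmult p a) e => // j e.
apply: pmult_ge => //; first exact: ip.1.
rewrite e derivM dvdp_add //; last by rewrite dvdp_mulr // dvdp_exp2l.
by apply: dvdp_mulr; rewrite deriv_exp /= -mulr_natl; do 2!apply: dvdp_mull.
Qed.

End Multiplicity.

(** Over a finite field the existence of a smaller divisor is decided by a search through
    coefficient vectors; a polynomial without one is irreducible. *)
Lemma exists_irredp (k : finFieldType) (b : {poly k}) : (1 < size b)%N ->
  exists2 p, irreducible_poly p & p %| b.
Proof.
have [n] := ubnP (size b); elim: n b => // n IH b sb b1.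
have [/existsP[r /andP[/andP[r1 r2] rb]]|] :=
  boolP [exists r : 'rV[k]_(size b),
    (1 < size (rVpoly r))%N && (size (rVpoly r) < size b)%N && (rVpoly r %| b)].
  have [|//|p ip pr] := IH (rVpoly r); first exact: leq_trans r2 sb.
  by exists p => //; exact: dvdp_trans rb.
rewrite negb_exists => /forallP h; exists b => //; split=> // q q1 qb.
have b0 : b != 0 by rewrite -size_poly_gt0; lia.
have sq := dvdp_leq b0 qb.
rewrite -dvdp_size_eqp // eqn_leq sq leqNgt; apply/negP => lt.
have := h (poly_rV q); rewrite poly_rV_K // qb lt !andbT; move: q1.
have : size q != 0 by rewrite size_poly_eq0; apply: contraTneq qb => ->; rewrite dvd0p.
by case: (size q) => [|[|]].
Qed.

(** * Places, product formula and derivation of the rational function field *)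

Section Fractions.
Variables (k : finFieldType) (K : fieldType) (io : {rmorphism {poly k} -> K}).
Variables (nm dn : K -> {poly k}).
Hypothesis io_inj : injective io.
Hypothesis dn_neq0 : forall x, dn x != 0.
Hypothesis fracE : forall x, x = io (nm x) / io (dn x).
Hypothesis k2 : forall c : k, c != 0 -> c = 1.
Implicit Types (x y z : K) (a b : {poly k}).

Lemma io_eq0 a : (io a == 0) = (a == 0).
Proof. by rewrite -(rmorph0 io) (inj_eq io_inj). Qed.

Lemma char2k : 2%:R = 0 :> k.
Proof.
apply/eqP; apply/negPn/negP => /k2 e.
by have /eqP := oner_neq0 k; apply; apply: (addrI 1); rewrite addr0 -{3}e.
Qed.

Lemma char2 : 2%:R = 0 :> K.
Proof. by rewrite -(rmorph_nat io) -polyC_natr char2k polyC0 rmorph0. Qed.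

Lemma char2p : 2%:R = 0 :> {poly k}.
Proof. by rewrite -polyC_natr char2k polyC0. Qed.

Lemma eq_fracP x a b a1 b1 : b != 0 -> b1 != 0 ->
  x = io a / io b -> x = io a1 / io b1 -> a * b1 = a1 * b.
Proof.
move=> b0 b10 e1 e2; apply: io_inj; rewrite !rmorphM.
by apply/eqP; rewrite -eqr_div ?io_eq0 // -e1 -e2.
Qed.

Lemma fracP x : exists a b, [/\ b != 0, x = io a / io b & (a == 0) = (x == 0)].
Proof.
exists (nm x), (dn x); split => //.
by rewrite [in RHS](fracE x) mulf_eq0 invr_eq0 !io_eq0 (negbTE (dn_neq0 x)) orbF.
Qed.

(** The part of a valuation that is visible on polynomials. The multiplicity of an irreducible
    factor and minus the degree are both instances, so that finite places and infinity extend to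
    fractions by one argument. *)
Definition is_mu (mu : {poly k} -> int) :=
  (forall a b, a != 0 -> b != 0 -> mu (a * b) = mu a + mu b) /\
  (forall a b, a != 0 -> b != 0 -> a + b != 0 -> forall m, m <= mu a -> m <= mu b -> m <= mu (a + b)).

Definition val (mu : {poly k} -> int) x : int := mu (nm x) - mu (dn x).

Section Val.
Variable mu : {poly k} -> int.
Hypothesis hmu : is_mu mu.
Notation v := (val mu).

Lemma val_frac a b : a != 0 -> b != 0 -> v (io a / io b) = mu a - mu b.
Proof.
move=> a0 b0; set x := io a / io b.
have x0 : x != 0 by rewrite mulf_neq0 ?invr_eq0 ?io_eq0.
have n0 : nm x != 0.
  by apply: contra x0 => /eqP e; rewrite (fracE x) e rmorph0 mul0r.
have := eq_fracP b0 (dn_neq0 x) (erefl x) (fracE x).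
move/(congr1 mu); rewrite !hmu.1 // /val; lia.
Qed.

Lemma val_io a : a != 0 -> v (io a) = mu a.
Proof.
move=> a0; have o0 : (1 : {poly k}) != 0 by exact: oner_neq0.
have e0 : mu 1 = 0 by apply: (addrI (mu 1)); rewrite addr0 -hmu.1 ?mulr1.
have -> : io a = io a / io 1 by rewrite rmorph1 divr1.
by rewrite val_frac // e0 subr0.
Qed.

Lemma fvalM x y : x != 0 -> y != 0 -> v (x * y) = v x + v y.
Proof.
have [a [b [b0 -> e]]] := fracP x; have [c [d [d0 -> e']]] := fracP y.
rewrite -e -e' => a0 c0.
rewrite mulf_div -!rmorphM !val_frac ?mulf_neq0 // !hmu.1 //; lia.
Qed.

Lemma fvalD x y : x != 0 -> y != 0 -> x + y != 0 ->
  forall m, m <= v x -> m <= v y -> m <= v (x + y).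
Proof.
have [a [b [b0 ex e]]] := fracP x; have [c [d [d0 ey e']]] := fracP y.
rewrite -e -e' => a0 c0.
have -> : x + y = io (a * d + c * b) / io (b * d).
  by rewrite ex ey addf_div ?io_eq0 // rmorphD !rmorphM.
move=> s0 m; have n0 : a * d + c * b != 0.
  by apply: contra s0 => /eqP ->; rewrite rmorph0 mul0r.
rewrite ex ey !val_frac ?mulf_neq0 // hmu.1 // => h1 h2.
rewrite lerBrDr; apply: hmu.2; rewrite ?mulf_neq0 // hmu.1 //; lia.
Qed.

Lemma is_val_val : is_val v.
Proof. by split; [exact: fvalM|exact: fvalD]. Qed.

End Val.

Definition vpi p := val (fun a => (pmult p a)%:Z).
Definition vinf := val (fun a => - ((size a).-1)%:Z).

Lemma is_mu_pi p : irreducible_poly p -> is_mu (fun a => (pmult p a)%:Z).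
Proof.
move=> ip; split=> a b a0 b0; first by rewrite pmultM // PoszD.
move=> s0 m h1 h2; apply: le_trans (_ : (minn (pmult p a) (pmult p b))%:Z <= _); first by lia.
by rewrite lez_nat; exact: pmultD.
Qed.

Lemma is_mu_inf : is_mu (fun a => - ((size a).-1)%:Z).
Proof.
split=> a b a0 b0.
  have := size_mul a0 b0; rewrite -size_poly_gt0 in a0; rewrite -size_poly_gt0 in b0.
  move=> ->; move: a0 b0; case: (size a) => // n; case: (size b) => // m _ _.
  by rewrite addSn addnS /=; lia.
move=> s0 m; have := size_polyD a b.
rewrite -!size_poly_gt0 in a0 b0 s0; move: a0 b0 s0.
case: (size a) => // n; case: (size b) => // n'; case: (size (a + b)) => // l; lia.
Qed.

(** In lowest terms an element without finite poles has a constant denominator, so it is a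
    polynomial and its degree is not negative. It is applied to quotients that would have positive
    valuation at infinity. *)
Lemma product_formula x : x != 0 ->
  (forall p, irreducible_poly p -> 0 <= vpi p x) -> vinf x <= 0.
Proof.
move=> x0 h; have [a [b [b0 ex e]]] := fracP x.
have a0 : a != 0 by rewrite e.
set g := gcdp a b.
have g0 : g != 0 by rewrite gcdp_eq0 negb_and a0.
have ea : a = a %/ g * g by rewrite divpK ?dvdp_gcdl.
have eb : b = b %/ g * g by rewrite divpK ?dvdp_gcdr.
set a1 := a %/ g; set b1 := b %/ g.
have a10 : a1 != 0 by apply: contra a0 => /eqP z; rewrite ea -/a1 z mul0r.
have b10 : b1 != 0 by apply: contra b0 => /eqP z; rewrite eb -/b1 z mul0r.
have cop : coprimep a1 b1 by apply: coprimep_div_gcd; rewrite a0.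
have e1 : x = io a1 / io b1.
  rewrite ex ea eb -/a1 -/b1 !rmorphM -mulf_div divff ?mulr1 // io_eq0 //.
have [sb|sb] := ltnP 1 (size b1).
  have [p ip pb] := exists_irredp sb.
  have pa : ~~ (p %| a1).
    apply/negP => pa; have := coprimepP _ _ cop p pa pb.
    by rewrite -size_poly_eq1; have := ip.1; case: (size p) => [|[]].
  have := h p ip; rewrite /vpi e1 val_frac //; last exact: is_mu_pi.
  rewrite -(pmult_gt0 ip b10) in pb; rewrite -(pmult_gt0 ip a10) in pa.
  lia.
rewrite /vinf e1 val_frac //; last exact: is_mu_inf.
move: sb; rewrite -!size_poly_gt0 in a10 b10; move: a10 b10.
case: (size a1) => // n; case: (size b1) => // m; lia.
Qed.

Definition der x : K :=
  io ((nm x)^`() * dn x + nm x * (dn x)^`()) / io (dn x) ^+ 2.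

Lemma der_frac a b : b != 0 ->
  der (io a / io b) = io (a^`() * b + a * b^`()) / io b ^+ 2.
Proof.
move=> b0; set x := io a / io b; rewrite /der.
have d0 := dn_neq0 x; set n := nm x; set d := dn x.
have E := eq_fracP b0 d0 (erefl x) (fracE x); rewrite -/n -/d in E.
have E' := congr1 (fun p => p^`()) E; rewrite /= !derivM in E'.
apply/eqP; rewrite eqr_div ?expf_neq0 ?io_eq0 // -!rmorphXn -!rmorphM; apply/eqP; congr (io _).
have c2 := char2p.
(* By [E'] and [E] each bracket on the right is a sum of two equal terms, hence 0: the two
   quotient-rule expressions agree. *)
have H : (n^`() * d + n * d^`()) * b ^+ 2 + (a^`() * b + a * b^`()) * d ^+ 2
   = (d * b) * (n^`() * b + n * b^`() + (a^`() * d + a * d^`()))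
     + (n * b + a * d) * (b * d^`() + d * b^`()) by ring: c2.
apply/eqP; rewrite -subr_eq0; move: H.
rewrite -E' -E.
have z (q : {poly k}) : q + q = 0 by rewrite -mulr2n -mulr_natl c2 mul0r.
rewrite !z mulr0 mul0r addr0 => /eqP H.
rewrite -(addrK ((a^`() * b + a * b^`()) * d ^+ 2) (_ * b ^+ 2)) (eqP H) add0r.
by rewrite -opprD z oppr0.
Qed.

Lemma der_io a : der (io a) = io a^`().
Proof.
rewrite -{1}(divr1 (io a)) -(rmorph1 io) der_frac ?oner_neq0 //.
by rewrite -polyC1 derivC mulr0 addr0 polyC1 mulr1 rmorph1 expr1n divr1.
Qed.

Lemma der0 : der 0 = 0.
Proof. by rewrite -(rmorph0 io) der_io deriv0. Qed.

Lemma derD x y : der (x + y) = der x + der y.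
Proof.
have [a [b [b0 -> _]]] := fracP x; have [c [d [d0 -> _]]] := fracP y.
have B : io b != 0 by rewrite io_eq0.
have Dn : io d != 0 by rewrite io_eq0.
rewrite addf_div // -!rmorphM -!rmorphD !der_frac ?mulf_neq0 // !derivD !derivM.
rewrite !(rmorphD, rmorphM) /=.
by have c2 := char2; field: c2; rewrite B Dn.
Qed.

Lemma derM x y : der (x * y) = der x * y + x * der y.
Proof.
have [a [b [b0 -> _]]] := fracP x; have [c [d [d0 -> _]]] := fracP y.
have B : io b != 0 by rewrite io_eq0.
have Dn : io d != 0 by rewrite io_eq0.
rewrite mulf_div -!rmorphM !der_frac ?mulf_neq0 // !derivM.
rewrite !(rmorphD, rmorphM) /=.
by field; rewrite B Dn.
Qed.

Lemma der_sqr x : der (x ^+ 2) = 0.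
Proof. by rewrite expr2 derM mulrC (addKK char2). Qed.

(** Differentiation lowers the degree. This gain of one is what makes the products of Wronskians
    positive at infinity. *)
Lemma der_vinf x : vge vinf (vinf x + 1) (der x).
Proof.
have [a [b [b0 ex e]]] := fracP x.
have [-> |d0] := eqVneq (der x) 0; first exact: vge0.
have x0 : x != 0.
  apply: contra d0 => /eqP ->; rewrite -(rmorph0 io) der_io deriv0 rmorph0 //.
have a0 : a != 0 by rewrite e.
move: d0; rewrite ex der_frac // => d0.
have n0 : a^`() * b + a * b^`() != 0.
  by apply: contra d0 => /eqP ->; rewrite rmorph0 mul0r.
rewrite vgeE // -rmorphXn /vinf !val_frac ?expf_neq0 //; try exact: is_mu_inf.
rewrite expr2 (is_mu_inf.1 _ _ b0 b0).
have s1 : (size (a^`() * b + a * b^`())%R <= (size a + size b).-2)%N.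
  have hd (c : {poly k}) : c != 0 -> (size c^`() <= (size c).-1)%N.
    by move=> c0; have := lt_size_deriv c0; case: (size c).
  apply: (leq_trans (size_polyD _ _)); rewrite geq_max; apply/andP; split.
    apply: (leq_trans (size_polyMleq _ _)); have := hd _ a0.
    rewrite -!size_poly_gt0 in a0 b0; move: a0 b0.
    by case: (size a) => // n; case: (size b) => // m; lia.
  apply: (leq_trans (size_polyMleq _ _)); have := hd _ b0.
  rewrite -!size_poly_gt0 in a0 b0; move: a0 b0.
  by case: (size a) => // n; case: (size b) => // m; lia.
move: s1; rewrite -!size_poly_gt0 in a0 b0 n0; move: a0 b0 n0.
case: (size a) => // n; case: (size b) => // m; case: (size (a^`() * b + a * b^`())) => // l; lia.
Qed.

(** The multiplicity of p drops by at most one under differentiation. For integral x the common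
    power of p is cancelled first, after which the denominator is prime to p and nothing is lost. *)
Lemma der_vpi_both p x : irreducible_poly p ->
  vge (vpi p) (vpi p x - 1) (der x) /\
  (0 <= vpi p x -> vge (vpi p) 0 (der x)).
Proof.
move=> ip; have hm := is_mu_pi ip; have hv : is_val (vpi p) := is_val_val hm.
have vio c : c != 0 -> vpi p (io c) = (pmult p c)%:Z := val_io hm (a := c).
have sp := ip.1; have p0 := irredp_neq0 ip.
have [a [b [b0 ex e]]] := fracP x.
have [-> |x0] := eqVneq x 0.
  by rewrite der0 !vge0.
have a0 : a != 0 by rewrite e.
have dp (c : {poly k}) : c != 0 -> vge (vpi p) ((pmult p c)%:Z - 1) (io c^`()).
  move=> c0; have [->|dc0] := eqVneq c^`() 0; first by rewrite rmorph0 vge0.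
  rewrite vgeE ?io_eq0 // vio // lerBlDr -[1]/(1%:Z) -PoszD lez_nat addn1.
  exact: pmult_deriv.
have dp0 (c : {poly k}) : vge (vpi p) 0 (io c).
  have [->|c0] := eqVneq c 0; first by rewrite rmorph0 vge0.
  by rewrite vgeE ?io_eq0 // vio //.
have dpc (c : {poly k}) : c != 0 -> vge (vpi p) (pmult p c)%:Z (io c).
  by move=> c0; rewrite vgeE ?io_eq0 // vio.
have vx : vpi p x = (pmult p a)%:Z - (pmult p b)%:Z by rewrite ex /vpi (val_frac hm).
have gen : vge (vpi p) (vpi p x - 1) (der x).
  rewrite {2}ex der_frac // vx.
  have h : vge (vpi p) (- 2%:Z * (pmult p b)%:Z) (io b ^+ 2)^-1.
    rewrite vgeE ?invr_eq0 ?expf_neq0 ?io_eq0 // (valV hv) ?expf_neq0 ?io_eq0 //.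
    by rewrite (valX hv) ?io_eq0 // vio //; lia.
  apply: vgeW (vgeM hv _ h); last first.
    rewrite rmorphD !rmorphM; apply: (vgeD hv).
      exact: (vgeM hv (dp _ a0) (dpc _ b0)).
    apply: vgeW (vgeM hv (dpc _ a0) (dp _ b0)).
    lia.
  lia.
split=> // h0.
have [a1 ea pa] := pmult_factor sp a0; have [b1 eb pb] := pmult_factor sp b0.
  have ab : (pmult p b <= pmult p a)%N by move: h0; rewrite vx; lia.
  have b10 : b1 != 0 by apply: contra b0 => /eqP z; rewrite eb z mulr0.
  have -> : x = io (p ^+ (pmult p a - pmult p b) * a1) / io b1.
    rewrite {1}ex {1}ea {1}eb -{1}(subnKC ab) exprD -mulrA !(rmorphM io (p ^+ pmult p b)).
    by rewrite -mulf_div divff ?mul1r // io_eq0 expf_neq0.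
  rewrite der_frac //; apply: (@vgeW _ _ (0 + 0)) => //; apply: (vgeM hv) => //.
  rewrite vgeE ?invr_eq0 ?expf_neq0 ?io_eq0 // (valV hv) ?expf_neq0 ?io_eq0 //.
  rewrite (valX hv) ?io_eq0 // vio //.
  by move: pb; rewrite -pmult_gt0 //; lia.
Qed.

End Fractions.

(** * The additive module, Wronskians and the cubic *)

Section Module.
Variable K : fieldType.
Hypothesis c2 : 2%:R = 0 :> K.
Implicit Types x y z : K.

Lemma sqrK2D x y : (x + y) ^+ 2 = x ^+ 2 + y ^+ 2.
Proof. by ring: c2. Qed.

(** The constant term t stays a parameter: the action of T + 1 has the same shape with t + 1 in
    place of t, so X and X + 1 are treated together. *)
Definition phi (t g D x : K) : K := t * x + g * x ^+ 2 + D * x ^+ 4.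

Lemma phiD t g D x y : phi t g D (x + y) = phi t g D x + phi t g D y.
Proof. by rewrite /phi -[4%N]/(2 * 2)%N !exprM !sqrK2D; ring. Qed.

Lemma phi0 t g D : phi t g D 0 = 0.
Proof. by rewrite /phi !expr0n /= !mulr0 !addr0. Qed.

(** The A-submodule generated by z; over F_2 sums already account for scalars. *)
Inductive gen (t g D z : K) : K -> Prop :=
| gen0 : gen t g D z 0
| gen_id : gen t g D z z
| genD x y : gen t g D z x -> gen t g D z y -> gen t g D z (x + y)
| genf x : gen t g D z x -> gen t g D z (phi t g D x).

Definition closed_mod t g D (s : seq K) :=
  (forall x y, x \in s -> y \in s -> x + y \in s) /\
  (forall x, x \in s -> phi t g D x \in s).

Lemma gen_closed t g D s z x : closed_mod t g D s -> z \in s -> gen t g D z x -> x \in s.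
Proof.
move=> [sD sf] zs; elim=> // [|x1 y1 _ h1 _ h2|x1 _ h1]; [|exact: sD|exact: sf].
by rewrite -(addKK c2 z) sD.
Qed.

Lemma gen_trans t g D z x y : gen t g D z x -> gen t g D x y -> gen t g D z y.
Proof.
move=> h; elim=> [||x1 y1 _ h1 _ h2|x1 _ h1] //; [exact: gen0|exact: genD|exact: genf].
Qed.

Definition derivation (d : K -> K) :=
  (forall x y, d (x + y) = d x + d y) /\ (forall x y, d (x * y) = d x * y + x * d y).

Section Wronskian.
Variable d : K -> K.
Hypothesis hd : derivation d.

Lemma d0 : d 0 = 0.
Proof. by have := hd.1 0 0; rewrite addr0 addKK. Qed.

Lemma d_sqr x : d (x ^+ 2) = 0.
Proof. by rewrite expr2 hd.2 mulrC addKK. Qed.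

Definition W x y := d x * y + x * d y.

Lemma Wxx x : W x x = 0.
Proof. by rewrite /W mulrC addKK. Qed.

Lemma WC x y : W x y = W y x.
Proof. by rewrite /W addrC mulrC [d x * y]mulrC. Qed.

Lemma WDr x y z : W x (y + z) = W x y + W x z.
Proof. by rewrite /W hd.1; ring. Qed.

Lemma WDl x y z : W (x + y) z = W x z + W y z.
Proof. by rewrite /W hd.1; ring. Qed.

Lemma Wxr x y : W x (x + y) = W x y.
Proof. by rewrite WDr Wxx add0r. Qed.

(** This identifies the vanishing of [W x y] with (x / y)' = 0, that is, in the rational function
    field, with x / y being a square. Hence the equivalence relation of [W_trans]. *)
Lemma W_quot x y : y != 0 -> W x y = y ^+ 2 * d (x / y).
Proof.
move=> y0; have e : x = x / y * y by rewrite divfK.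
rewrite /W {1}e hd.2; set u := x / y; rewrite [in X in _ + X]e -/u.
by ring: c2.
Qed.

Lemma W_trans x y z : y != 0 -> W x y = 0 -> W y z = 0 -> W x z = 0.
Proof.
move=> y0 h1 h2; have : y * W x z = z * W x y + x * W y z by rewrite /W; ring: c2.
by rewrite h1 h2 !mulr0 addr0 => /eqP; rewrite mulf_eq0 (negbTE y0) => /eqP.
Qed.

(* Along a class of proportional-up-to-squares elements x = y u, with u' = 0, the
   equation (phi x / x)' = 0 is a cubic equation for u with constant term t' = 1. *)
Lemma cubic t g D y x : d t = 1 -> y != 0 -> x != 0 -> W x y = 0 ->
  W (phi t g D x) x = 0 ->
  d (D * y ^+ 3) * (x / y) ^+ 3 + d (g * y) * (x / y) + 1 = 0.
Proof.
move=> dt y0 x0; rewrite W_quot // => /eqP.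
rewrite mulf_eq0 expf_eq0 (negbTE y0) /= => /eqP hu.
rewrite W_quot // => /eqP; rewrite mulf_eq0 expf_eq0 (negbTE x0) /= => /eqP.
have -> : phi t g D x / x = t + (g * y) * (x / y) + (D * y ^+ 3) * (x / y) ^+ 3.
  by rewrite /phi; field; rewrite x0 y0.
have d3 u : d u = 0 -> d (u ^+ 3) = 0.
  by move=> h; rewrite exprS hd.2 d_sqr h mul0r mulr0 addr0.
rewrite !hd.1 !(hd.2 _ (x / y)) !(hd.2 _ (_ ^+ 3)) hu (d3 _ hu) !mulr0 !addr0 dt => <-.
by ring.
Qed.

Lemma cubic_four (a b u1 u2 u3 u4 : K) :
  uniq [:: u1; u2; u3; u4] ->
  (forall u, u \in [:: u1; u2; u3; u4] -> a * u ^+ 3 + b * u + 1 = 0) -> False.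
Proof.
move=> hu h; pose p : {poly K} := a *: 'X^3 + b *: 'X + 1.
have p1 : p`_0 = 1 by rewrite /p !coefD !coefZ coefXn coefX coef1 /= !mulr0 !add0r.
have p0 : p != 0 by apply: contra_eq_neq p1 => ->; rewrite coef0 eq_sym oner_neq0.
have r : all (root p) [:: u1; u2; u3; u4].
  by apply/allP => u hu'; apply/eqP; rewrite -[RHS](h u hu') /p !hornerE; try ring.
have := max_poly_roots p0 r hu.
have : (size p <= 4)%N.
  rewrite /p; apply: (leq_trans (size_polyD _ _)); rewrite geq_max size_poly1 andbT.
  apply: (leq_trans (size_polyD _ _)); rewrite geq_max.
  rewrite (leq_trans (size_scale_leq _ _)) ?size_polyXn //.
  by rewrite (leq_trans (size_scale_leq _ _)) ?size_polyX.
by rewrite /= => h1 h2; have := leq_trans h2 h1.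
Qed.

(** After division by the first point the four points become distinct roots of the polynomial of
    [cubic]. Every case that uses the product formula ends here. *)
Lemma four_equiv t g D (l : seq K) : d t = 1 -> size l = 4 -> uniq l -> 0 \notin l ->
  (forall x y, x \in l -> y \in l -> W x y = 0) ->
  (forall x, x \in l -> W (phi t g D x) x = 0) -> False.
Proof.
case: l => [|x1 [|x2 [|x3 [|x4 []]]]] //= dt _ hu n0 hW hf.
have x10 : x1 != 0 by apply: contraNneq n0 => ->; rewrite inE eqxx.
apply: (@cubic_four (d (D * x1 ^+ 3)) (d (g * x1)) (x1 / x1) (x2 / x1) (x3 / x1) (x4 / x1)).
  rewrite -[X in uniq X]/(map (fun x => x / x1) [:: x1; x2; x3; x4]).
  by rewrite map_inj_uniq //; apply: divIf.
move=> u /(mapP (f := fun x => x / x1) (s := [:: x1; x2; x3; x4])) [x xl ->].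
apply: (@cubic t) => //; last exact: hf.
  by apply: contraNneq n0 => <-.
by apply: hW => //; rewrite inE eqxx.
Qed.

End Wronskian.
End Module.

(** Pattern of the valuations of x, z and x + z for torsion points with poles: the least value is
    taken twice and is at most twice the third. Both effects reflect the Newton polygon of phi over
    F_2. *)
Definition is_line (p q r : int) :=
  (p = q /\ p < r /\ p <= 2%:Z * r) \/ (p = r /\ p < q /\ p <= 2%:Z * q) \/
  (q = r /\ q < p /\ q <= 2%:Z * p).

(** The same pattern with names for its values, on the three nonzero elements of an F_2-plane: r is
    the exceptional value and q the repeated one. *)
Definition is_plane (r q a b c : int) :=
  ((c = r /\ a = q /\ b = q) \/ (b = r /\ a = q /\ c = q) \/ (a = r /\ b = q /\ c = q))
  /\ q <= 2%:Z * r.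

Lemma line_plane a b c : is_line a b c -> exists r q, is_plane r q a b c /\ q < r.
Proof.
case=> [[-> [h1 h2]]|[[-> [h1 h2]]|[-> [h1 h2]]]].
- by exists c, b; split=> //; split=> //; left.
- by exists b, c; split=> //; split=> //; right; left.
- by exists a, c; split=> //; split=> //; right; right.
Qed.

(** * Torsion points and their derivatives at one finite place *)

Section Local.
Variable K : fieldType.
Hypothesis c2 : 2%:R = 0 :> K.
Implicit Types x y z : K.
Variable d : K -> K.
Hypothesis hd : derivation d.
Variable v : K -> int.
Hypothesis hv : is_val v.
Hypothesis hd1 : forall x, vge v (v x - 1) (d x).
Hypothesis hd0 : forall x, 0 <= v x -> vge v 0 (d x).
Variables t g D : K.
Hypothesis ht : vge v 0 t.
Hypothesis dt : d t = 1.
Hypothesis D0 : D != 0.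
Hypothesis g01 : g = 0 \/ g = 1.
Variable s : seq K.
Hypothesis hs : closed_mod t g D s.
Notation f := (phi t g D).
Notation W := (W d).

Lemma W_vge m a b x y : vge v a (d x) -> vge v b (d y) ->
  m <= a + v y -> m <= v x + b -> vge v m (W x y).
Proof.
move=> ha hb h1 h2; apply: (vgeD hv).
  exact: vgeW h1 (vgeM hv ha (vge_val _ _)).
exact: vgeW h2 (vgeM hv (vge_val _ _) hb).
Qed.

(** Here x / y is a unit, so its derivative is integral and [W_quot] loses nothing. *)
Lemma W_eqval x y : x != 0 -> y != 0 -> v x = v y -> vge v (v x + v y) (W x y).
Proof.
move=> x0 y0 e; rewrite (W_quot c2 hd) //.
have : vge v 0 (d (x / y)).
  by apply: hd0; rewrite (valM hv) ?invr_eq0 // (valV hv) // e subrr.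
move/(vgeM hv (vgeX hv 2 (vge_val v y))); apply: vgeW; zlia.
Qed.

Lemma vge_g m x : (g = 1 -> vge v m x) -> vge v m (g * x).
Proof. by case: g01 => -> h; rewrite ?mul0r ?vge0 // mul1r; exact: h. Qed.

(** For x != 0 these conditions say that none of the three terms of [f x] has smaller valuation than
    x. *)
Definition zone x := (0 <= 3%:Z * v x + v D) && ((g == 0) || (0 <= v x)).

Lemma zone_f x : x != 0 -> zone x -> vge v (v x) (f x).
Proof.
move=> x0 /andP[z1 z2]; apply: (vgeD hv); first apply: (vgeD hv).
- by apply: vgeW (vgeM hv ht (vge_val v x)); zlia.
- apply: vge_g => g1; move: z2; rewrite g1 oner_eq0 /= => z2.
  by apply: vgeW (vgeX hv 2 (vge_val v x)); zlia.
- by apply: vgeW (vgeM hv (vge_val v D) (vgeX hv 4 (vge_val v x))); zlia.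
Qed.

Lemma zone_le x y : zone x -> v x <= v y -> zone y.
Proof. rewrite /zone; case: (g == 0) => //=; zlia. Qed.

Lemma zone_gen z x : z != 0 -> zone z -> gen t g D z x -> vge v (v z) x.
Proof.
move=> z0 hz; elim=> [||x1 y1 _ h1 _ h2|x1 _ h1]; rewrite ?vge0 ?vge_val //.
  exact: (vgeD hv).
have [->|x10] := eqVneq x1 0; first by rewrite (phi0 t g D) vge0.
move: h1; rewrite vgeE // => h1.
exact: vgeW h1 (zone_f x10 (zone_le hz h1)).
Qed.

(** Used in both directions: points that generate each other have equal valuations as soon as one of
    them is in the zone. *)
Lemma zone_gen2 z x : z != 0 -> x != 0 -> zone z -> gen t g D z x -> v z <= v x /\ zone x.
Proof.
move=> z0 x0 hz hg; have := zone_gen z0 hz hg; rewrite vgeE // => h.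
by split=> //; exact: zone_le hz h.
Qed.

Lemma bounded : exists B, forall x, x \in s -> B <= v x.
Proof.
elim: s => [|x l [B hB]]; first by exists 0.
exists (if B <= v x then B else v x) => y; rewrite inE => /orP[/eqP->|/hB h]; case: ifP; zlia.
Qed.

(** A finite list has bounded valuations, so no class of points can be mapped into itself by f with
    strictly decreasing valuation. *)
Lemma escape (C : K -> Prop) :
  (forall x, x \in s -> x != 0 -> C x -> [/\ f x != 0, C (f x) & v (f x) < v x]) ->
  forall x, x \in s -> x != 0 -> ~ C x.
Proof.
move=> h x xs x0 Cx; have [B hB] := bounded.
have [n] : exists n : nat, v x < B + n%:Z.
  by exists (`|v x - B|%N).+1; zlia.
elim: n x xs x0 Cx => [|n IH] x xs x0 Cx; first by have := hB x xs; zlia.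
move=> lt; have [f0 Cf lf] := h x xs x0 Cx.
by apply: (IH (f x)) => //; [exact: hs.2|lia].
Qed.

Lemma val_f_D x : x != 0 -> 3%:Z * v x + v D < 0 -> (g = 1 -> 2%:Z * v x + v D < 0) ->
  f x != 0 /\ v (f x) = v D + 4%:Z * v x.
Proof.
move=> x0 h1 h2; have e : v (D * x ^+ 4) = v D + 4%:Z * v x.
  by rewrite (valM hv) ?expf_neq0 // (valX hv).
rewrite -e /phi addrC; apply: (val_addl c2 hv); first by rewrite mulf_neq0 ?expf_neq0.
rewrite e; apply: (vgeD hv).
- by apply: vgeW (vgeM hv ht (vge_val v x)); zlia.
- apply: vge_g => g1; move: (h2 g1) => h3.
  by apply: vgeW (vgeX hv 2 (vge_val v x)); zlia.
Qed.

(** In every other situation [D x^4] dominates [f x] and the orbit escapes. What remains is the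
    analogue of Tate reduction: the square term dominates above the floor - v(D) / 2, and no torsion
    point lies below it. *)
Lemma nonzone x : x \in s -> x != 0 -> ~~ zone x -> [/\ g = 1, 0 < v D, v x < 0 & 0 <= 2%:Z * v x + v D].
Proof.
move=> xs x0; rewrite /zone.
have esc1 : (g = 0 \/ v D <= 0) -> ~ (3%:Z * v x + v D < 0).
  move=> hh; apply: (@escape (fun x => 3%:Z * v x + v D < 0)) => // y ys y0 hy.
  have [] := val_f_D y0 hy; first by case: hh => [->|? _]; [move/eqP; rewrite eq_sym oner_eq0|lia].
  by move=> f0 e; split=> //; rewrite e; zlia.
case: g01 => g1.
  by rewrite g1 eqxx /= andbT => h; case: esc1; [left|lia].
rewrite g1 oner_eq0 /= => h.
have [D1|D1] := lerP (v D) 0; first by case: esc1; [right|lia].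
have x1 : v x < 0 by zlia.
split=> //; rewrite leNgt; apply/negP.
apply: (@escape (fun x => 2%:Z * v x + v D < 0)) => // y ys y0 hy.
have [||f0 e] := val_f_D y0; [lia|by []|].
by split=> //; rewrite e; zlia.
Qed.

Definition neg x := [&& x \in s, x != 0 & v x < 0].

Lemma negP3 x : neg x -> [/\ x \in s, x != 0 & v x < 0].
Proof. by case/and3P. Qed.

Section Tate.
Hypothesis g1 : g = 1.
Hypothesis D1 : 0 < v D.

Lemma neg_nonzone x : neg x -> ~~ zone x.
Proof. by case/and3P => _ _ h; rewrite /zone g1 oner_eq0 /=; zlia. Qed.

Lemma top x : neg x -> 0 <= 2%:Z * v x + v D.
Proof. by move=> h; case/and3P: (h) => xs x0 _; have [] := nonzone xs x0 (neg_nonzone h). Qed.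

Lemma dbl x : neg x -> 0 < 2%:Z * v x + v D -> neg (f x) /\ v (f x) = 2%:Z * v x.
Proof.
case/and3P => xs x0 h h2.
have e2 : v (x ^+ 2) = 2%:Z * v x by rewrite (valX hv).
have [] : f x != 0 /\ v (f x) = 2%:Z * v x.
  rewrite -e2 /phi g1 mul1r -addrA addrCA; apply: (val_addl c2 hv); first by rewrite expf_neq0.
  rewrite e2; apply: (vgeD hv).
  - by apply: vgeW (vgeM hv ht (vge_val v x)); zlia.
  - by apply: vgeW (vgeM hv (vge_val v D) (vgeX hv 4 (vge_val v x))); zlia.
by move=> f0 e; split=> //; rewrite /neg f0 e hs.2 //=; zlia.
Qed.

(** f doubles both valuations until the lower point reaches the floor - v(D) / 2; there the claim is
    [top] for [f x]. *)
Lemma double x y : neg x -> neg y -> v y < v x -> v y <= 2%:Z * v x.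
Proof.
have [n] : exists n : nat, 2%:Z * v y + v D < n%:Z by exists (`|(2%:Z * v y + v D)%R|%N).+1; zlia.
elim: n x y => [|n IH] x y lt nx ny xy; first by have := top ny; zlia.
have ty := top ny; have tx := top nx; have [_ _ y1] := and3P ny; have [_ _ x1] := and3P nx.
have [fx ex] := dbl nx ltac:(zlia).
have [e|ne] := leP (2%:Z * v y + v D) 0; first by have := top fx; zlia.
have [fy ey] := dbl ny ltac:(zlia).
have := IH _ _ _ fx fy; rewrite ex ey; zlia.
Qed.

(** At the floor f z = t z + z^2 (1 + D z^2), and [top] keeps [f z] from going below v(z). So the
    bracket must make up for the z^2. *)
Lemma top_unit z : neg z -> 2%:Z * v z + v D = 0 -> vge v 1 (1 + D * z ^+ 2).
Proof.
move=> nz ez; have [zs z0 z1] := negP3 nz.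
have hf : vge v (v z) (f z).
  have [->|fz0] := eqVneq (f z) 0; first exact: vge0.
  rewrite vgeE //; have [h|h] := ltP (v (f z)) 0; last exact: le_trans (ltW z1) h.
  have /top : neg (f z) by rewrite /neg fz0 h hs.2.
  zlia.
have -> : 1 + D * z ^+ 2 = (f z + t * z) * (z ^-1) ^+ 2.
  by rewrite /phi g1; field: c2.
have h2 : vge v (v z) (f z + t * z).
  by apply: (vgeD hv) => //; apply: vgeW (vgeM hv ht (vge_val v z)); zlia.
apply: vgeW (vgeM hv h2 (vgeX hv 2 (vge_val v z^-1))).
by rewrite (valV hv) //; zlia.
Qed.

(** At the floor D x^2 and D y^2 are both congruent to 1, so their sum is small. Above it f doubles
    the valuations of x, y and x + y, and a counterexample would be carried down to the floor. *)
Lemma same x y : neg x -> neg y -> v x = v y -> vge v (v x + 1) (x + y).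
Proof.
have [n] : exists n : nat, 2%:Z * v x + v D < n%:Z by exists (`|(2%:Z * v x + v D)%R|%N).+1; zlia.
elim: n x y => [|n IH] x y lt nx ny xy; first by have := top nx; zlia.
have tx := top nx; have [xs x0 x1] := negP3 nx; have [ys y0 y1] := negP3 ny.
have [s0|s0] := eqVneq (x + y) 0; first by rewrite s0 vge0.
rewrite vgeE //.
have [le0|ne] := leP (2%:Z * v x + v D) 0.
  have e : 2%:Z * v x + v D = 0 by zlia.
  have := vgeD hv (top_unit nx e) (top_unit ny (etrans (congr1 (fun n => 2%:Z * n + v D) (esym xy)) e)).
  have -> : 1 + D * x ^+ 2 + (1 + D * y ^+ 2) = D * (x + y) ^+ 2 by ring: c2.
  rewrite vgeE ?mulf_neq0 ?expf_neq0 // (valM hv) ?expf_neq0 // (valX hv) //; zlia.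
rewrite leNgt; apply/negP => lt2.
have hge : v x <= v (x + y) by rewrite -(vgeE _ _ s0); apply: (vgeD hv); rewrite vgeE //; zlia.
have e : v (x + y) = v x by zlia.
have ns : neg (x + y) by rewrite /neg s0 e x1 hs.1.
have [fs es] := dbl ns ltac:(zlia); have [fx ex] := dbl nx ltac:(zlia).
have [fy ey] := dbl ny ltac:(zlia).
have := IH _ _ _ fx fy; rewrite ex ey -xy -(phiD c2) => /(_ ltac:(zlia) erefl).
have [_ fs0 _] := negP3 fs; rewrite vgeE // es e; zlia.
Qed.

Lemma neg_max x : neg x -> exists y, neg y /\ forall z, neg z -> v z <= v y.
Proof.
move=> nx.
suff [y [ny hy]] : exists y, neg y /\ forall z, z \in s -> neg z -> v z <= v y.
  by exists y; split=> // z nz; apply: hy => //; case/and3P: nz.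
elim: s => [|w l [y [ny hy]]]; first by exists x.
have [/andP[n1 n2]|nw] := boolP (neg w && (v y <= v w)).
  exists w; split=> // z; rewrite inE => /orP[/eqP->//|/hy h /h]; zlia.
exists y; split=> // z; rewrite inE => /orP[/eqP-> nz|/hy//].
by move: nw; rewrite nz /=; zlia.
Qed.

Variable y0 : K.
Hypothesis ny0 : neg y0.
Hypothesis maxy0 : forall z, neg z -> v z <= v y0.

Lemma iter_y k : 0 < (2 ^+ k.+1) * v y0 + v D ->
  neg (iter k f y0) /\ v (iter k f y0) = 2 ^+ k * v y0.
Proof.
have [_ _ h1] := negP3 ny0.
elim: k => [|k IH] h /=; first by rewrite expr0 mul1r.
have h2 : 0 < (2 ^+ k.+1) * v y0 + v D.
  have : 0 < (2 ^+ k.+1 : int) by rewrite exprn_gt0.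
  move: h; rewrite exprS; nia.
have [n1 e1] := IH h2.
have [|n2 e2] := dbl n1; first by rewrite e1; move: h2; rewrite exprS; nia.
by split=> //; rewrite e2 e1 exprS; ring.
Qed.

(** A point deeper than y0 agrees to leading order with [f z] for an iterate z of y0 of half its
    valuation, and (f z)' = z + t z' + D' z^4 because squares have derivative 0. Hence about v(x) /
    2 instead of the general v(x) - 1. *)
Lemma der_bound_aux k x m : neg x -> 2 ^+ k * v y0 <= v x ->
  2%:Z * m <= v x -> m <= v y0 - 1 -> vge v m (d x).
Proof.
have [ys yn0 y1] := negP3 ny0.
elim: k x m => [|k IH] x m nx hx m1 m2.
  by apply: vgeW (hd1 x); have := maxy0 nx; move: hx; rewrite expr0 mul1r; zlia.
have [xs xn0 x1] := negP3 nx.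
have [hk|hk] := leP (2 ^+ k * v y0) (v x); first exact: IH.
have tx := top nx.
have [nz ez] := @iter_y k ltac:(by rewrite exprS -mulrA; zlia).
set z := iter k f y0 in nz ez *.
have dz := double nz nx ltac:(by rewrite ez).
have e : v x = 2%:Z * v z by move: hx; rewrite ez exprS -mulrA; rewrite ez in dz; zlia.
have [nfz efz] := dbl nz ltac:(zlia).
have [zs zn0 z1] := negP3 nz.
have hx1 := same nx nfz ltac:(zlia).
have -> : x = f z + (x + f z) by rewrite addrCA (addKK c2) addr0.
rewrite hd.1; apply: (vgeD hv).
  have -> : d (f z) = z + t * d z + d D * z ^+ 4.
    rewrite /phi g1 mul1r !hd.1 (d_sqr c2 hd) (hd.2 t) (hd.2 D) dt addr0 mul1r.
    by rewrite -[4%N]/(2 * 2)%N exprM (d_sqr c2 hd) mulr0 addr0.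
  apply: (vgeD hv); first apply: (vgeD hv).
  - by rewrite vgeE //; zlia.
  - have h := IH z m nz ltac:(by rewrite ez) ltac:(zlia) m2.
    by apply: vgeW (vgeM hv ht h); zlia.
  - by apply: vgeW (vgeM hv (hd1 D) (vgeX hv 4 (vge_val v z))); zlia.
(* The remainder [x + f z] is strictly higher than x, so by [double] it reaches at least half the
   valuation of x, which is the range of the induction hypothesis. *)
have [->|w0] := eqVneq (x + f z) 0; first by rewrite (d0 c2 hd) vge0.
move: hx1; rewrite vgeE // => hx1.
have [w1|w1] := ltP (v (x + f z)) 0; last by apply: vgeW (hd0 w1); zlia.
have nw : neg (x + f z).
  by rewrite /neg w0 w1 hs.1 //; case/and3P: nfz.
apply: IH => //; last by zlia.
have := double nw nx ltac:(zlia); move: hx; rewrite exprS -mulrA; zlia.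
Qed.

Lemma der_bound x m : neg x -> 2%:Z * m <= v x -> m <= v y0 - 1 -> vge v m (d x).
Proof.
(* The exponent |v x| is large enough since v(y0) <= -1 and 2^n >= n. *)
move=> nx; apply: (@der_bound_aux `|v x|%N) => //.
have [_ _ y1] := negP3 ny0.
have : (`|v x|%N%:Z <= 2 ^+ `|v x|%N :> int).
  by rewrite -(natrX int 2) -natz ler_nat ltnW // ltn_expl.
nia.
Qed.

Lemma lev2 x : neg x -> v x = v y0 \/ v x <= 2%:Z * v y0.
Proof.
move=> nx; have := maxy0 nx; rewrite le_eqVlt => /orP[/eqP->|h]; [by left|right].
exact: double.
Qed.

Lemma lev4 x : neg x -> 2%:Z * v y0 <= v x \/ v x <= 4%:Z * v y0.
Proof.
move=> nx; have [h|h] := leP (2%:Z * v y0) (v x); [by left|right].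
have tx := top nx; have [n1 e1] := dbl ny0 ltac:(zlia).
by have := double n1 nx; rewrite e1 => /(_ h); zlia.
Qed.

Lemma line x z : neg x -> neg z -> neg (x + z) -> is_line (v x) (v z) (v (x + z)).
Proof.
move=> nx nz ns; have [_ x0 x1] := negP3 nx; have [_ z0 z1] := negP3 nz.
have [_ s0 s1] := negP3 ns.
have [lt|gt|e] := ltgtP (v x) (v z).
- have [_ e] := val_addl c2 hv (y := z) x0 ltac:(by rewrite vgeE //; zlia).
  by right; left; have := double nz nx lt; rewrite e; zlia.
- have [_ e] := val_addl c2 hv (y := x) z0 ltac:(by rewrite vgeE //; zlia).
  by right; right; rewrite addrC e; have := double nx nz gt; zlia.
- left; have := same nx nz e; rewrite vgeE // => h.
  by have := double ns nx ltac:(zlia); zlia.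
Qed.

Lemma plane_w_aux x z m : neg x -> neg z -> v z <= v x -> W x z != 0 ->
  2%:Z * m <= v x -> m <= v y0 - 1 -> v z + m <= v (W x z).
Proof.
move=> nx nz h W0 h1 h2; rewrite -(vgeE _ _ W0).
have hx := der_bound nx h1 h2.
have hz : vge v (m + v z - v x) (d z) by apply: der_bound => //; zlia.
by apply: (W_vge hx hz); zlia.
Qed.

Lemma plane_w x z m r q : neg x -> neg z -> neg (x + z) -> W x z != 0 ->
  is_plane r q (v x) (v z) (v (x + z)) ->
  2%:Z * m <= r -> m <= v y0 - 1 -> q + m <= v (W x z).
Proof.
move=> nx nz ns W0 h h1 h2.
have [_ _ x1] := negP3 nx; have [_ _ z1] := negP3 nz; have [_ _ s1] := negP3 ns.
have Wr : W (x + z) x = W x z by rewrite (WC d) (Wxr c2 hd).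
case: h => [[[e1 [e2 e3]]|[[e1 [e2 e3]]|[e1 [e2 e3]]]] hq].
- by rewrite -Wr -e2; apply: plane_w_aux; rewrite ?Wr //; zlia.
- by rewrite (WC d) -e2; apply: plane_w_aux; rewrite 1?(WC d) //; zlia.
- by rewrite -e2; apply: plane_w_aux => //; zlia.
Qed.

End Tate.
End Local.

(** w is the valuation of the Wronskian of a plane with valuations x, z, y, and e is the largest
    negative valuation. The weights 3 and 2 come from infinity, where the bounds for the three pairs
    of the plane add up to 3 w >= 2 (x + z + y) + 3. A finite place may fall short by 2, but only
    for shallow planes; deep ones have a surplus. *)
Definition plane_fact (e x z y w : int) :=
  [/\ -2%:Z <= 3%:Z * w - 2%:Z * (x + z + y),
      x <= 2%:Z * e -> z <= 2%:Z * e -> y <= 2%:Z * e -> 2%:Z <= 3%:Z * w - 2%:Z * (x + z + y)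
    & x <= 4%:Z * e \/ z <= 4%:Z * e \/ y <= 4%:Z * e -> 0 <= 3%:Z * w - 2%:Z * (x + z + y)].

(** Since e < 0 in every use, this leaves only x = e, x = 2 e or x <= 4 e. *)
Definition lev_fact (e x : int) :=
  (x = e \/ x <= 2%:Z * e) /\ (2%:Z * e <= x \/ x <= 4%:Z * e).

Lemma lev_fact_low (e a b c ac bc abc : int) : e < 0 -> a = e -> b = 2%:Z * e ->
  lev_fact e c -> lev_fact e ac -> lev_fact e bc -> lev_fact e abc ->
  is_line a c ac -> is_line b c bc -> is_line bc a abc -> c <= 4%:Z * e /\ bc <= 4%:Z * e.
Proof.
move=> e0 -> -> [lc lc'] [lac _] [lbc _] [labc _] l1 l2 l3.
have [c1|[c1|c1]] : c = e \/ c = 2%:Z * e \/ c <= 4%:Z * e by lia.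
- by exfalso; case: l1 => [|[|]]; lia.
- exfalso; have : bc = e by case: l2 => [|[|]]; lia.
  by case: l3 => [|[|]]; lia.
- by split=> //; case: l2 => [|[|]]; lia.
Qed.

(** A deficient plane has valuations e, 2 e, 2 e in some order. A further point c at level e or 2 e
    would produce a point above the maximum e, so c is at 4 e or deeper. Then the plane through c
    and a point of level 2 e lies wholly at 2 e or below, and its surplus 2 pays for the deficit;
    the remaining plane has none. *)
Lemma triple_arith_neg (e a b c ab ac bc abc wab wac wbc : int) : e < 0 ->
  lev_fact e a -> lev_fact e b -> lev_fact e c -> lev_fact e ab ->
  lev_fact e ac -> lev_fact e bc -> lev_fact e abc ->
  is_line a b ab -> is_line a c ac -> is_line b c bc ->
  is_line ab c abc -> is_line ac b abc -> is_line bc a abc -> is_line ac ab bc ->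
  plane_fact e a b ab wab -> plane_fact e a c ac wac -> plane_fact e b c bc wbc ->
  3%:Z * wab - 2%:Z * (a + b + ab) < 0 ->
  2%:Z * (2%:Z * (a + b + c) + ab + ac + bc) <= 3%:Z * (wab + wac + wbc).
Proof.
move=> e0 La Lb Lc Lab Lac Lbc Labc l1 l2 l3 l4 l5 l6 l7 [p1 p2 p3] [_ q2 q3] [_ r2 r3] h.
have [La1 La2] := La; have [Lb1 Lb2] := Lb; have [Lab1 Lab2] := Lab.
have ha : 4%:Z * e < a by clear - p3 h; lia.
have hb : 4%:Z * e < b by clear - p3 h; lia.
have hab : 4%:Z * e < ab by clear - p3 h; lia.
clear p2 p3.
have va : a = e \/ a = 2%:Z * e by clear - La1 La2 ha e0; lia.
have vb : b = e \/ b = 2%:Z * e by clear - Lb1 Lb2 hb e0; lia.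
have vab : ab = e \/ ab = 2%:Z * e by clear - Lab1 Lab2 hab e0; lia.
have [[ea [eb eab]]|[[ea [eb eab]]|[ea [eb eab]]]] :
  (a = e /\ b = 2%:Z * e /\ ab = 2%:Z * e) \/ (a = 2%:Z * e /\ b = e /\ ab = 2%:Z * e) \/
  (a = 2%:Z * e /\ b = 2%:Z * e /\ ab = e).
  by clear - e0 va vb vab l1; case: l1 => [|[|]]; lia.
- have [c1 c3] := lev_fact_low e0 ea eb Lc Lac Lbc Labc l2 l3 l6.
  have := q3 (or_intror (or_introl c1)); have : 2%:Z <= 3%:Z * wbc - 2%:Z * (b + c + bc).
    by apply: r2; clear - e0 c1 c3 eb; lia.
  by clear - p1; lia.
- have [c1 c3] := lev_fact_low e0 eb ea Lc Lbc Lac Labc l3 l2 l5.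
  have := r3 (or_intror (or_introl c1)); have : 2%:Z <= 3%:Z * wac - 2%:Z * (a + c + ac).
    by apply: q2; clear - e0 c1 c3 ea; lia.
  by clear - p1; lia.
- have [c1 c3] := lev_fact_low e0 eab ea Lc Labc Lac Lbc l4 l2 l7.
  have := r3 (or_intror (or_introl c1)); have : 2%:Z <= 3%:Z * wac - 2%:Z * (a + c + ac).
    by apply: q2; clear - e0 c1 c3 ea; lia.
  by clear - p1; lia.
Qed.

Lemma is_lineC p q r : is_line p q r -> is_line q p r.
Proof. rewrite /is_line; lia. Qed.

Lemma is_lineR p q r : is_line p q r -> is_line p r q.
Proof. rewrite /is_line; lia. Qed.

Lemma plane_factC e p q r w : plane_fact e p q r w -> plane_fact e q p r w.
Proof. by case=> h1 h2 h3; split; lia. Qed.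

Lemma triple_arith (e a b c ab ac bc abc wab wac wbc : int) : e < 0 ->
  lev_fact e a -> lev_fact e b -> lev_fact e c -> lev_fact e ab ->
  lev_fact e ac -> lev_fact e bc -> lev_fact e abc ->
  is_line a b ab -> is_line a c ac -> is_line b c bc ->
  is_line ab c abc -> is_line ac b abc -> is_line bc a abc -> is_line ac ab bc ->
  plane_fact e a b ab wab -> plane_fact e a c ac wac -> plane_fact e b c bc wbc ->
  2%:Z * (2%:Z * (a + b + c) + ab + ac + bc) <= 3%:Z * (wab + wac + wbc).
Proof.
move=> e0 La Lb Lc Lab Lac Lbc Labc l1 l2 l3 l4 l5 l6 l7 p q r.
have [h1|h1] := ltP (3%:Z * wab - 2%:Z * (a + b + ab)) 0; first exact: (triple_arith_neg e0 La Lb Lc Lab Lac Lbc Labc l1 l2 l3 l4 l5 l6 l7 p q r h1).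
have [h2|h2] := ltP (3%:Z * wac - 2%:Z * (a + c + ac)) 0.
  have := @triple_arith_neg e a c b ac ab bc abc wac wab wbc.
  have := is_lineC l3; have := is_lineC l7; have := plane_factC r.
  by clear - e0 La Lb Lc Lab Lac Lbc Labc l1 l2 l4 l5 l6 p q h2; move=> x1 x2 x3 x4;
    have := x4 e0 La Lc Lb Lac Lab Lbc Labc l2 l1 x3 l5 l4 l6 x2 q p x1 h2; clear; lia.
have [h3|h3] := ltP (3%:Z * wbc - 2%:Z * (b + c + bc)) 0.
  have := @triple_arith_neg e b c a bc ab ac abc wbc wab wac.
  have := is_lineC l1; have := is_lineC l2; have := plane_factC p; have := plane_factC q.
  have := is_lineR (is_lineC l7).
  by clear - e0 La Lb Lc Lab Lac Lbc Labc l3 l4 l5 l6 r h3; move=> x0 x1 x2 x3 x4 x5;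
    have := x5 e0 Lb Lc La Lbc Lab Lac Labc l3 x4 x3 l6 l4 l5 x0 r x2 x1 h3; clear; lia.
by clear - h1 h2 h3; lia.
Qed.

(** * Product formula arguments, beginning with irreducible p of degree at least 3 *)

Section Global.
Variable K : fieldType.
Hypothesis c2 : 2%:R = 0 :> K.
Implicit Types x y z : K.
Variable d : K -> K.
Hypothesis hd : derivation d.
Variables (I : Type) (vp : I -> K -> int) (vi : K -> int).
Hypothesis hvp : forall i, is_val (vp i).
Hypothesis hvi : is_val vi.
Hypothesis hd1 : forall i x, vge (vp i) (vp i x - 1) (d x).
Hypothesis hd0 : forall i x, 0 <= vp i x -> vge (vp i) 0 (d x).
Hypothesis hdi : forall x, vge vi (vi x + 1) (d x).
Hypothesis PF : forall x, x != 0 -> (forall i, 0 <= vp i x) -> vi x <= 0.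
Variables t g D : K.
Hypothesis ht : forall i, vge (vp i) 0 t.
Hypothesis dt : d t = 1.
Hypothesis D0 : D != 0.
Hypothesis g01 : g = 0 \/ g = 1.
Variable s : seq K.
Hypothesis hs : closed_mod t g D s.
Notation f := (phi t g D).
Notation W := (W d).
Notation gen := (gen t g D).

Lemma W_inf x y : W x y != 0 -> vi x + vi y + 1 <= vi (W x y).
Proof.
move=> W0; rewrite -(vgeE _ _ W0); apply: (vgeD hvi).
  by apply: vgeW (vgeM hvi (hdi x) (vge_val vi y)); lia.
by apply: vgeW (vgeM hvi (vge_val vi x) (hdi y)); lia.
Qed.

Section Place.
Variable i : I.
Notation v := (vp i).
Notation zone := (zone v g D).
Notation neg := (neg v s).

Lemma nonzone_neg x : x \in s -> x != 0 -> ~~ zone x -> neg x.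
Proof.
move=> xs x0 /(nonzone c2 (hvp i) (ht i) D0 g01 hs xs x0)[_ _ h _].
by rewrite /(neg _) xs x0 h.
Qed.

Lemma nonzone_tate x : x \in s -> x != 0 -> ~~ zone x -> g = 1 /\ 0 < v D.
Proof. by move=> xs x0 /(nonzone c2 (hvp i) (ht i) D0 g01 hs xs x0)[]. Qed.

Section Tate.
Hypothesis g1 : g = 1.
Hypothesis D1 : 0 < v D.
Variable y0 : K.
Hypothesis ny0 : neg y0.
Hypothesis maxy0 : forall z, neg z -> v z <= v y0.

Lemma T_line x z : neg x -> neg z -> neg (x + z) -> is_line (v x) (v z) (v (x + z)).
Proof. exact: (line c2 (hvp i) (ht i) D0 g01 hs g1 D1). Qed.

Lemma T_lev x : neg x -> lev_fact (v y0) (v x).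
Proof.
move=> nx; split.
  exact: (lev2 c2 (hvp i) (ht i) D0 g01 hs g1 D1 ny0 maxy0).
exact: (lev4 c2 (hvp i) (ht i) D0 g01 hs g1 D1 ny0).
Qed.

Lemma T_w x z m r q : neg x -> neg z -> neg (x + z) -> W x z != 0 ->
  is_plane r q (v x) (v z) (v (x + z)) ->
  2%:Z * m <= r -> m <= v y0 - 1 -> q + m <= v (W x z).
Proof. exact: (plane_w c2 hd (hvp i) (hd1 i) (@hd0 i) (ht i) dt D0 g01 hs g1 D1 ny0 maxy0). Qed.

Lemma T_plane x z : neg x -> neg z -> neg (x + z) -> W x z != 0 ->
  plane_fact (v y0) (v x) (v z) (v (x + z)) (v (W x z)).
Proof.
move=> nx nz ns W0.
have [r [q [hp hqr]]] := line_plane (T_line nx nz ns).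
have hw m := @T_w x z m r q nx nz ns W0 hp.
have [lx lx'] := T_lev nx; have [lz lz'] := T_lev nz; have [ls ls'] := T_lev ns.
have [_ _ e0] := negP3 ny0.
have lr : r = v y0 \/ r <= 2%:Z * v y0 by clear - hp lx lz ls; case: hp => [[|[|]]]; lia.
have lq : 2%:Z * v y0 <= q \/ q <= 4%:Z * v y0 by clear - hp lx' lz' ls'; case: hp => [[|[|]]]; lia.
have sum : v x + v z + v (x + z) = r + 2%:Z * q by clear - hp; case: hp => [[|[|]]]; lia.
have hq2 : q <= 2%:Z * r by case: hp.
(* The derivative bound requires 2 m <= r and m <= v(y0) - 1. The extreme value m = v(y0) - 1 is
   allowed for r at v(y0) or 2 v(y0); for lower r the choice m = r is enough. *)
case: lr => [lr|lr].
  have h1 := hw (v y0 - 1) ltac:(clear - lr e0; lia) ltac:(clear; lia).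
  split; rewrite sum.
  - by clear - h1 lr hqr hq2 e0; lia.
  - by clear - hp lr e0; case: hp => [[|[|]]]; lia.
  - by clear - hp lr lq e0 h1 hq2; case: hp => [[|[|]]]; lia.
have h1 : 2%:Z <= 3%:Z * v (W x z) - 2%:Z * (v x + v z + v (x + z)).
  rewrite sum; have [e|l] := leP (2%:Z * v y0) r.
    by have := hw (v y0 - 1) ltac:(clear - e lr e0; lia) ltac:(clear; lia); clear - e lr e0 hq2; lia.
  by have := hw r ltac:(clear - lr e0; lia) ltac:(clear - lr e0; lia); clear - e0 l hq2; lia.
by clear - h1; split; lia.
Qed.

End Tate.

Lemma neg_maxE x : 0 < v D -> neg x -> exists y, neg y /\ forall z, neg z -> v z <= v y.
Proof. by move=> h; apply: (neg_max h). Qed.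

Lemma W_eqv x y : x != 0 -> y != 0 -> W x y != 0 -> v x = v y -> v x + v y <= v (W x y).
Proof.
by move=> x0 y0 W0 e; rewrite -(vgeE _ _ W0); apply: (W_eqval c2 hd (hvp i) (@hd0 i)).
Qed.

End Place.

(** W a b is also the Wronskian of (a, a + b) and of (b, a + b). The three bounds at infinity give W
    a b the exponent 3 against a b (a + b) with exponent 2, and a surplus of 3 for each of the three
    planes. At finite places either all points of P have the same valuation or [triple_arith]
    applies. *)
Lemma triple_vanish (P : K -> Prop) a b c :
  (forall x y, P x -> P y -> P (x + y)) ->
  (forall x, P x -> x \in s) ->
  (forall x y, P x -> P y -> x != 0 -> gen x y) ->
  P a -> P b -> P c ->
  a != 0 -> b != 0 -> c != 0 -> a + b != 0 -> a + c != 0 -> b + c != 0 -> a + b + c != 0 ->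
  W a b != 0 -> W a c != 0 -> W b c != 0 -> False.
Proof.
move=> PD Ps Pg Pa Pb Pc a0 b0 c0 ab0 ac0 bc0 abc0 wab wac wbc.
pose N := (W a b * W a c * W b c) ^+ 3.
pose M := (a * b * c) ^+ 4 * ((a + b) * (a + c) * (b + c)) ^+ 2.
have N0 : N != 0 by rewrite expf_neq0 ?mulf_neq0.
have M0 : M != 0 by rewrite !(mulf_neq0, expf_neq0).
have vR v : is_val v -> v (N / M) = 3%:Z * (v (W a b) + v (W a c) + v (W b c))
    - (4%:Z * (v a + v b + v c) + 2%:Z * (v (a + b) + v (a + c) + v (b + c))).
  move=> hv; rewrite (valM hv) ?invr_eq0 // (valV hv) // /N /M.
  by rewrite !(valM hv, valX hv) ?(mulf_neq0, expf_neq0).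
have Wr x y : W x (x + y) = W x y by exact: Wxr.
have : vi (N / M) <= 0.
  apply: PF => [|i]; first by rewrite mulf_neq0 ?invr_eq0.
  rewrite vR //.
  have [z|nz] := boolP (zone (vp i) g D a).
    have e x : P x -> x != 0 -> vp i x = vp i a.
      move=> Px x0.
      have [h1 zx] := zone_gen2 (hvp i) (ht i) g01 a0 x0 z (Pg _ _ Pa Px a0).
      have [h2 _] := zone_gen2 (hvp i) (ht i) g01 x0 a0 zx (Pg _ _ Px Pa x0).
      by clear - h1 h2; lia.
    have w x y : P x -> P y -> x != 0 -> y != 0 -> W x y != 0 -> 2%:Z * vp i a <= vp i (W x y).
      by move=> Px Py x0 y0 W0; have := @W_eqv i _ _ x0 y0 W0; rewrite (e x) // (e y) // => /(_ erefl); clear; lia.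
    have := w a b Pa Pb a0 b0 wab; have := w a c Pa Pc a0 c0 wac; have := w b c Pb Pc b0 c0 wbc.
    rewrite (e b) // (e c) // (e (a + b) (PD _ _ Pa Pb)) // (e (a + c) (PD _ _ Pa Pc)) // (e (b + c) (PD _ _ Pb Pc)) //.
    by clear; lia.
  have n x : P x -> x != 0 -> neg (vp i) s x.
    move=> Px x0; apply: nonzone_neg => //; first exact: Ps.
    apply/negP => zx; move/negP: nz; apply.
    by have [_] := zone_gen2 (hvp i) (ht i) g01 x0 a0 zx (Pg _ _ Px Pa x0).
  have [g1 D1] := nonzone_tate (Ps _ Pa) a0 nz.
  have [y [ny hy]] := neg_maxE D1 (n a Pa a0).
  have [_ _ e0] := negP3 ny.
  have Pab := PD _ _ Pa Pb; have Pac := PD _ _ Pa Pc; have Pbc := PD _ _ Pb Pc.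
  have Pabc := PD _ _ Pab Pc.
  have na := n a Pa a0; have nb := n b Pb b0; have nc := n c Pc c0.
  have nab := n _ Pab ab0; have nac := n _ Pac ac0; have nbc := n _ Pbc bc0.
  have nabc := n _ Pabc abc0.
  have e1 : a + c + b = a + b + c by rewrite addrAC.
  have e2 : b + c + a = a + b + c by rewrite addrC addrA.
  have e3 : (a + c) + (a + b) = b + c by ring: c2.
  have L := T_line g1 D1; have V := T_lev g1 D1 ny hy; have Q := T_plane g1 D1 ny hy.
  have l5 := L (a + c) b nac nb; have l6 := L (b + c) a nbc na; have l7 := L (a + c) (a + b) nac nab.
  rewrite e1 in l5; rewrite e2 in l6; rewrite e3 in l7.
  have := triple_arith e0 (V a na) (V b nb) (V c nc) (V _ nab) (V _ nac) (V _ nbc) (V _ nabc)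
    (L _ _ na nb nab) (L _ _ na nc nac) (L _ _ nb nc nbc) (L _ _ nab nc nabc)
    (l5 nabc) (l6 nabc) (l7 nbc) (Q _ _ na nb nab wab) (Q _ _ na nc nac wac) (Q _ _ nb nc nbc wbc).
  by clear; lia.
rewrite vR //.
have h1 := W_inf wab; have h2 := W_inf wac; have h3 := W_inf wbc.
have k1 : vi a + vi (a + b) + 1 <= vi (W a b) by rewrite -Wr; apply: W_inf; rewrite Wr.
have k2 : vi b + vi (a + b) + 1 <= vi (W a b).
  by rewrite (WC d) -Wr [b + a]addrC; apply: W_inf; rewrite addrC Wr (WC d).
have k3 : vi a + vi (a + c) + 1 <= vi (W a c) by rewrite -Wr; apply: W_inf; rewrite Wr.
have k4 : vi c + vi (a + c) + 1 <= vi (W a c).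
  by rewrite (WC d) -Wr [c + a]addrC; apply: W_inf; rewrite addrC Wr (WC d).
have k5 : vi b + vi (b + c) + 1 <= vi (W b c) by rewrite -Wr; apply: W_inf; rewrite Wr.
have k6 : vi c + vi (b + c) + 1 <= vi (W b c).
  by rewrite (WC d) -Wr [c + b]addrC; apply: W_inf; rewrite addrC Wr (WC d).
clear - h1 h2 h3 k1 k2 k3 k4 k5 k6; lia.
Qed.

(* If W a b <> 0, one of the bases (a, b, c), (a, b, c + b), (a, b, c + a) of the span has
   no vanishing Wronskian. *)
Lemma W_vanish (P : K -> Prop) a b c :
  (forall x y, P x -> P y -> P (x + y)) ->
  (forall x, P x -> x \in s) ->
  (forall x y, P x -> P y -> x != 0 -> gen x y) ->
  P a -> P b -> P c ->
  a != 0 -> b != 0 -> c != 0 -> a + b != 0 -> a + c != 0 -> b + c != 0 -> a + b + c != 0 ->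
  W a b = 0.
Proof.
move=> PD Ps Pg Pa Pb Pc a0 b0 c0 ab0 ac0 bc0 abc0.
apply/eqP; apply/negPn/negP => wab.
have K3 c' := @triple_vanish P a b c' PD Ps Pg Pa Pb.
have e1 : b + (c + b) = c by rewrite addrC -addrA (addKK c2) addr0.
have e2 : a + (c + a) = c by rewrite addrC -addrA (addKK c2) addr0.
have [h1|h1] := eqVneq (W a c) 0.
  have h2 : W b c != 0.
    apply: contra wab => /eqP h2; apply/eqP.
    by apply: (W_trans c2 c0 h1); rewrite (WC d).
  apply: (K3 (c + b)) => //; rewrite ?(WDr hd) ?h1 ?add0r //.
  - exact: PD.
  - by rewrite addrC.
  - by rewrite [c + b]addrC addrA.
  - by rewrite e1.
  - by rewrite -addrA e1.
  - by rewrite (Wxx c2) addr0.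
have [h2|h2] := eqVneq (W b c) 0.
  apply: (K3 (c + a)) => //; rewrite ?(WDr hd) ?h2 ?add0r ?(Wxx c2) ?addr0 //.
  - exact: PD.
  - by rewrite addrC.
  - by rewrite e2.
  - by rewrite [c + a]addrC addrA [b + a]addrC.
  - by rewrite [a + b]addrC -addrA e2.
  - by rewrite (WC d).
exact: (K3 c).
Qed.

(** [W_vanish] links x, f x, f^2 x and f^3 x, and x, f x, x + f x, f^2 x contradict [four_equiv].
    The third iterate occurs because [four_equiv] also needs the class of the image of f^2 x. *)
Lemma simple_absurd (P : K -> Prop) x :
  (forall x y, P x -> P y -> P (x + y)) ->
  (forall x, P x -> x \in s) ->
  (forall x, P x -> P (f x)) ->
  (forall x y, P x -> P y -> x != 0 -> gen x y) ->
  P x -> x != 0 -> f x != 0 -> x + f x != 0 ->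
  f (f x) != 0 -> x + f (f x) != 0 -> f x + f (f x) != 0 -> x + f x + f (f x) != 0 ->
  f (f (f x)) != 0 -> f x + f (f (f x)) != 0 -> f (f x) + f (f (f x)) != 0 ->
  f x + f (f x) + f (f (f x)) != 0 -> False.
Proof.
move=> PD Ps Pf Pg Px.
set y := f x; set z := f y; set w := f z => x0 y0 xy0 z0 xz0 yz0 xyz0 w0 yw0 zw0 yzw0.
have Py : P y by exact: Pf.
have Pz : P z by exact: Pf.
have Pw : P w by exact: Pf.
have hxy : W x y = 0 by apply: (@W_vanish P x y z).
have hyz : W y z = 0 by apply: (@W_vanish P y z w).
have hzw : W z w = 0.
  by apply: (@W_vanish P z w y) => //; rewrite [_ + y]addrC // addrA.
have hxz : W x z = 0 by apply: (W_trans c2 y0 hxy).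
apply: (@four_equiv _ c2 d hd t g D [:: x; y; x + y; z]) => //.
- have nq (u u' : K) : u + u' != 0 -> (u == u') = false by rewrite (add_eq0 c2) => /negbTE.
  have e1 : y + (x + y) != 0 by rewrite addrCA (addKK c2) addr0.
  have e2 : x + (x + y) != 0 by rewrite (addK2 c2).
  by rewrite /= !inE (nq _ _ xy0) (nq _ _ xz0) (nq _ _ yz0) (nq _ _ xyz0) (nq _ _ e1) (nq _ _ e2).
- by rewrite !inE !negb_or ![0 == _]eq_sym x0 y0 xy0 z0.
- have hy u : u \in [:: x; y; x + y; z] -> W u y = 0.
    rewrite !inE => /or4P[]/eqP-> //; first by rewrite (Wxx c2).
      by rewrite (WDl hd) hxy (Wxx c2) addr0.
    by rewrite (WC d).
  by move=> u u' /hy h1 /hy h2; apply: (W_trans c2 y0 h1); rewrite (WC d).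
- move=> u; rewrite !inE => /or4P[]/eqP->; rewrite -/y -/z -/w.
  + by rewrite (WC d).
  + by rewrite (WC d).
  + rewrite (phiD c2) -/y -/z; apply: (W_trans c2 y0).
      by rewrite (WDl hd y z) (Wxx c2) add0r (WC d).
    by rewrite (WC d) (WDl hd x y) hxy (Wxx c2) addr0.
  + by rewrite (WC d).
Qed.

Section Place2.
Variable i : I.
Notation v := (vp i).
Notation zone := (zone v g D).
Notation neg := (neg v s).

Section Tate2.
Hypothesis g1 : g = 1.
Hypothesis D1 : 0 < v D.

Lemma T_top x : neg x -> 0 <= 2%:Z * v x + v D.
Proof. exact: (top c2 (hvp i) (ht i) D0 g01 hs g1 D1). Qed.

Lemma T_dbl x : neg x -> 0 < 2%:Z * v x + v D -> neg (f x) /\ v (f x) = 2%:Z * v x.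
Proof. exact: (dbl c2 (hvp i) (ht i) hs g1 D1). Qed.

Lemma T_double x y : neg x -> neg y -> v y < v x -> v y <= 2%:Z * v x.
Proof. exact: (double c2 (hvp i) (ht i) D0 g01 hs g1 D1). Qed.

Lemma T_same x y : neg x -> neg y -> x + y != 0 -> v x = v y -> v x < v (x + y).
Proof.
move=> nx ny s0 e.
have := same c2 (hvp i) (ht i) D0 g01 hs g1 D1 nx ny e; rewrite vgeE //; clear; lia.
Qed.

(** f doubles the valuation at a but not at b, so b lies on the floor - v(D) / 2. *)
Lemma cycle_shape1 a b : neg a -> neg b -> neg (f b) -> f a = b -> v b < v a -> v (f b) = v b ->
  v b = 2%:Z * v a /\ 4%:Z * v a + v D = 0.
Proof.
move=> na nb nc ab lt e; have tb := T_top nb.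
have [] := T_dbl na; rewrite ?ab; first by clear - tb lt; lia.
move=> _ e1; split=> //.
have [h|h] := leP (2%:Z * v b + v D) 0; first by clear - h tb e1; lia.
have [_ e2] := T_dbl nb h; have [_ _ b1] := negP3 nb; clear - e e2 b1; lia.
Qed.

(* On the three nonzero elements of a module A/(X^2+X+1) outside the integral zone the
   valuations are -v(D)/4, -v(D)/2, -v(D)/2. *)
Lemma cycle_shape a b c : neg a -> neg b -> neg c -> f a = b -> f b = c -> f c = a -> c = a + b ->
  [\/ [/\ v b = 2%:Z * v a, v c = 2%:Z * v a & 4%:Z * v a + v D = 0],
      [/\ v c = 2%:Z * v b, v a = 2%:Z * v b & 4%:Z * v b + v D = 0] |
      [/\ v a = 2%:Z * v c, v b = 2%:Z * v c & 4%:Z * v c + v D = 0]].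
Proof.
move=> na nb nc ab bc ca e.
have := T_line g1 D1 na nb; rewrite -e => /(_ nc) [[e1 [lt _]]|[[e1 [lt _]]|[e1 [lt _]]]].
- apply: Or33; have := @cycle_shape1 c a nc na; rewrite ca ab => /(_ nb erefl lt (esym e1)) [h1 h2].
  by split=> //; clear - e1 h1; lia.
- apply: Or32; have := @cycle_shape1 b c nb nc; rewrite bc ca -e1 => /(_ na erefl lt erefl) [h1 h2].
  by split=> //; clear - e1 h1; lia.
- apply: Or31; have := @cycle_shape1 a b na nb; rewrite ab bc => /(_ nc erefl lt (esym e1)) [h1 h2].
  by split=> //; clear - e1 h1; lia.
Qed.

Variable y0 : K.
Hypothesis ny0 : neg y0.
Hypothesis maxy0 : forall z, neg z -> v z <= v y0.

Lemma T_w2 x z : neg x -> neg z -> neg (x + z) -> W x z != 0 ->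
  exists r q, [/\ is_plane r q (v x) (v z) (v (x + z)), q < r,
    r <= v y0 - 1 -> q + r <= v (W x z)
    & 2%:Z * v y0 - 2%:Z <= r -> q + v y0 - 1 <= v (W x z)].
Proof.
move=> nx nz ns W0; have [r [q [hp hqr]]] := line_plane (T_line g1 D1 nx nz ns).
have hw m := @T_w i g1 D1 y0 ny0 maxy0 x z m r q nx nz ns W0 hp.
have [_ _ e0] := negP3 ny0.
exists r, q; split=> // h.
  by apply: hw => //; clear - h e0; lia.
by rewrite -addrA; apply: hw; clear - h; lia.
Qed.

(** The action of X^2 + X + 1, both for t = X and for t = X + 1, since this polynomial is invariant
    under X -> X + 1. *)
Definition Qf x := f (f x) + f x + x.

Lemma QfD x y : Qf (x + y) = Qf x + Qf y.
Proof. by rewrite /Qf !(phiD c2); ring. Qed.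

Lemma Qff x : Qf (f x) = f (Qf x).
Proof. by rewrite /Qf !(phiD c2). Qed.

(** Points with Q-image in the cycle have poles. Adding b, then a, cancels leading terms without
    leaving these points and reaches half of v(a). The last halving uses u, [f u + a] and
    [f u + a + u], which are again such points because X and X + 1 permute the nonzero elements of
    A/Q. *)
Lemma cycle_low a b c x : f a = b -> f b = c -> f c = a -> c = a + b ->
  neg a -> neg b -> v b = 2%:Z * v a -> 4%:Z * v a + v D = 0 ->
  (forall u, u \in s -> Qf u \in [:: a; b; c] -> neg u) ->
  x \in s -> Qf x \in [:: a; b; c] -> v a <= 4%:Z * v y0.
Proof.
move=> ab bc ca cab na nb vb va G.
have [_ as0 a1] := negP3 na; have [as' _ _] := negP3 na; have [bs _ _] := negP3 nb.
have Qa : Qf a = 0 by rewrite /Qf ab bc cab -addrA [b + a]addrC (addKK c2).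
have Qb : Qf b = 0 by rewrite -ab Qff Qa phi0.
have n0 u : neg u -> u != 0 by case/negP3.
have u1 x1 : x1 \in s -> Qf x1 \in [:: a; b; c] -> exists u,
    [/\ u \in s, Qf u \in [:: a; b; c] & v a <= v u].
  move=> xs Qx; have nx := G _ xs Qx; have tx := T_top nx.
  have [e|ne] := leP (v x1) (v b).
    have Q' : Qf (x1 + b) \in [:: a; b; c] by rewrite QfD Qb addr0.
    have xs' : x1 + b \in s by exact: hs.1.
    have n' := G _ xs' Q'; exists (x1 + b); split=> //.
    have h := T_same nx nb (n0 _ n') ltac:(clear - e tx vb va; lia).
    have := T_double n' nb ltac:(clear - h e tx vb va; lia); clear - vb; lia.
  by exists x1; split=> //; have := T_double nx nb ne; clear - vb; lia.
have u2 x1 : x1 \in s -> Qf x1 \in [:: a; b; c] -> exists u,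
    [/\ u \in s, Qf u \in [:: a; b; c] & v a <= 2%:Z * v u].
  move=> xs Qx; have [u [us Qu hu]] := u1 _ xs Qx; have nu := G _ us Qu.
  have [e|ne] := leP (v u) (v a); last by exists u; split=> //; exact: T_double.
  have Q' : Qf (u + a) \in [:: a; b; c] by rewrite QfD Qa addr0.
  have us' : u + a \in s by exact: hs.1.
  have n' := G _ us' Q'; exists (u + a); split=> //.
  have h := T_same nu na (n0 _ n') ltac:(clear - e hu; lia).
  by apply: T_double => //; clear - h e hu; lia.
move=> xs Qx; have [u [us Qu hu]] := u2 _ xs Qx; have nu := G _ us Qu.
have mu w : neg w -> v w <= v y0 by exact: maxy0.
have [_ _ u0] := negP3 nu.
have [nfu efu] := T_dbl nu ltac:(clear - hu va a1; lia).
have [fus _ _] := negP3 nfu.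
have [lt|ge] := ltP (v a) (2%:Z * v u).
  have := T_double nfu na ltac:(clear - lt efu; lia); have := mu _ nu; clear - efu; lia.
have e : v a = 2%:Z * v u by clear - hu ge; lia.
have Q3 : Qf (f u + a) \in [:: a; b; c].
  rewrite QfD Qa addr0 Qff; move: Qu; rewrite !inE => /or3P[]/eqP->;
  by rewrite ?ab ?bc ?ca eqxx ?orbT.
have us3 : f u + a \in s by exact: hs.1.
have n3 := G _ us3 Q3.
have h3 := T_same nfu na (n0 _ n3) ltac:(clear - efu e; lia).
have k3 := T_double n3 na ltac:(clear - h3 efu e; lia).
have [lt3|ge3] := ltP (v u) (v (f u + a)).
  have := T_double n3 nu lt3; have := mu _ n3; clear - e; lia.
have Q4 : Qf (f u + a + u) \in [:: a; b; c].
  rewrite 2!QfD Qa addr0 Qff; move: Qu; rewrite !inE => /or3P[]/eqP->.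
  - by rewrite ab cab [b + a]addrC eqxx !orbT.
  - by rewrite bc cab -addrA (addKK c2) addr0 eqxx.
  - by rewrite ca cab addrA (addKK c2) add0r eqxx orbT.
have us4 : f u + a + u \in s by exact: hs.1.
have n4 := G _ us4 Q4.
have h4 := T_same n3 nu (n0 _ n4) ltac:(clear - ge3 k3 e; lia).
have := T_double n4 nu ltac:(clear - h4 ge3 k3 e; lia); have := mu _ n4; clear - e; lia.
Qed.

End Tate2.
End Place2.

Lemma gen_Qf x : gen x (Qf x).
Proof. exact: (genD (genD (genf (genf (gen_id _ _ _ _))) (genf (gen_id _ _ _ _))) (gen_id _ _ _ _)). Qed.

(** * The nonzero points [v1], [v2], [v3] of a copy of A/Q *)

Section Cycle.
Variables v1 v2 v3 : K.
Hypotheses (f12 : f v1 = v2) (f23 : f v2 = v3) (f31 : f v3 = v1) (e3 : v3 = v1 + v2).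
Hypothesis v10 : v1 != 0.
Hypothesis v1s : v1 \in s.

Lemma cycle_neq0 : v2 != 0 /\ v3 != 0.
Proof.
split; apply: contra v10 => /eqP e; rewrite -f31; last by rewrite e phi0.
by rewrite -f23 e !phi0.
Qed.

Lemma cycle_in : v2 \in s /\ v3 \in s.
Proof. by rewrite -f23 -f12; split; do !apply: hs.2. Qed.

Lemma cycle_mem : [/\ v1 \in [:: v1; v2; v3], v2 \in [:: v1; v2; v3] & v3 \in [:: v1; v2; v3]].
Proof. by rewrite !inE !eqxx !orbT. Qed.

Lemma cycle_gen1 a b : a \in [:: v1; v2; v3] -> b \in [:: v1; v2; v3] -> gen a b.
Proof.
have h a1 b1 c1 : f a1 = b1 -> f b1 = c1 -> [/\ gen a1 a1, gen a1 b1 & gen a1 c1].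
  by move=> <- <-; split; do ?apply: genf; apply: gen_id.
have [h1 h2 h3] := h _ _ _ f12 f23; have [h4 h5 h6] := h _ _ _ f23 f31.
have [h7 h8 h9] := h _ _ _ f31 f12.
by rewrite !inE => /or3P[]/eqP-> /or3P[]/eqP->.
Qed.

Lemma cycle_zone i : zone (vp i) g D v1 ->
  vp i v2 = vp i v1 /\ vp i v3 = vp i v1.
Proof.
have [v20 v30] := cycle_neq0; have [m1 m2 m3] := cycle_mem.
move=> z; have [h1 z2] := zone_gen2 (hvp i) (ht i) g01 v10 v20 z (cycle_gen1 m1 m2).
have [h2 z3] := zone_gen2 (hvp i) (ht i) g01 v20 v30 z2 (cycle_gen1 m2 m3).
have [h3 _] := zone_gen2 (hvp i) (ht i) g01 v30 v10 z3 (cycle_gen1 m3 m1).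
clear - h1 h2 h3; lia.
Qed.

Lemma cycle_nonzone i : ~~ zone (vp i) g D v1 ->
  [/\ neg (vp i) s v1, neg (vp i) s v2 & neg (vp i) s v3].
Proof.
have [v20 v30] := cycle_neq0; have [v2s v3s] := cycle_in.
move=> nz; have h a : a \in s -> a != 0 -> a \in [:: v1; v2; v3] -> neg (vp i) s a.
  move=> as' a0 ai; apply: nonzone_neg => //; apply: contra nz => za.
  by have [] := zone_gen2 (hvp i) (ht i) g01 a0 v10 za (cycle_gen1 ai (mem_head _ _)).
by split; apply: h; rewrite // !inE eqxx ?orbT.
Qed.

Lemma W_cycle : W v2 v3 = W v1 v2 /\ W v1 v3 = W v1 v2.
Proof.
by rewrite e3 (WDr hd) (Wxx c2) addr0 (WC d); split=> //; rewrite (WDr hd) (Wxx c2) add0r.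
Qed.

(** * Modules A/Q^2: [x] is a preimage of [v1] under Q *)

Section Square.
Variable x : K.
Hypothesis xs : x \in s.
Hypothesis Qx : Qf x = v1.

Lemma Q_cycle a : a \in [:: v1; v2; v3] -> Qf a = 0.
Proof.
have h a1 b1 c1 : f a1 = b1 -> f b1 = c1 -> c1 + b1 + a1 = 0 -> Qf a1 = 0.
  by rewrite /Qf => -> ->.
rewrite !inE => /or3P[]/eqP->.
- by apply: (h _ _ _ f12 f23); rewrite e3 -addrA [v2 + v1]addrC (addKK c2).
- by apply: (h _ _ _ f23 f31); rewrite e3 addrA (addKK c2) add0r (addKK c2).
- by apply: (h _ _ _ f31 f12); rewrite e3 [v2 + v1]addrC (addKK c2).
Qed.

Lemma cycle_G i : ~~ zone (vp i) g D v1 ->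
  forall u, u \in s -> Qf u \in [:: v1; v2; v3] -> neg (vp i) s u.
Proof.
move=> nz u us Qu.
have q0 : Qf u != 0.
  have [v20 v30] := cycle_neq0.
  by move: Qu; rewrite !inE => /or3P[]/eqP->.
have u0 : u != 0 by apply: contra q0 => /eqP->; rewrite /Qf !phi0 !addr0.
apply: nonzone_neg => //; apply: contra nz => zu.
have [_ zq] := zone_gen2 (hvp i) (ht i) g01 u0 q0 zu (gen_Qf u).
by have [] := zone_gen2 (hvp i) (ht i) g01 q0 v10 zq (cycle_gen1 Qu (mem_head _ _)).
Qed.

Lemma cycle_lowE i y0 : ~~ zone (vp i) g D v1 -> neg (vp i) s y0 ->
  (forall z, neg (vp i) s z -> vp i z <= vp i y0) ->
  [/\ vp i v1 <= 4%:Z * vp i y0, vp i v2 <= 4%:Z * vp i y0 & vp i v3 <= 4%:Z * vp i y0].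
Proof.
move=> nz ny hy; have [g1 D1] := nonzone_tate v1s v10 nz.
have [n1 n2 n3] := cycle_nonzone nz; have G := cycle_G nz.
have [_ _ l1] := negP3 n1; have [_ _ l2] := negP3 n2; have [_ _ l3] := negP3 n3.
have Qx1 : Qf x \in [:: v1; v2; v3] by rewrite Qx mem_head.
have [[h1 h2 h3]|[h1 h2 h3]|[h1 h2 h3]] := cycle_shape g1 D1 n1 n2 n3 f12 f23 f31 e3.
- have := cycle_low g1 D1 hy f12 f23 f31 e3 n1 n2 h1 h3 G xs Qx1.
  by move=> h; split; clear - h1 h2 l1 h; lia.
- have e3' : v1 = v2 + v3 by rewrite e3 addrCA (addKK c2) addr0.
  have p : [:: v2; v3; v1] =i [:: v1; v2; v3] by move=> u; rewrite !inE orbA orbC.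
  have := @cycle_low i g1 D1 y0 hy v2 v3 v1 x f23 f31 f12 e3' n2 n3 h1 h3.
  rewrite p => h; have := h _ xs Qx1; clear - h1 h2 l2 G p; move=> h'; have h4 := h' ltac:(by move=> u us; rewrite p; exact: G).
  by split; clear - h1 h2 l2 h4; lia.
- have e3' : v2 = v3 + v1 by rewrite e3 addrAC (addKK c2) add0r.
  have p : [:: v3; v1; v2] =i [:: v1; v2; v3] by move=> u; rewrite !inE orbC -orbA.
  have := @cycle_low i g1 D1 y0 hy v3 v1 v2 x f31 f12 f23 e3' n3 n1 h1 h3.
  rewrite p => h; have := h _ xs Qx1; clear - h1 h2 l3 G p; move=> h'; have h4 := h' ltac:(by move=> u us; rewrite p; exact: G).
  by split; clear - h1 h2 l3 h4; lia.
Qed.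

(** At a bad place [cycle_low] puts the cycle at 4 v(y) or deeper, so the derivative bound is
    available with m = r and W v1 v2 loses nothing against v1 v2. Infinity gains one. *)
Lemma square_WV : W v1 v2 = 0.
Proof.
have [v20 v30] := cycle_neq0.
apply/eqP; apply/negPn/negP => W0.
have vR v : is_val v -> v (W v1 v2 / (v1 * v2)) = v (W v1 v2) - (v v1 + v v2).
  by move=> hv; rewrite (valM hv) ?invr_eq0 ?mulf_neq0 // (valV hv) ?mulf_neq0 // (valM hv).
have : vi (W v1 v2 / (v1 * v2)) <= 0.
  apply: PF => [|i]; first by rewrite mulf_neq0 ?invr_eq0 ?mulf_neq0.
  rewrite vR //; have [z|nz] := boolP (zone (vp i) g D v1).
    have [h1 h2] := cycle_zone z.
    by have := @W_eqv i _ _ v10 v20 W0 (esym h1); clear; lia.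
  have [g1 D1] := nonzone_tate v1s v10 nz.
  have [n1 n2 n3] := cycle_nonzone nz.
  have [y [ny hy]] := neg_maxE D1 n1; have [_ _ e0] := negP3 ny.
  have [k1 k2 k3] := cycle_lowE nz ny hy.
  have := T_w2 g1 D1 ny hy n1 n2; rewrite -e3 => /(_ n3 W0) [r [q [[hp _] hqr hw _]]].
  have hr : r <= vp i y - 1 by clear - hp k1 k2 k3 e0; case: hp => [|[|]]; lia.
  have := hw hr; clear - hp hqr; case: hp => [|[|]]; lia.
have := W_inf W0; rewrite vR //; clear; lia.
Qed.

Lemma square_val i a : a \in [:: v1; v2; v3] ->
  zone (vp i) g D v1 -> x != 0 -> x + a != 0 -> vp i (x + a) = vp i x.
Proof.
move=> ai zv x0 xa0.
have as' : a \in s.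
  have [v2s v3s] := cycle_in; by move: ai; rewrite !inE => /or3P[]/eqP->.
have a0 : a != 0.
  have [v20 v30] := cycle_neq0; by move: ai; rewrite !inE => /or3P[]/eqP->.
have [z|nz] := boolP (zone (vp i) g D x).
  have gx : gen x (x + a).
    have := gen_Qf x; rewrite Qx => h; apply: genD; first exact: gen_id.
    exact: gen_trans h (cycle_gen1 (mem_head _ _) ai).
  have [h1 z1] := zone_gen2 (hvp i) (ht i) g01 x0 xa0 z gx.
  have gx' : gen (x + a) x.
    have := gen_Qf (x + a); rewrite QfD Qx (Q_cycle ai) addr0 => h.
    have := genD (gen_id _ _ _ _) (gen_trans h (cycle_gen1 (mem_head _ _) ai)).
    by rewrite -addrA (addKK c2) addr0.
  have [h2 _] := zone_gen2 (hvp i) (ht i) g01 xa0 x0 z1 gx'.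
  clear - h1 h2; lia.
have [g1 D1 x1 _] := nonzone c2 (hvp i) (ht i) D0 g01 hs xs x0 nz.
have [] // := val_addl c2 (hvp i) (y := a) x0.
have [_] := zone_gen2 (hvp i) (ht i) g01 v10 a0 zv (cycle_gen1 (mem_head _ _) ai).
rewrite vgeE // /(zone _) g1 oner_eq0 /= => /andP[_ h]; clear - h x1; lia.
Qed.

Lemma square_neq0 a : a \in [:: 0; v1; v2; v3] -> x + a != 0.
Proof.
move=> ai; apply: contra v10 => /eqP e; rewrite -Qx.
have -> : Qf x = Qf (x + a).
  rewrite QfD; move: ai; rewrite inE => /orP[/eqP->|/Q_cycle->]; last by rewrite addr0.
  by rewrite /Qf !phi0 !addr0.
by rewrite e /Qf !phi0 !addr0.
Qed.

(** W x a is also the Wronskian of x and x + a, and, by [square_WV], of x + b and x + c. So its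
    square is compared with the product over the whole coset of x. *)
Lemma square_Wx a b c : [/\ a \in [:: v1; v2; v3], b \in [:: v1; v2; v3] & c \in [:: v1; v2; v3]] ->
  c = a + b -> W x a = 0.
Proof.
case=> ai bi ci ec; apply/eqP; apply/negPn/negP => W0.
have WV0 : W b a = 0.
  have hW := square_WV; have [h1 h2] := W_cycle.
  by move: ai bi; rewrite !inE => /or3P[]/eqP-> /or3P[]/eqP->; rewrite ?(Wxx c2) // 1?(WC d) ?h1 ?h2 // (WC d) ?h1 ?h2.
have in0 u : u \in [:: v1; v2; v3] -> u \in [:: 0; v1; v2; v3] by rewrite [in X in _ -> X]inE => ->; rewrite orbT.
have x0 : x != 0 by have := @square_neq0 0 (mem_head _ _); rewrite addr0.
have xa := square_neq0 (in0 _ ai); have xb := square_neq0 (in0 _ bi); have xc := square_neq0 (in0 _ ci).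
have Wb : W (x + b) a = W x a by rewrite (WDl hd) WV0 addr0.
have Wb0 : W (x + b) a != 0 by rewrite Wb.
have exc : x + c = (x + b) + a by rewrite ec -addrA [b + a]addrC.
pose M := x * (x + a) * (x + b) * (x + c).
have M0 : M != 0 by rewrite !mulf_neq0.
have vR v : is_val v -> v (W x a ^+ 2 / M) =
    2%:Z * v (W x a) - (v x + v (x + a) + v (x + b) + v (x + c)).
  move=> hv; rewrite (valM hv) ?invr_eq0 ?expf_neq0 // (valV hv) // (valX hv) //.
  by rewrite /M !(valM hv) ?mulf_neq0.
have : vi (W x a ^+ 2 / M) <= 0.
  apply: PF => [|i]; first by rewrite mulf_neq0 ?invr_eq0 ?expf_neq0.
  rewrite vR //; have [z|nz] := boolP (zone (vp i) g D v1).
    rewrite !square_val //.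
    have Wr : W x (x + a) = W x a by exact: Wxr.
    have := @W_eqv i x (x + a) x0 xa; rewrite Wr square_val // => /(_ W0 erefl); clear; lia.
  have [g1 D1] := nonzone_tate v1s v10 nz.
  have [n1 n2 n3] := cycle_nonzone nz.
  have [y [ny hy]] := neg_maxE D1 n1; have [_ _ e0] := negP3 ny.
  have [k1 k2 k3] := cycle_lowE nz ny hy.
  have na : neg (vp i) s a by move: ai; rewrite !inE => /or3P[]/eqP->.
  have ka : vp i a <= 4%:Z * vp i y by move: ai; rewrite !inE => /or3P[]/eqP->.
  have [as' _ _] := negP3 na.
  have ns u : u \in [:: 0; v1; v2; v3] -> neg (vp i) s (x + u).
    move=> ui; apply: (cycle_G nz).
      have [v2s v3s] := cycle_in.
      move: ui; rewrite !inE => /or4P[]/eqP->; rewrite ?addr0 //; exact: hs.1.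
    rewrite QfD Qx; move: ui; rewrite inE => /orP[/eqP->|/Q_cycle->]; last by rewrite addr0 mem_head.
    by rewrite /Qf !phi0 !addr0 mem_head.
  have nx := ns 0 (mem_head _ _); rewrite addr0 in nx.
  have nxa := ns _ (in0 _ ai); have nxb := ns _ (in0 _ bi); have nxc := ns _ (in0 _ ci).
  have [_ _ lx] := negP3 nx; have [_ _ lxa] := negP3 nxa; have [_ _ lxb] := negP3 nxb; have [_ _ lxc] := negP3 nxc.
  have [mx1 mx2 mx3 mx4] : [/\ vp i x <= vp i y, vp i (x + a) <= vp i y, vp i (x + b) <= vp i y & vp i (x + c) <= vp i y].
    by split; apply: hy.
  have [r [q [[hp hq] hqr h1 h2]]] := T_w2 g1 D1 ny hy nx na nxa W0.
  have := T_w2 g1 D1 ny hy nxb na; rewrite -exc Wb => /(_ nxc W0) [r' [q' [[hp' hq'] hqr' h1' h2']]].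
  have kb : vp i b <= 4%:Z * vp i y by move: bi; rewrite !inE => /or3P[]/eqP->.
  have kc : vp i c <= 4%:Z * vp i y by move: ci; rewrite !inE => /or3P[]/eqP->.
  have [v20 v30] := cycle_neq0.
  have b0 : b != 0 by move: bi; rewrite !inE => /or3P[]/eqP->.
  have c0 : c != 0 by move: ci; rewrite !inE => /or3P[]/eqP->.
  (* A sum in the cycle is deep, so one of its two summands is. For the four pairs below this makes
     both x and x + a deep, or both x + b and x + c, and the corresponding plane has a surplus. *)
  have dis u u' w : neg (vp i) s u -> neg (vp i) s u' -> u + u' = w -> w != 0 ->
      vp i w <= 4%:Z * vp i y -> vp i u <= 4%:Z * vp i y \/ vp i u' <= 4%:Z * vp i y.
    move=> nu nu' e w0 kw; rewrite -e in w0 kw.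
    have [|h] := leP (vp i u) (4%:Z * vp i y); first by left.
    have [|h'] := leP (vp i u') (4%:Z * vp i y); first by right.
    have [_ u0 _] := negP3 nu; have [_ u0' _] := negP3 nu'.
    have := vgeD (hvp i) (m := 4%:Z * vp i y + 1) (x := u) (y := u').
    by rewrite !vgeE // => /(_ ltac:(clear - h; lia) ltac:(clear - h'; lia)); clear - kw; lia.
  have d1 := dis x (x + b) b nx nxb (addK2 c2 _ _) b0 kb.
  have d2 := dis x (x + c) c nx nxc (addK2 c2 _ _) c0 kc.
  have d3 := dis (x + a) (x + b) c nxa nxb ltac:(by rewrite addrACA (addKK c2) add0r ec) c0 kc.
  have d4 := dis (x + a) (x + c) b nxa nxc ltac:(by rewrite addrACA (addKK c2) add0r ec (addK2 c2)) b0 kb.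
  clear - e0 ka mx1 mx2 mx3 mx4 hp hq hqr h1 h2 hp' hq' hqr' h1' h2' d1 d2 d3 d4.
  case: hp => [[? [? ?]]|[[? [? ?]]|[? [? ?]]]]; case: hp' => [[? [? ?]]|[[? [? ?]]|[? [? ?]]]]; lia.
rewrite vR //.
have k1 : vi x + vi (x + a) + 1 <= vi (W x a).
  have Wr : W x (x + a) = W x a by exact: Wxr.
  by rewrite -Wr; apply: W_inf; rewrite Wr.
have k2 : vi (x + b) + vi (x + c) + 1 <= vi (W x a).
  have Wr : W (x + b) (x + c) = W x a by rewrite exc (Wxr c2 hd).
  by rewrite -Wr; apply: W_inf; rewrite Wr.
clear - k1 k2; lia.
Qed.

End Square.

(** * Modules A/Q (+) A/l: [x0] is an l-torsion point next to the cycle *)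

Section Mixed.
Variable x0 : K.
Hypothesis x0s : x0 \in s.
Hypothesis x00 : x0 != 0.
Hypothesis fx0 : f x0 = 0.

Lemma mixed_eq : t = g * x0 + D * x0 ^+ 3.
Proof.
have : x0 * (t + (g * x0 + D * x0 ^+ 3)) = 0 by rewrite -fx0 /phi; ring.
by move/eqP; rewrite mulf_eq0 (negbTE x00) (add_eq0 c2) => /eqP.
Qed.

Lemma Qx0 : Qf x0 = x0.
Proof. by rewrite /Qf fx0 phi0 !add0r. Qed.

Lemma mixed_z_neq0 a : a \in [:: v1; v2; v3] -> x0 + a != 0.
Proof.
move=> ai; apply: contra x00 => /eqP e.
have : Qf (x0 + a) = x0 by rewrite QfD Qx0 (Q_cycle ai) addr0.
by rewrite e => <-; rewrite /Qf !phi0 !addr0.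
Qed.

Lemma mixed_z_in a : a \in [:: v1; v2; v3] -> x0 + a \in s.
Proof.
have [v2s v3s] := cycle_in.
by move=> ai; apply: hs.1 => //; move: ai; rewrite !inE => /or3P[]/eqP->.
Qed.

Lemma mixed_gen_x0 a : a \in [:: v1; v2; v3] -> gen (x0 + a) x0.
Proof. by move=> ai; have := gen_Qf (x0 + a); rewrite QfD Qx0 (Q_cycle ai) addr0. Qed.

Lemma mixed_gen_v a b : a \in [:: v1; v2; v3] -> b \in [:: v1; v2; v3] -> gen (x0 + a) b.
Proof.
move=> ai bi; have [m1 m2 m3] := cycle_mem.
have h : gen (x0 + a) (f a) by have := genf (gen_id t g D (x0 + a)); rewrite (phiD c2) fx0 add0r.
apply: gen_trans h (cycle_gen1 _ bi).
by move: ai; rewrite !inE => /or3P[]/eqP->; rewrite ?f12 ?f23 ?f31 eqxx ?orbT.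
Qed.

Section MixedPlace.
Variable i : I.
Notation v := (vp i).

Lemma mixed_zone a : a \in [:: v1; v2; v3] -> zone v g D (x0 + a) ->
  [/\ zone v g D x0, zone v g D v1, v (x0 + a) <= v x0, v (x0 + a) <= v v1
    & forall b, b \in [:: v1; v2; v3] -> v (x0 + b) = v (x0 + a)].
Proof.
move=> ai za; have za0 := mixed_z_neq0 ai; have [m1 m2 m3] := cycle_mem.
have [h1 zx] := zone_gen2 (hvp i) (ht i) g01 za0 x00 za (mixed_gen_x0 ai).
have [h2 zv] := zone_gen2 (hvp i) (ht i) g01 za0 v10 za (mixed_gen_v ai m1).
split=> // b bi; have zb0 := mixed_z_neq0 bi.
have gab a' b' : a' \in [:: v1; v2; v3] -> b' \in [:: v1; v2; v3] -> gen (x0 + a') (x0 + b').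
  by move=> ai' bi'; apply: genD; [exact: mixed_gen_x0|exact: mixed_gen_v].
have [h3 zb] := zone_gen2 (hvp i) (ht i) g01 za0 zb0 za (gab _ _ ai bi).
have [h4 _] := zone_gen2 (hvp i) (ht i) g01 zb0 za0 zb (gab _ _ bi ai).
clear - h3 h4; lia.
Qed.

(** By [mixed_eq], t = g x0 + D x0^3, and the zone inequalities of v1 become strict at the larger
    valuation of x0. *)
Lemma mixed_t : zone v g D v1 -> v v1 < v x0 -> 1 <= v t.
Proof.
move=> /andP[z1 z2] lt; have t0 : t != 0.
  by apply/eqP => e; move: dt; rewrite e (d0 c2 hd) => /eqP; rewrite eq_sym oner_eq0.
rewrite -(vgeE _ _ t0) mixed_eq; apply: (vgeD (hvp i)).
  apply: (vge_g g01) => g1; rewrite vgeE //.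
  by move: z2; rewrite g1 oner_eq0 /=; clear - lt; lia.
by apply: vgeW (vgeM (hvp i) (vge_val v D) (vgeX (hvp i) 3 (vge_val v x0))); clear - z1 lt; lia.
Qed.

Lemma mixed_r1 : zone v g D v1 -> ~~ zone v g D x0 ->
  [/\ 0 <= v v1, v x0 < 0 & forall b, b \in [:: v1; v2; v3] -> v (x0 + b) = v x0].
Proof.
move=> zv nx; have [g1 D1 x1 _] := nonzone c2 (hvp i) (ht i) D0 g01 hs x0s x00 nx.
have [m1 m2 m3] := cycle_mem.
have hb b : b \in [:: v1; v2; v3] -> 0 <= v b.
  move=> bi; have b0 : b != 0.
    by have [v20 v30] := cycle_neq0; move: bi; rewrite !inE => /or3P[]/eqP->.
  have [_] := zone_gen2 (hvp i) (ht i) g01 v10 b0 zv (cycle_gen1 m1 bi).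
  by rewrite /(zone _) g1 oner_eq0 /= => /andP[].
split=> // [|b bi]; first exact: hb.
have [] // := val_addl c2 (hvp i) (y := b) x00.
by apply: vgeW (vge_val _ _); have := hb _ bi; clear - x1; lia.
Qed.

Lemma mixed_r2 : ~~ zone v g D v1 -> zone v g D x0 ->
  [/\ 0 <= v x0, v t = v x0 & forall b, b \in [:: v1; v2; v3] -> v (x0 + b) = v b].
Proof.
move=> nv zx; have [g1 D1] := nonzone_tate v1s v10 nv.
have [n1 n2 n3] := cycle_nonzone nv.
have x1 : 0 <= v x0 by move: zx; rewrite /(zone _) g1 oner_eq0 /= => /andP[].
split=> //.
  rewrite mixed_eq g1 mul1r; have [] // := val_addl c2 (hvp i) (y := D * x0 ^+ 3) x00.
  by apply: vgeW (vgeM (hvp i) (vge_val v D) (vgeX (hvp i) 3 (vge_val v x0))); clear - x1 D1; lia.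
move=> b bi; have nb : neg v s b by move: bi; rewrite !inE => /or3P[]/eqP->.
have [_ b0 b1] := negP3 nb; rewrite addrC.
have [] // := val_addl c2 (hvp i) (y := x0) b0.
by apply: vgeW (vge_val _ _); clear - x1 b1; lia.
Qed.

(** f x0 = 0 stops the doubling, so x0 lies on the floor together with b and c. Adding x0 to these
    cancels leading terms, and the new valuations are read off by halving those of f (x0 + b) = c
    and f (x0 + c) = a. *)
Lemma mixed_r3_aux a b c : neg v s a -> neg v s b -> neg v s c ->
  f b = c -> f c = a -> v b = 2%:Z * v a -> v c = 2%:Z * v a -> 4%:Z * v a + v D = 0 ->
  ~~ zone v g D x0 -> neg v s (x0 + b) -> neg v s (x0 + c) ->
  [/\ v x0 = 2%:Z * v a, v (x0 + a) = 2%:Z * v a, v (x0 + b) = v a & 2%:Z * v (x0 + c) = v a].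
Proof.
move=> na nb nc bc ca hb hc ha nx nzb nzc.
have nx0 := nonzone_neg x0s x00 nx; have [g1 D1] := nonzone_tate x0s x00 nx.
have [_ _ a1] := negP3 na.
have vx : v x0 = 2%:Z * v a.
  have tx := T_top g1 D1 nx0; have [h|h] := leP (2%:Z * v x0 + v D) 0; first by clear - h tx ha; lia.
  by have [] := T_dbl g1 D1 nx0 h; rewrite fx0 /(neg _) eqxx andbF.
have fz u u' : f u = u' -> f (x0 + u) = u' by move=> <-; rewrite (phiD c2) fx0 add0r.
split=> //.
- rewrite -vx; have [] // := val_addl c2 (hvp i) (y := a) x00.
  by apply: vgeW (vge_val _ _); clear - vx a1; lia.
- have [_ zb0 _] := negP3 nzb.
  have h := T_same g1 D1 nx0 nb zb0 ltac:(by rewrite vx hb).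
  have [_] := T_dbl g1 D1 nzb ltac:(clear - h vx ha; lia); rewrite (fz _ _ bc) hc; clear; lia.
- have [_ zc0 _] := negP3 nzc.
  have h := T_same g1 D1 nx0 nc zc0 ltac:(by rewrite vx hc).
  by have [_] := T_dbl g1 D1 nzc ltac:(clear - h vx ha; lia); rewrite (fz _ _ ca) => ->.
Qed.

Notation z1 := (x0 + v1).
Notation z2 := (x0 + v2).
Notation z3 := (x0 + v3).

Lemma mixed_r3 : ~~ zone v g D v1 -> ~~ zone v g D x0 -> neg v s z1 -> neg v s z2 -> neg v s z3 ->
  exists h, [/\ is_plane (2%:Z * h) (4%:Z * h) (v v1) (v v2) (v v3), v x0 = 4%:Z * h, h < 0,
    v v1 + v v2 + v v3 = 10%:Z * h & v z1 + v z2 + v z3 = 7%:Z * h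
    /\ exists c, [/\ c \in [:: v1; v2; v3], v c = 4%:Z * h, v (x0 + c) = h & neg v s (x0 + c) /\ neg v s c]].
Proof.
move=> nv nx nz1 nz2 nz3; have [n1 n2 n3] := cycle_nonzone nv; have [m1 m2 m3] := cycle_mem.
have [g1 D1] := nonzone_tate v1s v10 nv.
have [_ _ l1] := negP3 n1; have [_ _ l2] := negP3 n2; have [_ _ l3] := negP3 n3.
have [[h1 h2 h3]|[h1 h2 h3]|[h1 h2 h3]] := cycle_shape g1 D1 n1 n2 n3 f12 f23 f31 e3.
- have [k1 k2 k3 k4] := mixed_r3_aux n1 n2 n3 f23 f31 h1 h2 h3 nx nz2 nz3.
  exists (v z3); split; try by clear - h1 h2 k1 k2 k3 k4 l1; lia.
    by split; [right; right|]; clear - h1 h2 k4 l1; lia.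
  split; first by clear - h1 h2 k1 k2 k3 k4 l1; lia.
  by exists v3; split=> //; clear - h2 k4; lia.
- have [k1 k2 k3 k4] := mixed_r3_aux n2 n3 n1 f31 f12 h1 h2 h3 nx nz3 nz1.
  exists (v z1); split; try by clear - h1 h2 k1 k2 k3 k4 l2; lia.
    by split; [right; left|]; clear - h1 h2 k4 l2; lia.
  split; first by clear - h1 h2 k1 k2 k3 k4 l1; lia.
  by exists v1; split=> //; clear - h2 k4; lia.
- have [k1 k2 k3 k4] := mixed_r3_aux n3 n1 n2 f12 f23 h1 h2 h3 nx nz1 nz2.
  exists (v z2); split; try by clear - h1 h2 k1 k2 k3 k4 l3; lia.
    by split; [left|]; clear - h1 h2 k4 l3; lia.
  split; first by clear - h1 h2 k1 k2 k3 k4 l1; lia.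
  by exists v2; split=> //; clear - h2 k4; lia.
Qed.

Lemma mixed_shape2 : ~~ zone v g D v1 -> exists h,
  [/\ is_plane h (2%:Z * h) (v v1) (v v2) (v v3), h < 0, v v1 + v v2 + v v3 = 5%:Z * h
    & exists c, [/\ c \in [:: v1; v2; v3], v c = 2%:Z * h & neg v s c]].
Proof.
move=> nv; have [n1 n2 n3] := cycle_nonzone nv; have [m1 m2 m3] := cycle_mem.
have [g1 D1] := nonzone_tate v1s v10 nv.
have [_ _ l1] := negP3 n1; have [_ _ l2] := negP3 n2; have [_ _ l3] := negP3 n3.
have [[h1 h2 h3]|[h1 h2 h3]|[h1 h2 h3]] := cycle_shape g1 D1 n1 n2 n3 f12 f23 f31 e3.
- exists (v v1); split=> //; [|by clear - h1 h2; lia|by exists v2].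
  by split; [right; right|]; clear - h1 h2 l1; lia.
- exists (v v2); split=> //; [|by clear - h1 h2; lia|by exists v3].
  by split; [right; left|]; clear - h1 h2 l2; lia.
- exists (v v3); split=> //; [|by clear - h1 h2; lia|by exists v1].
  by split; [left|]; clear - h1 h2 l3; lia.
Qed.

Lemma mixed_nz : ~~ zone v g D z1 -> [/\ neg v s z1, neg v s z2 & neg v s z3].
Proof.
move=> nz; have [m1 m2 m3] := cycle_mem.
have h a : a \in [:: v1; v2; v3] -> neg v s (x0 + a).
  move=> ai; apply: nonzone_neg; [exact: mixed_z_in|exact: mixed_z_neq0|].
  apply: contra nz => za; have [zx zv _ _ hb] := mixed_zone ai za.
  by apply: (zone_le za); rewrite hb.
by split; apply: h.
Qed.

(** The cases are the positions of x0 and v1 relative to the zone. The weights keep the estimate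
    homogeneous and make it tight in each case: inside the zone it reduces to v(z1) <= v(x0), and
    outside the bounds used meet for h = -1. *)
Lemma mixed_I1 : W v1 v2 != 0 ->
  10%:Z * (v v1 + v v2 + v v3) + 2%:Z * (v z1 + v z2 + v z3) <= 15%:Z * v (W v1 v2) + 6%:Z * v x0.
Proof.
move=> W0; have [m1 m2 m3] := cycle_mem; have [v20 v30] := cycle_neq0.
have [zz|nz] := boolP (zone v g D z1).
  have [zx zv hx hv hb] := mixed_zone m1 zz; have [h2 h3] := cycle_zone zv.
  have := W_eqv v10 v20 W0 (esym h2); rewrite (hb _ m2) (hb _ m3); clear - hx h2 h3; lia.
have [nz1 nz2 nz3] := mixed_nz nz.
have [zv|nv] := boolP (zone v g D v1).
  have [h2 h3] := cycle_zone zv.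
  have [zx|nx] := boolP (zone v g D x0).
    have [_ _ l1] := negP3 nz1; have [g1 D1] := nonzone_tate (mixed_z_in m1) (mixed_z_neq0 m1) nz.
    move: zx zv; rewrite /(zone _) g1 oner_eq0 /= => /andP[_ a1] /andP[_ a2].
    have := vgeD (hvp i) (m := 0) (x := x0) (y := v1); rewrite !vgeE //; last exact: mixed_z_neq0.
    by move=> /(_ a1 a2); clear - l1; lia.
  have [k1 k2 hb] := mixed_r1 zv nx.
  have := W_eqv v10 v20 W0 (esym h2); rewrite !hb //; clear - h2 h3; lia.
have [n1 n2 n3] := cycle_nonzone nv; have [g1 D1] := nonzone_tate v1s v10 nv.
have [zx|nx] := boolP (zone v g D x0).
  have [k1 k2 hb] := mixed_r2 nv zx; rewrite !hb //.
  have [h [hp h0 hsum _]] := mixed_shape2 nv.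
  have [y [ny hy]] := neg_maxE D1 n1.
  have hw := @T_w i g1 D1 y ny hy v1 v2 (h - 1) h (2%:Z * h) n1 n2; rewrite -e3 in hw.
  have mh : h <= v y.
    by have := hy _ n1; have := hy _ n2; have := hy _ n3; case: hp => [[|[|]]]; clear; lia.
  have := hw n3 W0 hp ltac:(clear - h0; lia) ltac:(clear - mh; lia).
  clear - h0 hsum k1; lia.
have [h [hp hx h0 hsum [hsum2 [c [ci c1 c3 [nzc nc]]]]]] := mixed_r3 nv nx nz1 nz2 nz3.
have [y [ny hy]] := neg_maxE D1 n1.
have hw := @T_w i g1 D1 y ny hy v1 v2 (h - 1) (2%:Z * h) (4%:Z * h) n1 n2; rewrite -e3 in hw.
have mh : h <= v y by have := hy _ nzc; rewrite c3.
have := hw n3 W0 hp ltac:(clear - h0; lia) ltac:(clear - mh; lia).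
clear - h0 hsum hsum2 hx; lia.
Qed.

(** Differentiating x0 may cost one, v(kap) >= v(x0) - 1. Inside the zone this hurts only if v(v1) <
    v(x0), and then [mixed_t] gives v(t) >= 1; this is the origin of the term in t. *)
Lemma mixed_I2 kap : kap != 0 ->
  (forall a, a \in [:: v1; v2; v3] -> W x0 a = kap * a) ->
  3%:Z * v x0 + 3%:Z * (v z1 + v z2 + v z3)
    <= 3%:Z * v t + 6%:Z * v kap + 2%:Z * (v v1 + v v2 + v v3).
Proof.
move=> kap0 hk; have [m1 m2 m3] := cycle_mem; have [v20 v30] := cycle_neq0.
have t0 : t != 0.
  by apply/eqP => e; move: dt; rewrite e (d0 c2 hd) => /eqP; rewrite eq_sym oner_eq0.
have vt : 0 <= v t by rewrite -(vgeE _ _ t0).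
have n0 a : a \in [:: v1; v2; v3] -> a != 0 by rewrite !inE => /or3P[]/eqP->.
have vk a : a \in [:: v1; v2; v3] -> W x0 a != 0 /\ v (W x0 a) = v kap + v a.
  by move=> ai; rewrite hk //; split; [rewrite mulf_neq0 ?(n0 a)|rewrite (valM (hvp i)) ?(n0 a)].
have gk a : a \in [:: v1; v2; v3] -> v x0 - 1 <= v kap.
  move=> ai; have [W0 e] := vk a ai.
  have : vge v (v x0 + v a - 1) (W x0 a).
    by apply: (W_vge (hvp i) (hd1 i x0) (hd1 i a)); clear; lia.
  by rewrite vgeE // e; clear; lia.
have [zz|nz] := boolP (zone v g D z1).
  have [zx zv hx hv hb] := mixed_zone m1 zz; have [h2 h3] := cycle_zone zv.
  rewrite (hb _ m2) (hb _ m3) h2 h3; have G := gk _ m1.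
  have [lt|gt|e] := ltgtP (v v1) (v x0).
  - have ht1 := mixed_t zv lt; clear - hx hv G ht1 lt; lia.
  - clear - hx hv G gt vt; lia.
  - have [W0 eW] := vk _ m1.
    have := W_eqv x00 v10 W0 (esym e); rewrite eW; clear - hx hv e vt; lia.
have [nz1 nz2 nz3] := mixed_nz nz.
have [zv|nv] := boolP (zone v g D v1).
  have [h2 h3] := cycle_zone zv.
  have [zx|nx] := boolP (zone v g D x0).
    have [_ _ l1] := negP3 nz1; have [g1 D1] := nonzone_tate (mixed_z_in m1) (mixed_z_neq0 m1) nz.
    move: zx zv; rewrite /(zone _) g1 oner_eq0 /= => /andP[_ a1] /andP[_ a2].
    have := vgeD (hvp i) (m := 0) (x := x0) (y := v1); rewrite !vgeE //; last exact: mixed_z_neq0.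
    by move=> /(_ a1 a2); clear - l1; lia.
  have [k1 k2 hb] := mixed_r1 zv nx; have G := gk _ m1.
  rewrite !hb //; clear - h2 h3 G k1 k2 vt; lia.
have [n1 n2 n3] := cycle_nonzone nv; have [g1 D1] := nonzone_tate v1s v10 nv.
have [zx|nx] := boolP (zone v g D x0).
  have [k1 k2 hb] := mixed_r2 nv zx; rewrite !hb //.
  have [h [hp h0 hsum [c [ci ch nc]]]] := mixed_shape2 nv.
  have [y [ny hy]] := neg_maxE D1 n1.
  have mh : h <= v y.
    by have := hy _ n1; have := hy _ n2; have := hy _ n3; case: hp => [[|[|]]]; clear; lia.
  have [W0 eW] := vk _ ci.
  have dc : vge v (h - 1) (d c).
    apply: (der_bound c2 hd (hvp i) (hd1 i) (@hd0 i) (ht i) dt D0 g01 hs g1 D1 ny hy nc);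
    clear - h0 ch mh; lia.
  have : vge v (2%:Z * h) (W x0 c).
    by apply: (W_vge (hvp i) (hd0 k1) dc); clear - ch h0 k1; lia.
  by rewrite vgeE // eW ch k2; clear - hsum h0; lia.
have [h [hp hx h0 hsum [hsum2 [c [ci c1 c3 [nzc nc]]]]]] := mixed_r3 nv nx nz1 nz2 nz3.
have [y [ny hy]] := neg_maxE D1 n1.
have [W0 eW] := vk _ ci; have nx0 := nonzone_neg x0s x00 nx.
have hw := @T_w i g1 D1 y ny hy x0 c (h - 1) h (4%:Z * h) nx0 nc nzc W0.
have mh : h <= v y by have := hy _ nzc; rewrite c3.
have := hw _ ltac:(clear - h0; lia) ltac:(clear - mh; lia).
rewrite eW; move=> H; have := H ltac:(split; [left|]; clear - hx c1 c3 h0; lia).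
clear - h0 hsum hsum2 hx c1 vt; lia.
Qed.

End MixedPlace.

Notation z1 := (x0 + v1).
Notation z2 := (x0 + v2).
Notation z3 := (x0 + v3).

(** When the Wronskians on the cycle vanish, its points share one logarithmic derivative, so W x0 a
    is [kap] times a. Six bounds at infinity, three of type [A] and three of type [B], add up to the
    exponents of N / M with a surplus of 6, of which t^3 consumes 3. *)
Lemma mixed_step2 : vi t = -1 -> W v1 v2 = 0 -> W x0 v1 = 0.
Proof.
move=> vt WV; have [m1 m2 m3] := cycle_mem; have [v20 v30] := cycle_neq0.
apply/eqP; apply/negPn/negP => W0.
pose kap := W x0 v1 / v1.
have k0 : kap != 0 by rewrite mulf_neq0 ?invr_eq0.
have hk a : a \in [:: v1; v2; v3] -> W x0 a = kap * a.
  move=> ai; have Wa : W v1 a = 0.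
    have [h1 h2] := W_cycle; move: ai; rewrite !inE => /or3P[]/eqP->; rewrite ?(Wxx c2) //.
    by rewrite h2.
  rewrite /kap; apply: (mulfI v10).
  have : v1 * W x0 a + a * W x0 v1 = x0 * W v1 a by rewrite /(W x0 a) /(W x0 v1) /(W v1 a); ring: c2.
  rewrite Wa mulr0 => /eqP; rewrite (add_eq0 c2) => /eqP->.
  by field.
clearbody kap.
have t0 : t != 0.
  by apply/eqP => e; move: dt; rewrite e (d0 c2 hd) => /eqP; rewrite eq_sym oner_eq0.
have z10 := mixed_z_neq0 m1; have z20 := mixed_z_neq0 m2; have z30 := mixed_z_neq0 m3.
pose N := t ^+ 3 * kap ^+ 6 * (v1 * v2 * v3) ^+ 2.
pose M := x0 ^+ 3 * (z1 * z2 * z3) ^+ 3.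
have N0 : N != 0 by rewrite !(mulf_neq0, expf_neq0).
have M0 : M != 0 by rewrite !(mulf_neq0, expf_neq0).
have vR v : is_val v -> v (N / M) = 3%:Z * v t + 6%:Z * v kap + 2%:Z * (v v1 + v v2 + v v3)
    - (3%:Z * v x0 + 3%:Z * (v z1 + v z2 + v z3)).
  move=> hv; rewrite (valM hv) ?invr_eq0 // (valV hv) // /N /M.
  by rewrite !(valM hv, valX hv) ?(mulf_neq0, expf_neq0).
have : vi (N / M) <= 0.
  apply: PF => [|i]; first by rewrite mulf_neq0 ?invr_eq0.
  by rewrite vR // subr_ge0; apply: mixed_I2.
rewrite vR //.
have n0 a : a \in [:: v1; v2; v3] -> a != 0 by rewrite !inE => /or3P[]/eqP->.
have vk a : a \in [:: v1; v2; v3] -> W x0 a != 0 /\ vi (W x0 a) = vi kap + vi a.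
  by move=> ai; rewrite hk //; split; [rewrite mulf_neq0 ?(n0 a)|rewrite (valM hvi) ?(n0 a)].
have A a : a \in [:: v1; v2; v3] -> vi x0 + vi (x0 + a) + 1 <= vi kap + vi a.
  move=> ai; have [Wa <-] := vk a ai.
  have Wr : W x0 (x0 + a) = W x0 a by exact: Wxr.
  by rewrite -Wr; apply: W_inf; rewrite Wr.
have WV0 a b : a \in [:: v1; v2; v3] -> b \in [:: v1; v2; v3] -> W a b = 0.
  have [h1 h2] := W_cycle; rewrite WV in h1 h2.
  have h a' : a' \in [:: v1; v2; v3] -> W a' v1 = 0.
    by rewrite !inE => /or3P[]/eqP->; rewrite ?(Wxx c2) // (WC d).
  by move=> /h ha /h hb; apply: (W_trans c2 v10 ha); rewrite (WC d).
have B a b c : a \in [:: v1; v2; v3] -> b \in [:: v1; v2; v3] -> c \in [:: v1; v2; v3] -> c = a + b ->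
    vi (x0 + a) + vi (x0 + b) + 1 <= vi kap + vi c.
  move=> ai bi ci ec; have [Wc <-] := vk c ci.
  have Wr : W (x0 + a) (x0 + b) = W x0 c.
    by rewrite (WDl hd x0 a) !(WDr hd _ x0 b) (Wxx c2) (WV0 a b) // add0r addr0 (WC d a) ec (WDr hd) addrC.
  by rewrite -Wr; apply: W_inf; rewrite Wr.
have A1 := A _ m1; have A2 := A _ m2; have A3 := A _ m3.
have B1 := B _ _ _ m1 m2 m3 e3.
have B2 := B _ _ _ m2 m3 m1 ltac:(by rewrite e3 addrCA (addKK c2) addr0).
have B3 := B _ _ _ m3 m1 m2 ltac:(by rewrite e3 addrAC (addKK c2) add0r).
clear - vt A1 A2 A3 B1 B2 B3; lia.
Qed.

End Mixed.

End Cycle.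

Lemma square_absurd v1 v2 v3 x : f v1 = v2 -> f v2 = v3 -> f v3 = v1 -> v3 = v1 + v2 ->
  v1 != 0 -> v1 \in s -> x \in s -> Qf x = v1 -> False.
Proof.
move=> f12 f23 f31 e3 v10 v1s xs Qx.
have [v20 v30] := cycle_neq0 f23 f31 v10.
have [v2s v3s] := cycle_in f12 f23 v1s.
have [m1 m2 m3] := cycle_mem v1 v2 v3.
have WV := square_WV f12 f23 f31 e3 v10 v1s xs Qx.
have [h1 h2] := W_cycle e3; rewrite WV in h1 h2.
have Wx1 : W x v1 = 0 by apply: (@square_Wx _ _ _ f12 f23 f31 e3 v10 v1s x xs Qx v1 v2 v3).
have e1 : v1 = v2 + v3 by rewrite e3 addrCA (addKK c2) addr0.
have fxs : f x \in s by exact: hs.2.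
have Qfx : Qf (f x) = v2 by rewrite Qff Qx.
have [k1 k2 k3] := cycle_mem v2 v3 v1.
have Wfx : W (f x) v2 = 0 by apply: (@square_Wx _ _ _ f23 f31 f12 e1 v20 v2s (f x) fxs Qfx v2 v3 v1).
have Wf1 : W (f x) v1 = 0 by apply: (W_trans c2 v20 Wfx); rewrite (WC d).
have xn a : a \in [:: v1; v2; v3] -> x + a != 0.
  move=> ai; apply: (square_neq0 f12 f23 f31 e3 v10 Qx).
  by rewrite inE ai orbT.
have x0 : x != 0.
  by apply: contra v10 => /eqP e; rewrite -Qx e /Qf !phi0 !addr0.
have nq (u u' : K) : u + u' != 0 -> (u == u') = false by rewrite (add_eq0 c2) => /negbTE.
apply: (@four_equiv _ c2 d hd t g D [:: v1; v2; v3; x]) => //.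
- rewrite /= !inE (nq v1 v2) -?e3 // (nq v2 v3) -?e1 // (nq v1 x) 1?addrC ?xn // (nq v2 x) 1?addrC ?xn // (nq v3 x) 1?addrC ?xn //.
  by rewrite (nq v1 v3) // e3 (addK2 c2).
- by rewrite !inE !negb_or ![0 == _]eq_sym v10 v20 v30 x0.
- have h u : u \in [:: v1; v2; v3; x] -> W u v1 = 0.
    by rewrite !inE => /or4P[]/eqP->; rewrite ?(Wxx c2) // (WC d).
  by move=> u u' /h ha /h hb; apply: (W_trans c2 v10 ha); rewrite (WC d).
- move=> u; rewrite !inE => /or4P[]/eqP->; rewrite ?f12 ?f23 ?f31.
  + by rewrite (WC d).
  + by rewrite (WC d).
  + by [].
  + by apply: (W_trans c2 v10 Wf1); rewrite (WC d).
Qed.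

Lemma Qf_cycle x : Qf x = 0 -> f (f x) = x + f x /\ f (f (f x)) = x.
Proof.
rewrite /Qf => h; have e : f (f x) = x + f x.
  by apply/eqP; rewrite -(add_eq0 c2) -h [x + f x]addrC addrA.
by split=> //; rewrite e (phiD c2) e addrCA (addKK c2) addr0.
Qed.

Section FullQ.
Variable i0 : I.
Hypothesis res0 : forall x y, x != 0 -> y != 0 -> x + y != 0 -> vp i0 x = vp i0 y ->
  vp i0 x < vp i0 (x + y).

Lemma Qtors_val x : x \in s -> x != 0 -> Qf x = 0 ->
  [/\ g = 1, 0 < vp i0 D, neg (vp i0) s x, 4%:Z * vp i0 x + vp i0 D <= 0 &
    exists a, [/\ a \in [:: x; f x; f (f x)], neg (vp i0) s a & 4%:Z * vp i0 a + vp i0 D = 0]].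
Proof.
move=> xs x0 /Qf_cycle [e1 e2].
have [y0 z0] := cycle_neq0 erefl e2 x0.
have [m1 m2 m3] := cycle_mem x (f x) (f (f x)).
have nz : ~~ zone (vp i0) g D x.
  apply/negP => z; have [h1 h2] := cycle_zone erefl erefl e2 x0 z.
  have := @res0 x (f x) x0 y0; rewrite -e1 => /(_ z0 (esym h1)); clear - h2; lia.
have [g1 D1] := nonzone_tate xs x0 nz.
have [n1 n2 n3] := cycle_nonzone erefl erefl e2 x0 xs nz.
have := cycle_shape g1 D1 n1 n2 n3 erefl erefl e2 e1.
have [_ _ l1] := negP3 n1; have [_ _ l2] := negP3 n2; have [_ _ l3] := negP3 n3.
by case=> [[h1 h2 h3]|[h1 h2 h3]|[h1 h2 h3]]; split=> //; try (by clear - h1 h2 h3 l1 l2 l3; lia);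
  [exists x|exists (f x)|exists (f (f x))].
Qed.

(** With residue field F_2 three elements of equal valuation cannot sum to 0, so every cycle lies
    outside the zone and its highest point has valuation - v(D) / 4. The sum of the highest points
    of two independent cycles would be a Q-torsion point higher still. *)
Lemma full_Q_absurd x y : x \in s -> y \in s -> x != 0 -> y != 0 -> Qf x = 0 -> Qf y = 0 ->
  (forall a b, a \in [:: x; f x; f (f x)] -> b \in [:: y; f y; f (f y)] -> a + b != 0) -> False.
Proof.
move=> xs ys x0 y0 Qx Qy hab.
have [g1 D1 nx _ [a [ai na ha]]] := Qtors_val xs x0 Qx.
have [_ _ ny _ [b [bi nb hb]]] := Qtors_val ys y0 Qy.
have s0 := hab _ _ ai bi.
have Qz u u' : Qf u = 0 -> u' \in [:: u; f u; f (f u)] -> Qf u' = 0.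
  by move=> h; rewrite !inE => /or3P[]/eqP->; rewrite ?Qff h ?phi0.
have [as' _ _] := negP3 na; have [bs _ _] := negP3 nb.
have [_ _ _ h _] := Qtors_val (hs.1 _ _ as' bs) s0 ltac:(by rewrite QfD (Qz x a) // (Qz y b) // addr0).
have := T_same g1 D1 na nb s0 ltac:(clear - ha hb; lia); clear - h ha; lia.
Qed.

End FullQ.


(** * The place at infinity and the end of the case A/Q (+) A/l *)

Section Infinity.
Hypothesis resi : forall x y, x != 0 -> y != 0 -> x + y != 0 -> vi x = vi y -> vi x < vi (x + y).
Hypothesis vit : vi t = -1.

Lemma t_neq0 : t != 0.
Proof. by apply/eqP => e; move: dt; rewrite e (d0 c2 hd) => /eqP; rewrite eq_sym oner_eq0. Qed.

Lemma inf_line x y : x != 0 -> y != 0 -> x + y != 0 ->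
  [\/ vi x = vi y /\ vi x < vi (x + y), vi (x + y) = vi x /\ vi x < vi y
    | vi (x + y) = vi y /\ vi y < vi x].
Proof.
move=> x0 y0 s0; have [lt|gt|e] := ltgtP (vi x) (vi y).
- apply: Or32; split=> //; have [] // := val_addl c2 hvi (y := y) x0.
  by rewrite vgeE //; clear - lt; lia.
- apply: Or33; split=> //; rewrite addrC; have [] // := val_addl c2 hvi (y := x) y0.
  by rewrite vgeE //; clear - gt; lia.
- by apply: Or31; split=> //; apply: resi.
Qed.

Lemma inf_f_ge x n : x != 0 -> n <= vi x - 1 -> (g = 1 -> n <= 2%:Z * vi x) ->
  n <= vi D + 4%:Z * vi x -> vge vi n (f x).
Proof.
move=> x0 h1 h2 h3; apply: (vgeD hvi); first apply: (vgeD hvi).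
- by apply: vgeW (vgeM hvi (vge_val vi t) (vge_val vi x)); rewrite vit; clear - h1; lia.
- apply: (vge_g g01) => /h2 h; by apply: vgeW (vgeX hvi 2 (vge_val vi x)).
- exact: vgeW (vgeM hvi (vge_val vi D) (vgeX hvi 4 (vge_val vi x))).
Qed.

(** A term of [f x] with valuation below M cannot be the only one of least valuation. *)
Lemma inf_f_eq x M : x != 0 -> vge vi M (f x) ->
  [/\ vi x - 1 < M -> (g = 1 /\ 2%:Z * vi x <= vi x - 1) \/ vi D + 4%:Z * vi x <= vi x - 1,
      g = 1 -> 2%:Z * vi x < M -> vi x - 1 <= 2%:Z * vi x \/ vi D + 4%:Z * vi x <= 2%:Z * vi x
    & vi D + 4%:Z * vi x < M -> vi x - 1 <= vi D + 4%:Z * vi x \/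
        (g = 1 /\ 2%:Z * vi x <= vi D + 4%:Z * vi x)].
Proof.
move=> x0 hM; have t0 := t_neq0.
have e1 : vi (t * x) = vi x - 1 by rewrite (valM hvi) // vit; clear; lia.
have e2 : vi (x ^+ 2) = 2%:Z * vi x by rewrite (valX hvi).
have e4 : vi (D * x ^+ 4) = vi D + 4%:Z * vi x by rewrite (valM hvi) ?expf_neq0 // (valX hvi).
have x20 : x ^+ 2 != 0 by rewrite expf_neq0.
have tx0 : t * x != 0 by rewrite mulf_neq0.
have Dx0 : D * x ^+ 4 != 0 by rewrite mulf_neq0 ?expf_neq0.
have absurd y z : f x = y + z -> y != 0 -> vi y < M -> vge vi (vi y + 1) z -> False.
  move=> e y0 h hz; have [s0 es] := val_addl c2 hvi y0 hz.
  by move: hM; rewrite e vgeE // es; clear - h; lia.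
split.
- move=> h; case: (boolP ((g == 1) && (2%:Z * vi x <= vi x - 1))) => [/andP[/eqP]|ng]; first by left.
  right; rewrite leNgt; apply/negP => h2.
  apply: (@absurd (t * x) (g * x ^+ 2 + D * x ^+ 4)) => //; rewrite ?e1 // ?addrA //.
  apply: (vgeD hvi); last by rewrite vgeE // e4; clear - h2; lia.
  apply: (vge_g g01) => g1; rewrite vgeE // e2; move: ng; rewrite g1 eqxx /=; clear; lia.
- move=> g1 h; have [h1|h1] := leP (vi x - 1) (2%:Z * vi x); first by left.
  right; rewrite leNgt; apply/negP => h2.
  apply: (@absurd (x ^+ 2) (t * x + D * x ^+ 4)) => //; rewrite ?e2 //.
    by rewrite /phi g1 mul1r addrA [x ^+ 2 + _]addrC.
  by apply: (vgeD hvi); rewrite vgeE // ?e1 ?e4; clear - h1 h2; lia.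
- move=> h; have [h1|h1] := leP (vi x - 1) (vi D + 4%:Z * vi x); first by left.
  right; case: (boolP ((g == 1) && (2%:Z * vi x <= vi D + 4%:Z * vi x))) => [/andP[/eqP]|ng] //.
  exfalso; apply: (@absurd (D * x ^+ 4) (t * x + g * x ^+ 2)) => //; rewrite ?e4 //.
    by rewrite /phi addrC.
  apply: (vgeD hvi); first by rewrite vgeE // e1; clear - h1; lia.
  apply: (vge_g g01) => g1; rewrite vgeE // e2; move: ng; rewrite g1 eqxx /=; clear; lia.
Qed.

(** If [f z] is as low as e, some term of [f z] is. For the linear term this is q <= p + 1; for the
    other two the information about M and D obtained from [inf_f_eq] at m and e leaves 2 q <= 3
    p. *)
Lemma inf_q m e z M p q : m != 0 -> e != 0 -> z != 0 ->
  vi m = M -> vi e = M + p -> vi z = M + q -> 0 < p -> p < q ->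
  vge vi M (f m) -> vge vi M (f e) -> f z != 0 -> vi (f z) <= M + p ->
  2%:Z * q <= 3%:Z * p \/ q <= p + 1.
Proof.
move=> m0 en0 z0 hm he hz p0 pq fm fe fz0 fz.
have [m1 m2 m3] := inf_f_eq m0 fm; have [e1 e2 e3] := inf_f_eq en0 fe.
have hz3 : [\/ vi z - 1 <= M + p, g = 1 /\ 2%:Z * vi z <= M + p | vi D + 4%:Z * vi z <= M + p].
  have [h1|h1] := leP (vi z - 1) (M + p); first exact: Or31.
  have [h3|h3] := leP (vi D + 4%:Z * vi z) (M + p); first exact: Or33.
  case: (boolP ((g == 1) && (2%:Z * vi z <= M + p))) => [/andP[/eqP g1 h2]|ng]; first exact: Or32.
  exfalso; have := @inf_f_ge z (M + p + 1) z0 ltac:(clear - h1; lia).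
  move=> /(_ _ ltac:(clear - h3; lia)); rewrite vgeE // => H.
  have := H ltac:(by move=> g1; move: ng; rewrite g1 eqxx /=; clear; lia); clear - fz; lia.
rewrite hm in m1 m2 m3; rewrite he in e1 e2 e3; rewrite hz in hz3.
have d1 := m1 ltac:(clear; lia).
case: g01 => g1.
  have ng : g <> 1 by rewrite g1 => /eqP; rewrite eq_sym oner_eq0.
  have {}d1 : vi D + 4%:Z * M <= M - 1 by case: d1 => // -[/ng].
  have {}m3 : M - 1 <= vi D + 4%:Z * M by case: (m3 ltac:(clear - d1; lia)) => // -[/ng].
  by case: hz3 => [h|[/ng]//|h]; clear - h d1 m3 p0 pq; lia.
have {}e2 := e2 g1; have {}m2 := m2 g1.
have {}d1 : 2%:Z * M <= M - 1 \/ vi D + 4%:Z * M <= M - 1 by case: d1 => [[]|]; auto.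
have {}m3 : vi D + 4%:Z * M < M -> M - 1 <= vi D + 4%:Z * M \/ 2%:Z * M <= vi D + 4%:Z * M.
  by move=> /m3 [|[]]; auto.
by case: hz3 => [h|[_ h]|h]; clear - h d1 m2 m3 e2 p0 pq; lia.
Qed.

(** The danger is cancellation that lifts a translate x0 + a far above x0 and a. But f (x0 + a) = f
    a stays low, so [inf_q] limits the lift, and [inf_line] lists the possible patterns. *)
Lemma mixed_inf v1 v2 v3 x0 : f v1 = v2 -> f v2 = v3 -> f v3 = v1 -> v3 = v1 + v2 ->
  v1 != 0 -> x0 != 0 -> f x0 = 0 -> W v1 v2 != 0 ->
  vi v2 < vi v1 -> vi v3 = vi v2 ->
  10%:Z * (vi v1 + vi v2 + vi v3) + 2%:Z * (vi (x0 + v1) + vi (x0 + v2) + vi (x0 + v3))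
    < 15%:Z * vi (W v1 v2) + 6%:Z * vi x0.
Proof.
move=> f12 f23 f31 e3 v10 x00 fx0 W0 lt eq.
have [v20 v30] := cycle_neq0 f23 f31 v10; have [m1 m2 m3] := cycle_mem v1 v2 v3.
have zn a : a \in [:: v1; v2; v3] -> x0 + a != 0 by exact: (mixed_z_neq0 f12 f23 f31 e3 x00 fx0).
have fz a : f (x0 + a) = f a by rewrite (phiD c2) fx0 add0r.
have w := W_inf W0.
have fv2 : vge vi (vi v2) (f v2) by rewrite f23 vgeE // eq.
have fv1 : vge vi (vi v2) (f v1) by rewrite f12 vgeE.
have B z : z != 0 -> f z != 0 -> vi (f z) <= vi v1 -> vi v1 < vi z ->
    2%:Z * (vi z - vi v2) <= 3%:Z * (vi v1 - vi v2) \/ vi z - vi v2 <= vi v1 - vi v2 + 1.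
  move=> z0 fz0 h1 h2.
  by apply: (@inf_q v2 v1 z (vi v2)) => //; clear - h1 h2 lt; lia.
have B1 := B _ (zn _ m1) ltac:(by rewrite fz f12) ltac:(by rewrite fz f12; apply: ltW).
have B2 := B _ (zn _ m2) ltac:(by rewrite fz f23) ltac:(by rewrite fz f23 eq; apply: ltW).
have B3 := B _ (zn _ m3) ltac:(by rewrite fz f31) ltac:(by rewrite fz f31).
have l1 := inf_line x00 v10 (zn _ m1); have l2 := inf_line x00 v20 (zn _ m2).
have l3 := inf_line x00 v30 (zn _ m3).
have e4 : (x0 + v2) + (x0 + v3) = v1.
  by rewrite addrACA (addKK c2) add0r e3 addrCA (addKK c2) addr0.
have l4 := inf_line (zn _ m2) (zn _ m3) ltac:(by rewrite e4); rewrite e4 in l4.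
clear - w B1 B2 B3 l1 l2 l3 l4 lt eq.
case: l2 => [[a1 a2]|[a1 a2]|[a1 a2]]; case: l3 => [[b1 b2]|[b1 b2]|[b1 b2]];
case: l1 => [[d1 d2]|[d1 d2]|[d1 d2]]; try (clear - eq lt a1 a2 b1 b2 d1 d2 w B1; lia);
case: l4 => [[h1 h2]|[h1 h2]|[h1 h2]]; lia.
Qed.

Lemma mixed_step1 v1 v2 v3 x0 : f v1 = v2 -> f v2 = v3 -> f v3 = v1 -> v3 = v1 + v2 ->
  v1 != 0 -> v1 \in s -> x0 \in s -> x0 != 0 -> f x0 = 0 -> W v1 v2 = 0.
Proof.
move=> f12 f23 f31 e3 v10 v1s x0s x00 fx0.
apply/eqP; apply/negPn/negP => W0.
have [v20 v30] := cycle_neq0 f23 f31 v10; have [m1 m2 m3] := cycle_mem v1 v2 v3.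
have zn a : a \in [:: v1; v2; v3] -> x0 + a != 0 by exact: (mixed_z_neq0 f12 f23 f31 e3 x00 fx0).
have z1 := zn _ m1; have z2 := zn _ m2; have z3 := zn _ m3.
have [w1 w2] := W_cycle e3.
pose N := W v1 v2 ^+ 15 * x0 ^+ 6.
pose M := (v1 * v2 * v3) ^+ 10 * ((x0 + v1) * (x0 + v2) * (x0 + v3)) ^+ 2.
have N0 : N != 0 by rewrite mulf_neq0 ?expf_neq0.
have M0 : M != 0 by rewrite mulf_neq0 ?expf_neq0 ?mulf_neq0.
have vR v : is_val v -> v (N / M) = 15%:Z * v (W v1 v2) + 6%:Z * v x0
    - (10%:Z * (v v1 + v v2 + v v3) + 2%:Z * (v (x0 + v1) + v (x0 + v2) + v (x0 + v3))).
  move=> hv; rewrite (valM hv) ?invr_eq0 // (valV hv) // /N /M.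
  by rewrite !(valM hv, valX hv) ?(mulf_neq0, expf_neq0).
have : vi (N / M) <= 0.
  apply: PF => [|i]; first by rewrite mulf_neq0 ?invr_eq0.
  rewrite vR // subr_ge0.
  exact: (mixed_I1 f12 f23 f31 e3 v10 v1s x0s x00 fx0).
rewrite vR //.
have e1 : v1 = v2 + v3 by rewrite e3 addrCA (addKK c2) addr0.
have e2 : v2 = v3 + v1 by rewrite e3 addrAC (addKK c2) add0r.
have w3 : W v3 v1 = W v1 v2 by rewrite (WC d) w2.
have := inf_line v10 v20; rewrite -e3 => /(_ v30) [[a1 a2]|[a1 a2]|[a1 a2]].
- have := @mixed_inf v3 v1 v2 x0 f31 f12 f23 e2 v30 x00 fx0; rewrite w3 => /(_ W0 a2 (esym a1)); clear; lia.
- have := @mixed_inf v2 v3 v1 x0 f23 f31 f12 e1 v20 x00 fx0; rewrite w1 a1 => /(_ W0 a2 erefl).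
  by clear - a1; lia.
- have := @mixed_inf v1 v2 v3 x0 f12 f23 f31 e3 v10 x00 fx0 W0 a2 a1; clear; lia.
Qed.

Lemma mixed_absurd v1 v2 v3 x0 : f v1 = v2 -> f v2 = v3 -> f v3 = v1 -> v3 = v1 + v2 ->
  v1 != 0 -> v1 \in s -> x0 \in s -> x0 != 0 -> f x0 = 0 -> False.
Proof.
move=> f12 f23 f31 e3 v10 v1s x0s x00 fx0.
have [v20 v30] := cycle_neq0 f23 f31 v10; have [m1 m2 m3] := cycle_mem v1 v2 v3.
have WV := mixed_step1 f12 f23 f31 e3 v10 v1s x0s x00 fx0.
have Wx := mixed_step2 f12 f23 f31 e3 v10 v1s x0s x00 fx0 vit WV.
have [h1 h2] := W_cycle e3; rewrite WV in h1 h2.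
have e1 : v1 = v2 + v3 by rewrite e3 addrCA (addKK c2) addr0.
have xn a : a \in [:: v1; v2; v3] -> a + x0 != 0.
  by move=> ai; rewrite addrC; apply: (mixed_z_neq0 f12 f23 f31 e3 x00 fx0).
have nq (u u' : K) : u + u' != 0 -> (u == u') = false by rewrite (add_eq0 c2) => /negbTE.
apply: (@four_equiv _ c2 d hd t g D [:: v1; v2; v3; x0]) => //.
- rewrite /= !inE (nq v1 v2) -?e3 // (nq v2 v3) -?e1 // (nq v1 x0) ?xn // (nq v2 x0) ?xn // (nq v3 x0) ?xn //.
  by rewrite (nq v1 v3) // e3 (addK2 c2).
- by rewrite !inE !negb_or ![0 == _]eq_sym v10 v20 v30 x00.
- have h u : u \in [:: v1; v2; v3; x0] -> W u v1 = 0.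
    by rewrite !inE => /or4P[]/eqP->; rewrite ?(Wxx c2) // (WC d).
  by move=> u u' /h ha /h hb; apply: (W_trans c2 v10 ha); rewrite (WC d).
- move=> u; rewrite !inE => /or4P[]/eqP->; rewrite ?f12 ?f23 ?f31 ?fx0.
  + by rewrite (WC d).
  + by rewrite (WC d).
  + by [].
  + by rewrite /(W _ _) (d0 c2 hd) !mul0r addr0.
Qed.

End Infinity.

End Global.

(** * Squares and coprime factorisations over F_2 *)

Section Squares.
Variable k : finFieldType.
Hypothesis k2 : forall c : k, c != 0 -> c = 1.
Implicit Types (a b c p q : {poly k}).

Let c2 := char2p k2.

Lemma paddKK a : a + a = 0.
Proof. by rewrite -mulr2n -mulr_natl c2 mul0r. Qed.

Lemma padd_eq0 a b : (a + b == 0) = (a == b).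
Proof. by rewrite addr_eq0 -[- b]add0r -(paddKK b) addrK. Qed.

Lemma psqrD a b : (a + b) ^+ 2 = a ^+ 2 + b ^+ 2.
Proof. by ring: c2. Qed.

Lemma psqr_inj a b : a ^+ 2 = b ^+ 2 -> a = b.
Proof.
move=> e; apply/eqP; rewrite -padd_eq0; have := expf_eq0 (a + b) 2.
by rewrite psqrD e paddKK eqxx => /esym.
Qed.

Lemma comp_sqr a : a \Po 'X^2 = a ^+ 2.
Proof.
elim/poly_ind: a => [|a c IH]; first by rewrite comp_poly0 expr0n.
rewrite comp_polyD comp_polyM comp_polyX comp_polyC IH psqrD exprMn -polyC_exp.
congr (_ + _%:P); have [->|/k2 ->] := eqVneq c 0; by rewrite ?expr0n ?expr1n.
Qed.

Lemma deriv_eq0 a : a^`() = 0 -> exists b, a = b ^+ 2.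
Proof.
rewrite -{1}[a]poly_even_odd derivD derivM !deriv_comp derivX mulr1 derivXn /=.
rewrite -mulr_natl c2 mul0r !mulr0 mul0r !add0r => e; exists (even_poly a).
by rewrite -{1}[a]poly_even_odd e mul0r addr0 comp_sqr.
Qed.

(** Differentiation gives a' b = a b', so a divides a', which has smaller degree. Hence a' = 0 and a
    is a square. *)
Lemma coprime_sqr a b c : coprimep a b -> a * b = c ^+ 2 ->
  exists a1 b1, [/\ a = a1 ^+ 2, b = b1 ^+ 2 & a1 * b1 = c].
Proof.
have sq x y : coprimep x y -> x * y = c ^+ 2 -> exists x1, x = x1 ^+ 2.
  move=> xy e; have [->|x0] := eqVneq x 0; first by exists 0; rewrite expr0n.
  apply: deriv_eq0; apply/eqP/negPn/negP => d0.
  have := congr1 (fun p => p^`()) e; rewrite /= expr2 !derivM.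
  rewrite [c * _]mulrC paddKK => /eqP; rewrite padd_eq0 => /eqP h.
  have : x %| x^`() by rewrite -(Gauss_dvdpl _ xy) h dvdp_mulr.
  move/(dvdp_leq d0); have := lt_size_deriv x0.
  by case: (size x) => [|n]; case: (size _) => [|m]; lia.
move=> ab e; have [a1 ea] := sq _ _ ab e.
have [b1 eb] : exists b1, b = b1 ^+ 2.
  by apply: (sq b a); rewrite ?(mulrC b) // coprimep_sym.
exists a1, b1; split=> //; apply: psqr_inj; by rewrite exprMn -ea -eb.
Qed.

Lemma unit_eq1 a : size a = 1%N -> a = 1.
Proof.
move=> s; have /size_poly1P [c c0 ->] : size a == 1%N by rewrite s.
by rewrite (k2 c0).
Qed.

Lemma eqp_eqF a b : a %= b -> a = b.
Proof.
case/eqpP => [[x y]] /= /andP[/k2 -> /k2 ->]; by rewrite !scale1r.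
Qed.

Lemma dvdp_eqF a b : a %| b -> b %| a -> a = b.
Proof. by move=> h1 h2; apply: eqp_eqF; rewrite /eqp h1. Qed.

Definition dg a := (size a).-1.

Lemma sizeE a : a != 0 -> size a = (dg a).+1.
Proof. by rewrite /dg -size_poly_gt0; case: (size a). Qed.

Lemma dgM a b : a != 0 -> b != 0 -> dg (a * b) = (dg a + dg b)%N.
Proof.
move=> a0 b0; rewrite /dg size_mul // (sizeE a0) (sizeE b0) /=.
by rewrite addnS.
Qed.

Lemma dg0 : dg 0 = 0%N. Proof. by rewrite /dg size_poly0. Qed.

Lemma dgM_le a b : (dg (a * b) <= dg a + dg b)%N.
Proof.
have [->|a0] := eqVneq a 0; first by rewrite mul0r dg0.
have [->|b0] := eqVneq b 0; first by rewrite mulr0 dg0.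
by rewrite dgM.
Qed.

Lemma dgX a n : dg (a ^+ n) = (n * dg a)%N.
Proof.
have [->|a0] := eqVneq a 0.
  by rewrite expr0n dg0 muln0; case: n => //=; rewrite ?dg0 // /dg size_poly1.
by elim: n => [|n IH]; rewrite ?expr0 ?exprS ?dgM ?expf_neq0 // ?IH ?mulSn // /dg size_poly1.
Qed.

Lemma dgD_le n a b : (dg a <= n)%N -> (dg b <= n)%N -> (dg (a + b)%R <= n)%N.
Proof. by have := size_polyD a b; rewrite /dg; lia. Qed.

Lemma dgD_gt a b : (dg b < dg a)%N -> dg (a + b) = dg a.
Proof. by rewrite /dg => h; rewrite size_polyDl //; lia. Qed.

Lemma dvdp_dg a b : a %| b -> b != 0 -> (dg a <= dg b)%N.
Proof. by move=> ab b0; have := dvdp_leq b0 ab; rewrite /dg; case: (size a); case: (size b) => //=; lia. Qed.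

Lemma dvdp_eq0 a b : a %| b -> (dg b < dg a)%N -> b = 0.
Proof.
move=> ab; have [//|b0] := eqVneq b 0; have := dvdp_dg ab b0; lia.
Qed.

Lemma dg_size_lt a b : (size b < size a)%N -> b != 0 -> (dg b < dg a)%N.
Proof. by move=> h b0; move: h; rewrite (sizeE b0) /dg; case: (size a). Qed.

Lemma coprimep_dvd a b p : irreducible_poly p -> coprimep a b -> p %| a -> ~~ (p %| b).
Proof.
move=> ip ab pa; apply/negP => pb; have := coprimepP _ _ ab p pa pb.
by rewrite -size_poly_eq1; have := ip.1; case: (size p) => [|[]].
Qed.

Lemma coprimep_irr a b : a != 0 ->
  (forall p, irreducible_poly p -> p %| a -> p %| b -> False) -> coprimep a b.
Proof.
move=> a0 h; have g0 : gcdp a b != 0 by rewrite gcdp_eq0 negb_and a0.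
rewrite /coprimep; move: g0; rewrite -size_poly_gt0.
case E : (size (gcdp a b)) => [|[|n]] // _.
have [p ip pg] : exists2 p, irreducible_poly p & p %| gcdp a b.
  by apply: exists_irredp; rewrite E.
by case: (h p ip); apply: (dvdp_trans pg); rewrite ?dvdp_gcdl ?dvdp_gcdr.
Qed.

Lemma irredpX p a n : irreducible_poly p -> p %| a ^+ n -> p %| a.
Proof.
move=> ip; elim: n => [|n IH].
  by rewrite expr0 => /(dvdp_dg)/(_ (oner_neq0 _)); have := ip.1; rewrite /dg size_poly1; case: (size p) => [|[]].
by rewrite exprS irredp_dvdM // => /orP[|/IH].
Qed.

Lemma irredp_size2 p : size p = 2%N -> irreducible_poly p.
Proof.
move=> s; have p0 : p != 0 by rewrite -size_poly_gt0 s.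
split; first by rewrite s.
move=> q q1 qp; rewrite -dvdp_size_eqp // s; have := dvdp_leq p0 qp.
have : q != 0 by apply: contraTneq qp => ->; rewrite dvd0p.
by rewrite -size_poly_gt0 s; move: q1; case: (size q) => [|[|[|]]].
Qed.

Lemma bezout_split a u x : a != 0 -> coprimep u a ->
  exists y r, x = u * y + a * r /\ (size y < size a)%N.
Proof.
move=> a0 /Bezout_eq1_coprimepP [[v w] /= e].
exists ((v * x) %% a), (u * ((v * x) %/ a) + w * x).
split; last by rewrite ltn_modp.
have E := divp_eq (v * x) a.
have -> : u * ((v * x) %% a) + a * (u * ((v * x) %/ a) + w * x)
  = u * ((v * x) %/ a * a + (v * x) %% a) + w * a * x by ring.
rewrite -E; have -> : u * (v * x) + w * a * x = (v * u + w * a) * x by ring.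
by rewrite e mul1r.
Qed.

Section T.
Variable t : {poly k}.
Hypothesis st : size t = 2%N.

Let it : irreducible_poly t := irredp_size2 st.

Lemma size2_neq0 : t != 0. Proof. exact: irredp_neq0. Qed.

Lemma dgt : dg t = 1%N. Proof. by rewrite /dg st. Qed.

Lemma coprime_tsqr a b c : coprimep a b -> a * b = t * c ^+ 2 ->
  exists m n, [/\ m * n = c, coprimep (t * m) n, a + b = t * m ^+ 2 + n ^+ 2 &
   (a = t * m ^+ 2 /\ b = n ^+ 2) \/ (b = t * m ^+ 2 /\ a = n ^+ 2)].
Proof.
wlog ta : a b / t %| a => [H|].
  move=> ab e; have : t %| a * b by rewrite e dvdp_mulr.
  rewrite irredp_dvdM // => /orP[h|h]; first exact: H.
  have [||m [n [h1 h2 h3 h4]]] := H _ _ h _ (_ : b * a = _).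
  - by rewrite coprimep_sym.
  - by rewrite mulrC.
  by exists m, n; split=> //; [rewrite addrC|case: h4; [right|left]].
move=> ab; case/dvdpP: ta => a1 ea; move=> e0.
have e : a1 * b = c ^+ 2.
  by apply: (mulfI size2_neq0); rewrite -e0 ea; ring.
have ab' := ab; rewrite ea coprimepMl in ab'; case/andP: ab' => c1 c1'.
have [m [n [h1 h2 h3]]] := coprime_sqr c1 e.
exists m, n; split=> //.
- rewrite coprimepMl; apply/andP; split.
    by move: c1'; rewrite h2 coprimep_pexpr.
  by move: c1; rewrite h1 h2 coprimep_pexpr // coprimep_pexpl.
- by rewrite ea h1 h2; ring.
- by left; rewrite ea h1; split=> //; ring.
Qed.

Lemma tmul_sqr a c : t * a = c ^+ 2 -> exists m, a = t * m ^+ 2 /\ c = t * m.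
Proof.
move=> e; have /dvdpP [m em] : t %| c.
  by apply: (@irredpX _ _ 2) => //; rewrite -e dvdp_mulr.
exists m; rewrite em; split; last by ring.
by apply: (mulfI size2_neq0); rewrite e em; ring.
Qed.
End T.
End Squares.

(** * Descent for A/l^2 (+) A/l *)

Section Quartic.
Variable k : finFieldType.
Hypothesis k2 : forall c : k, c != 0 -> c = 1.
Variable t : {poly k}.
Hypothesis st : size t = 2%N.
Implicit Types (a b c e g h i j p q r s m n : {poly k}).

Let c2 := char2p k2.
Let t0 := size2_neq0 st.
Let it : irreducible_poly t := irredp_size2 st.

Lemma pmove a b c : a + b = c -> a = b + c.
Proof. by move=> <-; rewrite addrCA (paddKK k2) addr0. Qed.

(** Otherwise t^5 e^6 dominates the right side, whose degree is then odd; the left side has even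
    degree if q^2 dominates and too small a degree if not. *)
Lemma cubic_dg e h q : e != 0 ->
  q ^+ 2 + t * e * h * q = h ^+ 3 + t ^+ 5 * e ^+ 6 -> (2 * dg e + 2 <= dg h)%N.
Proof.
move=> e0 E; rewrite leqNgt; apply/negP => lt.
have d1 : dg (t ^+ 5 * e ^+ 6) = (5 + 6 * dg e)%N by rewrite dgM ?expf_neq0 // !dgX dgt.
have d2 : dg (h ^+ 3 + t ^+ 5 * e ^+ 6) = (5 + 6 * dg e)%N.
  by rewrite addrC dgD_gt // d1 dgX; lia.
have d3 : (dg (t * e * h * q) <= 1 + dg e + dg h + dg q)%N.
  have := dgM_le (t * e * h) q; have := dgM_le (t * e) h; have := dgM_le t e.
  rewrite (dgt st); lia.
have [dq|dq] := ltnP (1 + dg e + dg h) (dg q).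
  have := d2; rewrite -E dgD_gt dgX; lia.
have : (dg (q ^+ 2 + t * e * h * q) <= 4 + 6 * dg e)%N.
  by apply: dgD_le; rewrite ?dgX; lia.
by rewrite E d2; lia.
Qed.

(** (h / e^2, q / e^3) is a point of the elliptic curve Y^2 + t X Y = X^3 + t^5. Splitting q along t
    e and h separates the equation into h = r^2 + t e r and y (y + h) = t (t e^2)^2. The factors of
    the latter are coprime, so they are a square and t times a square. *)
Lemma cubic_descent e h q : e != 0 -> coprimep h (t * e) ->
  q ^+ 2 + t * e * h * q = h ^+ 3 + t ^+ 5 * e ^+ 6 ->
  exists i j r, [/\ i * j = e, coprimep i j, coprimep t j &
    r ^+ 2 + t * i * j * r = t ^+ 3 * i ^+ 4 + j ^+ 4].
Proof.
move=> e0 cop E; have dh := cubic_dg e0 E.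
have h0 : h != 0 by apply: contraTneq dh => ->; rewrite dg0; lia.
have te0 : t * e != 0 by rewrite mulf_neq0.
have cop' : coprimep (t * e) h by rewrite coprimep_sym.
have [y [r [eq sy]]] := bezout_split q h0 cop'.
have H : (t * e) ^+ 2 * (y ^+ 2 + h * y + t ^+ 3 * e ^+ 4) = h ^+ 2 * (h + r ^+ 2 + t * e * r).
  apply/eqP; rewrite -(padd_eq0 k2); apply/eqP.
  have -> : (t * e) ^+ 2 * (y ^+ 2 + h * y + t ^+ 3 * e ^+ 4) + h ^+ 2 * (h + r ^+ 2 + t * e * r)
    = (q ^+ 2 + t * e * h * q) + (h ^+ 3 + t ^+ 5 * e ^+ 6) by rewrite eq; ring: c2.
  by rewrite E (paddKK k2).
have Z : y ^+ 2 + h * y + t ^+ 3 * e ^+ 4 = 0.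
  apply: (@dvdp_eq0 _ (h ^+ 2)).
    rewrite -(@Gauss_dvdpr _ _ ((t * e) ^+ 2)); last by rewrite coprimep_expl ?coprimep_expr.
    by rewrite H dvdp_mulr.
  have d1 : dg (t ^+ 3 * e ^+ 4) = (3 + 4 * dg e)%N by rewrite dgM ?expf_neq0 // !dgX dgt.
  rewrite dgX; apply: leq_ltn_trans (_ : 2 * dg h - 1 < _)%N; last by lia.
  apply: dgD_le; last by lia.
  have [->|y0] := eqVneq y 0; first by rewrite expr0n mulr0 addr0 dg0.
  have dy := dg_size_lt sy y0.
  by apply: dgD_le; rewrite ?dgX ?dgM //; lia.
have hE : h = r ^+ 2 + t * e * r.
  move/eqP: H; rewrite Z mulr0 eq_sym mulf_eq0 expf_eq0 /= (negbTE h0) -addrA (padd_eq0 k2).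
  by move/eqP.
have Y : y * (y + h) = t * (t * e ^+ 2) ^+ 2.
  by apply/eqP; rewrite -(padd_eq0 k2) -Z; apply/eqP; ring.
have y0 : y != 0.
  apply/eqP => y0; move/esym/eqP: Y; rewrite y0 mul0r.
  by rewrite !(mulf_eq0, expf_eq0) /= (negbTE e0) (negbTE t0).
have cy : coprimep y (y + h).
  apply: coprimep_irr => // p ip py pyh.
  have ph : p %| h by rewrite -(dvdp_addr _ py).
  have : p %| t * (t * e ^+ 2) ^+ 2 by rewrite -Y dvdp_mulr.
  have := coprimep_dvd ip cop ph; rewrite irredp_dvdM // negb_or => /andP[pt pe].
  rewrite irredp_dvdM // (negbTE pt) /= => /(irredpX ip).
  rewrite irredp_dvdM // (negbTE pt) /= => /(irredpX ip).
  by rewrite (negbTE pe).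
have [m [n [mn cmn s1 _]]] := coprime_tsqr k2 st cy Y.
have [|i [j [ij cij _ [[h1 h2]|[h1 h2]]]]] := coprime_tsqr k2 st _ mn.
- by move: cmn; rewrite coprimepMl => /andP[].
- move: cij; rewrite coprimepMl => /andP[c1 c3].
  exists i, j, r; split=> //.
  have -> : t * i * j * r = t * e * r by rewrite -ij; ring.
  rewrite -hE; move: s1; rewrite addrA (paddKK k2) add0r => ->.
  by rewrite h1 h2; ring.
- move: cmn; rewrite h1 => /(coprimep_dvd it); rewrite !dvdp_mulr //.
  by move=> /(_ isT).
Qed.

Lemma quartic_to_cubic g h p : g != 0 -> coprimep g h -> coprimep t h ->
  p ^+ 2 + t * g * h * p = t ^+ 3 * g ^+ 4 + h ^+ 4 ->
  exists e q, [/\ g = t * e ^+ 2, coprimep h (t * e) &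
    q ^+ 2 + t * e * h * q = h ^+ 3 + t ^+ 5 * e ^+ 6].
Proof.
move=> g0 gh th E.
(* In characteristic 2 the quartic rearranges into a square with two coprime factors. *)
have S : (t * g) * (h * p + t ^+ 2 * g ^+ 3) = (p + h ^+ 2) ^+ 2.
  apply/eqP; rewrite -(padd_eq0 k2); apply/eqP.
  have -> : t * g * (h * p + t ^+ 2 * g ^+ 3) + (p + h ^+ 2) ^+ 2
    = (p ^+ 2 + t * g * h * p) + (t ^+ 3 * g ^+ 4 + h ^+ 4) by ring: c2.
  by rewrite E (paddKK k2).
have tg0 : t * g != 0 by rewrite mulf_neq0.
have cgh : coprimep (t * g) h by rewrite coprimepMl th gh.
have cop : coprimep (t * g) (h * p + t ^+ 2 * g ^+ 3).
  apply: coprimep_irr => // x ix xtg.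
  have xh := coprimep_dvd ix cgh xtg.
  rewrite dvdp_addl; last first.
    have -> : t ^+ 2 * g ^+ 3 = (t * g) * (t * g ^+ 2) by ring.
    by rewrite dvdp_mulr.
  rewrite irredp_dvdM // (negbTE xh) /= => xp.
  have : x %| h ^+ 4.
    have -> : h ^+ 4 = p ^+ 2 + (t * g) * (h * p) + (t * g) * (t ^+ 2 * g ^+ 3).
      have -> : p ^+ 2 + (t * g) * (h * p) = t ^+ 3 * g ^+ 4 + h ^+ 4 by rewrite -E; ring.
      by ring: c2.
    by rewrite !dvdp_add ?(dvdp_mulr _ xtg) // expr2 dvdp_mulr.
  by move/(irredpX ix); rewrite (negbTE xh).
have [x [q [e1 e2 e3]]] := coprime_sqr k2 cop S.
have [e [ge xe]] := tmul_sqr st e1.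
exists e, q; split=> //.
  move: cgh; rewrite ge coprimep_sym; apply: coprimep_dvdl.
  by rewrite dvdp_mul // expr2 dvdp_mull // dvdp_mulr.
have pE : p = h ^+ 2 + t * e * q.
  by apply: pmove; rewrite -e3 xe.
rewrite -e2 pE ge; ring: c2.
Qed.

(** The passage through the cubic gives g = t e^2 and e = i j; the new solution has i in place of g,
    of smaller degree. *)
Lemma quartic_absurd g h p : g != 0 -> coprimep g h -> coprimep t h ->
  p ^+ 2 + t * g * h * p = t ^+ 3 * g ^+ 4 + h ^+ 4 -> False.
Proof.
have [N] := ubnP (dg g); elim: N g h p => // N IH g h p dN g0 gh th E.
have [e [q [ge he E2]]] := quartic_to_cubic g0 gh th E.
have e0 : e != 0 by apply: contraNneq g0 => e0; rewrite ge e0 expr0n mulr0.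
have [i [j [r [ij cij tj E3]]]] := cubic_descent e0 he E2.
have i0 : i != 0 by apply: contraNneq e0 => i0; rewrite -ij i0 mul0r.
have j0 : j != 0 by apply: contraNneq e0 => z; rewrite -ij z mulr0.
apply: (IH i j r) => //.
by move: dN; rewrite ge dgM ?expf_neq0 // dgX (dgt st) -ij dgM //; lia.
Qed.

(* The two coprime factorisations t m^2 * n^2 of one polynomial and the relation between
   the corresponding sums reduce, after removing common factors, to the quartic. *)
Lemma two_factorisations_absurd m n m1 n1 : m != 0 -> n != 0 ->
  coprimep (t * m) n -> coprimep (t * m1) n1 -> m * n = m1 * n1 ->
  t * (m + m1) ^+ 2 + (n + n1) ^+ 2 = t * m * n -> False.
Proof.
move=> m0 n0 cmn cmn1 E S.
set x := gcdp m m1; have x0 : x != 0 by rewrite gcdp_eq0 negb_and m0.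
have eb : m = m %/ x * x by rewrite divpK ?dvdp_gcdl.
have ec : m1 = m1 %/ x * x by rewrite divpK ?dvdp_gcdr.
have cop : coprimep (m %/ x) (m1 %/ x) by rewrite coprimep_div_gcd ?m0.
move: eb ec cop; set b := m %/ x; set c := m1 %/ x => eb ec cop.
have E1 : b * n = c * n1.
  by apply: (mulIf x0); rewrite mulrAC -eb E ec mulrAC.
have /dvdpP [y ny] : c %| n.
  by rewrite -(Gauss_dvdpr _ (_ : coprimep c b)) ?E1 ?dvdp_mulr // coprimep_sym.
have b0 : b != 0 by apply: contraNneq m0 => z; rewrite eb z mul0r.
have c0 : c != 0 by apply: contraNneq n0 => z; rewrite ny z mulr0.
have y0 : y != 0 by apply: contraNneq n0 => z; rewrite ny z mul0r.
have n1y : n1 = y * b by apply: (mulfI c0); rewrite -E1 ny; ring.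
have cxy : coprimep (t * x) y.
  move: cmn; rewrite ny eb coprimepMr => /andP[+ _].
  by apply: coprimep_dvdr; rewrite mulrA dvdp_mul // dvdp_mulr.
have tx0 : t * x != 0 by rewrite mulf_neq0.
have R : (b + c) ^+ 2 * (t * x ^+ 2 + y ^+ 2) = t * x * y * (b * c).
  have -> : t * x * y * (b * c) = t * m * n by rewrite eb ny; ring.
  by rewrite -S eb ec ny n1y; ring: c2.
have bc0 : b * c != 0 by rewrite mulf_neq0.
have cbc : coprimep (b * c) ((b + c) ^+ 2).
  apply: coprimep_irr => // p ip; rewrite irredp_dvdM // => h /(irredpX ip) h'.
  have [pb pc] : p %| b /\ p %| c.
    by case/orP: h => h; split=> //; [rewrite -(dvdp_addr _ h)|rewrite -(dvdp_addl _ h)].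
  by have := coprimep_dvd ip cop pb; rewrite pc.
have ctx : coprimep (t * x * y) (t * x ^+ 2 + y ^+ 2).
  apply: coprimep_irr; first by rewrite mulf_neq0.
  move=> p ip; rewrite irredp_dvdM // => /orP[h|h].
    have py := coprimep_dvd ip cxy h.
    rewrite dvdp_addr; first by move/(irredpX ip); rewrite (negbTE py).
    by rewrite expr2 mulrA dvdp_mulr.
  have px : ~~ (p %| t * x) by apply: coprimep_dvd h => //; rewrite coprimep_sym.
  rewrite dvdp_addl; last by rewrite expr2 dvdp_mulr.
  rewrite expr2 mulrA irredp_dvdM // (negbTE px) /= => h'.
  by move: px; rewrite irredp_dvdM // h' orbT.
have P1 : b * c = t * x ^+ 2 + y ^+ 2.
  apply: (dvdp_eqF k2).
    by rewrite -(Gauss_dvdpr _ cbc) R dvdp_mull.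
  have := ctx; rewrite coprimep_sym => /Gauss_dvdpr <-.
  by rewrite -R dvdp_mull.
have P2 : (t * x) * y = (b + c) ^+ 2.
  by apply: (mulIf bc0); rewrite -R -P1.
have [z [h [z1 h1 zh]]] := coprime_sqr k2 cxy P2.
have [g [xg zg]] := tmul_sqr st z1.
have cb : c = b + t * g * h by apply: (pmove); rewrite addrC -zh zg.
have ch : coprimep (t * x) h.
  by move: cxy; rewrite h1 coprimep_pexpr.
apply: (@quartic_absurd g h b).
- by apply: contraNneq x0 => z0; rewrite xg z0 expr0n mulr0.
- apply: coprimep_dvdr ch; by rewrite xg expr2 dvdp_mull // mulrA dvdp_mull.
- by apply: coprimep_dvdr ch; rewrite dvdp_mulr.
- have : b * c = t * x ^+ 2 + y ^+ 2 by [].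
  by rewrite cb xg h1 => e; transitivity (b * (b + t * g * h)); [ring|rewrite e; ring].
Qed.

End Quartic.

(** * Polynomial steps of the descent for (A/l)^2 (+) A/(l+1) *)

Section PolyDescent.
Variable k : finFieldType.
Hypothesis k2 : forall c : k, c != 0 -> c = 1.
Variable t : {poly k}.
Hypothesis st : size t = 2%N.
Implicit Types (a b c e g h i j p q r s m n x y : {poly k}).

Let c2 := char2p k2.
Let t0 := size2_neq0 st.
Let it : irreducible_poly t := irredp_size2 st.

Lemma coprimep_t a : ~~ (t %| a) -> coprimep t a.
Proof. by move=> ta; rewrite irreducible_poly_coprime. Qed.

Lemma dvdp_t a : a %| t -> a = 1 \/ a = t.
Proof.
move=> at_; have [ta|ta] := boolP (t %| a); first by right; apply: (dvdp_eqF k2).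
left; apply: (dvdp_eqF k2); last exact: dvd1p.
rewrite -(@Gauss_dvdpr _ _ t) ?mulr1 //.
by rewrite coprimep_sym; exact: coprimep_t.
Qed.

Lemma dvdp_t2 a : a %| t ^+ 2 -> [\/ a = 1, a = t | a = t ^+ 2].
Proof.
have [/dvdpP[b ->]|ta] := boolP (t %| a).
  rewrite expr2 dvdp_mul2r // => /dvdp_t [->|->]; first by constructor 2; rewrite mul1r.
  by constructor 3.
move=> h; have /dvdp_t [->|e] : a %| t.
- rewrite -(@Gauss_dvdpr _ _ t) -?expr2 //.
  by rewrite coprimep_sym; exact: coprimep_t.
- by constructor 1.
- by move: ta; rewrite e dvdpp.
Qed.

Lemma size_t1 : size (t + 1) = 2%N.
Proof. by rewrite size_polyDl // st size_poly1. Qed.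

Lemma irredp_eq p q : irreducible_poly p -> irreducible_poly q -> p %| q -> p = q.
Proof.
move=> ip iq pq; apply: (eqp_eqF k2); apply: iq.2 => //.
by have := ip.1; case: (size p) => [|[]].
Qed.

Lemma coprimep_sqrM x y : y != 0 -> coprimep x y -> coprimep (y ^+ 2) (x * (x + y)).
Proof.
move=> y0 xy; apply: coprimep_irr; first by rewrite expf_neq0.
move=> p ip /(irredpX ip) py.
have px : ~~ (p %| x) by apply: coprimep_dvd py => //; rewrite coprimep_sym.
by rewrite irredp_dvdM // (dvdp_addl _ py) orbb (negbTE px).
Qed.

(** With t + 1 prime to a, the product a b is prime to N, so y^2 = d a b with d dividing t^2. For d
    = 1 and d = t^2 the product a b is a square; d = t would make t divide both a and b. *)
Lemma E2_poly a b x y : a != 0 -> b != 0 -> y != 0 -> coprimep a b -> coprimep x y ->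
  ~~ ((t + 1) %| a) ->
  t ^+ 2 * (x * (x + y)) * (a * b) = y ^+ 2 * (a ^+ 2 + t * a * b + (t + 1) * b ^+ 2) ->
  exists a1 b1, a = a1 ^+ 2 /\ b = b1 ^+ 2.
Proof.
move=> a0 b0 y0 ab xy ta E; set N := a ^+ 2 + _ + _ in E.
have ab0 : a * b != 0 by rewrite mulf_neq0.
have cN : coprimep (a * b) N.
  apply: coprimep_irr => // p ip; rewrite irredp_dvdM // => /orP[h|h].
    have pb := coprimep_dvd ip ab h.
    rewrite dvdp_addr; last by rewrite dvdp_add // ?expr2 ?(dvdp_mulr _ h) // -mulrA mulrC -mulrA dvdp_mulr.
    rewrite irredp_dvdM // => /orP[/(irredp_eq ip (irredp_size2 size_t1)) e|/(irredpX ip)].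
      by move: ta; rewrite -e h.
    by rewrite (negbTE pb).
  have pa : ~~ (p %| a) by apply: coprimep_dvd h => //; rewrite coprimep_sym.
  rewrite /N -addrA dvdp_addl; first by move/(irredpX ip); rewrite (negbTE pa).
  by rewrite dvdp_add ?(dvdp_mull _ h) // expr2 mulrA dvdp_mull.
have /dvdpP [d yd] : a * b %| y ^+ 2.
  by rewrite -(Gauss_dvdpl _ cN) -E dvdp_mull.
have cy := coprimep_sqrM y0 xy.
have dt : d %| t ^+ 2.
  have : y ^+ 2 %| t ^+ 2 * (a * b) by rewrite -(Gauss_dvdpl _ cy) mulrAC E dvdp_mulr.
  by rewrite yd dvdp_mul2r.
have fin z : a * b = z ^+ 2 -> exists a1 b1, a = a1 ^+ 2 /\ b = b1 ^+ 2.
  by move=> e; have [a1 [b1 [h1 h2 _]]] := coprime_sqr k2 ab e; exists a1, b1.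
case: (dvdp_t2 dt) => ed.
- by apply: (fin y); rewrite yd ed mul1r.
- have [z [abz yz]] := tmul_sqr st (esym (etrans yd (congr1 (fun z => z * _) ed))).
  have tab : t %| a * b by rewrite abz dvdp_mulr.
  have tN : t %| N.
    have -> : N = t * (x * (x + y)); last by rewrite dvdp_mulr.
    have ty : t * (a * b) != 0 by rewrite mulf_neq0.
    by apply: (mulfI ty); rewrite -[t in LHS]ed -yd -E; ring.
  have tab' : t %| a + b.
    apply: (@irredpX _ _ _ 2) => //.
    have -> : (a + b) ^+ 2 = N + t * (a * b + b ^+ 2) by rewrite /N; ring: c2.
    by rewrite dvdp_add // dvdp_mulr.
  have [ta' tb] : t %| a /\ t %| b.
    move: tab; rewrite irredp_dvdM // => /orP[h|h]; split=> //.
      by rewrite -(dvdp_addr _ h).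
    by rewrite -(dvdp_addl _ h).
  by have := coprimep_dvd it ab ta'; rewrite tb.
- have /dvdpP [z yz] : t %| y.
    by apply: (@irredpX _ _ _ 2) => //; rewrite yd ed expr2 -!mulrA dvdp_mulr.
  apply: (fin z); have tt0 : t ^+ 2 != 0 by rewrite expf_neq0.
  by apply: (mulfI tt0); rewrite -ed -yd yz ed; ring.
Qed.

(** The case of denominator b = t e^2 in [wp_cube]. An expression of degree below 2 deg a turns out
    divisible by a^2. *)
Lemma even_case a e x : a != 0 -> e != 0 -> coprimep a (t * e) ->
  x ^+ 2 + t * e * a * x = (a + t * e ^+ 2) ^+ 3 ->
  (0 < dg a)%N /\ exists r, r ^+ 2 + t * e * r = a + t * e ^+ 2.
Proof.
move=> a0 e0 ca E.
have da : (2 * dg e < dg a)%N.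
  rewrite ltnNge; apply/negP => lt.
  have d1 : dg (t * e ^+ 2) = (1 + 2 * dg e)%N by rewrite dgM ?expf_neq0 // !dgX dgt.
  have d2 : dg ((a + t * e ^+ 2) ^+ 3) = (3 + 6 * dg e)%N.
    by rewrite dgX addrC dgD_gt d1; lia.
  have d3 : (dg (t * e * a * x) <= 1 + dg e + dg a + dg x)%N.
    have := dgM_le (t * e * a) x; have := dgM_le (t * e) a; have := dgM_le t e.
    rewrite (dgt st); lia.
  have [dx|dx] := ltnP (1 + dg e + dg a) (dg x).
    have := d2; rewrite -E dgD_gt dgX; lia.
  have : (dg (x ^+ 2 + t * e * a * x) <= 2 + 6 * dg e)%N.
    by apply: dgD_le; rewrite ?dgX; lia.
  by rewrite E d2; lia.
split; first by lia.
have te0 : t * e != 0 by rewrite mulf_neq0.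
have ca' : coprimep (t * e) a by rewrite coprimep_sym.
have [y [r [ex sy]]] := bezout_split x a0 ca'.
exists r.
have H : (t * e) ^+ 2 * (y ^+ 2 + a * y + (a * e ^+ 2 + t * e ^+ 4))
   = a ^+ 2 * ((r ^+ 2 + t * e * r) + (a + t * e ^+ 2)).
  apply/eqP; rewrite -(padd_eq0 k2); apply/eqP.
  transitivity (x ^+ 2 + t * e * a * x + (a + t * e ^+ 2) ^+ 3); last by rewrite E (paddKK k2).
  have -> : (a + t * e ^+ 2) ^+ 3 = a ^+ 3 + a ^+ 2 * (t * e ^+ 2) + a * (t * e ^+ 2) ^+ 2 + (t * e ^+ 2) ^+ 3.
    by rewrite exprS (psqrD k2); ring.
  by rewrite ex; ring: c2.
have Z : y ^+ 2 + a * y + (a * e ^+ 2 + t * e ^+ 4) = 0.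
  apply: (@dvdp_eq0 _ (a ^+ 2)).
    rewrite -(@Gauss_dvdpr _ _ ((t * e) ^+ 2)); last by rewrite coprimep_expl ?coprimep_expr.
    by rewrite H dvdp_mulr.
  have d1 : dg (t * e ^+ 4) = (1 + 4 * dg e)%N by rewrite dgM ?expf_neq0 // !dgX dgt.
  have d2 : dg (a * e ^+ 2) = (dg a + 2 * dg e)%N by rewrite dgM ?expf_neq0 // !dgX.
  rewrite dgX; apply: leq_ltn_trans (_ : 2 * dg a - 1 < _)%N; last by lia.
  apply: dgD_le; last by apply: dgD_le; lia.
  have [->|y0] := eqVneq y 0; first by rewrite expr0n mulr0 addr0 dg0.
  have dy := dg_size_lt sy y0.
  by apply: dgD_le; rewrite ?dgX ?dgM //; lia.
move/eqP: H; rewrite Z mulr0 eq_sym mulf_eq0 expf_eq0 /= (negbTE a0) (padd_eq0 k2).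
by move/eqP.
Qed.

(** The case of denominator b = e^2. The degree bound is now only 2 deg a, so the expression
    divisible by a^2 may also be a^2 itself; this would make t divide both a and e. *)
Lemma odd_case a e x : a != 0 -> e != 0 -> coprimep a e ->
  t * x ^+ 2 + t * e * a * x = (a + e ^+ 2) ^+ 3 ->
  a = e ^+ 2 \/ (0 < dg a)%N /\ exists r, t * (r ^+ 2 + e * r) = a + e ^+ 2.
Proof.
move=> a0 e0 ca E.
have da : (2 * dg e <= dg a)%N.
  rewrite leqNgt; apply/negP => lt.
  have d2 : dg ((a + e ^+ 2) ^+ 3) = (6 * dg e)%N.
    by rewrite dgX addrC dgD_gt dgX; lia.
  have d3 : (dg (t * e * a * x) <= 1 + dg e + dg a + dg x)%N.
    have := dgM_le (t * e * a) x; have := dgM_le (t * e) a; have := dgM_le t e.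
    rewrite (dgt st); lia.
  have [x0|x0] := eqVneq x 0.
    by move: d2; rewrite -E x0 expr0n !mulr0 addr0 dg0; lia.
  have d4 : dg (t * x ^+ 2) = (1 + 2 * dg x)%N by rewrite dgM ?expf_neq0 // dgX dgt.
  have [dx|dx] := ltnP (dg e + dg a) (dg x).
    have := d2; rewrite -E dgD_gt d4; lia.
  have : (dg (t * x ^+ 2 + t * e * a * x) <= 6 * dg e - 1)%N.
    by apply: dgD_le; lia.
  by rewrite E d2; lia.
have [da0|da0] := posnP (dg a).
  left; have -> : a = 1 by apply: (unit_eq1 k2); rewrite sizeE // da0.
  have -> : e = 1; last by rewrite expr1n.
  apply: (unit_eq1 k2); rewrite sizeE //; lia.
right; split=> //.
have ca' : coprimep e a by rewrite coprimep_sym.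
have [y [r [ex sy]]] := bezout_split x a0 ca'.
exists r.
have H : e ^+ 2 * (t * y ^+ 2 + t * (a * y) + (a * e ^+ 2 + e ^+ 4))
   = a ^+ 2 * (t * (r ^+ 2 + e * r) + (a + e ^+ 2)).
  apply/eqP; rewrite -(padd_eq0 k2); apply/eqP.
  transitivity (t * x ^+ 2 + t * e * a * x + (a + e ^+ 2) ^+ 3); last by rewrite E (paddKK k2).
  have -> : (a + e ^+ 2) ^+ 3 = a ^+ 3 + a ^+ 2 * (e ^+ 2) + a * (e ^+ 2) ^+ 2 + (e ^+ 2) ^+ 3.
    by rewrite exprS (psqrD k2); ring.
  by rewrite ex; ring: c2.
set Y := t * y ^+ 2 + _ + _ in H.
have /dvdpP [c cY] : a ^+ 2 %| Y.
  rewrite -(@Gauss_dvdpr _ _ (e ^+ 2)); last by rewrite coprimep_expl ?coprimep_expr.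
  by rewrite H dvdp_mulr.
have dY : (dg Y <= 2 * dg a)%N.
  have d1 : dg (e ^+ 4) = (4 * dg e)%N by rewrite dgX.
  have d2 : dg (a * e ^+ 2) = (dg a + 2 * dg e)%N by rewrite dgM ?expf_neq0 // dgX.
  apply: dgD_le; last by apply: dgD_le; lia.
  have [->|y0] := eqVneq y 0; first by rewrite expr0n !mulr0 addr0 dg0.
  have dy := dg_size_lt sy y0.
  have d3 : dg (t * y ^+ 2) = (1 + 2 * dg y)%N by rewrite dgM ?expf_neq0 // dgX dgt.
  have d4 : dg (t * (a * y)) = (1 + (dg a + dg y))%N by rewrite !dgM ?mulf_neq0 // dgt.
  by apply: dgD_le; lia.
have a20 : a ^+ 2 != 0 by rewrite expf_neq0.
have G : t * (r ^+ 2 + e * r) + (a + e ^+ 2) = c * e ^+ 2.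
  by apply: (mulfI a20); rewrite -H cY; ring.
have [cz|cz] := eqVneq c 0.
  by apply/eqP; rewrite -(padd_eq0 k2) G cz mul0r.
have c1 : c = 1.
  apply: (unit_eq1 k2); rewrite sizeE //; move: dY; rewrite cY dgM // dgX; lia.
have ta : t %| a.
  have -> : a = t * (r ^+ 2 + e * r); last by rewrite dvdp_mulr.
  apply/esym/eqP; rewrite -(padd_eq0 k2); apply/eqP/(addIr (e ^+ 2)).
  by rewrite -addrA G c1 mul1r add0r.
have te := coprimep_dvd it ca ta.
have : t %| e ^+ 4.
  have -> : e ^+ 4 = a * (a + t * y + e ^+ 2) + t * y ^+ 2.
    apply/eqP; rewrite -(padd_eq0 k2); apply/eqP.
    transitivity (Y + c * a ^+ 2); last by rewrite cY (paddKK k2).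
    by rewrite c1 /Y; ring.
  by rewrite dvdp_add ?(dvdp_mulr _ ta) // dvdp_mulr.
by move/(irredpX it); rewrite (negbTE te).
Qed.

End PolyDescent.

(** * Torsion at l and l + 1 over the function field *)

Section LinearTorsion.
Variables (k : finFieldType) (K : fieldType) (io : {rmorphism {poly k} -> K}).
Variables (nm dn : K -> {poly k}).
Hypothesis io_inj : injective io.
Hypothesis dn_neq0 : forall x, dn x != 0.
Hypothesis fracE : forall x, x = io (nm x) / io (dn x).
Hypothesis k2 : forall c : k, c != 0 -> c = 1.
Variable tp : {poly k}.
Hypothesis stp : size tp = 2%N.
Hypothesis dtp : tp^`() = 1.
Notation t := (io tp).
Implicit Types (x y z u w m n : K) (a b : {poly k}).

Let c2 := char2 io k2.
Let ioE := io_eq0 io_inj.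
Let tp0 := size2_neq0 stp.
Let t0 : t != 0. Proof. by rewrite ioE. Qed.
Let t10 : t + 1 != 0.
Proof. by rewrite -(rmorph1 io) -rmorphD ioE -size_poly_gt0 size_t1. Qed.

Lemma reduced_frac x : exists a b, [/\ b != 0, coprimep a b & x = io a / io b].
Proof.
have [a [b [b0 ex e]]] := fracP io_inj dn_neq0 fracE x.
set g := gcdp a b.
have g0 : g != 0 by rewrite gcdp_eq0 negb_and b0 orbT.
have ea : a = a %/ g * g by rewrite divpK ?dvdp_gcdl.
have eb : b = b %/ g * g by rewrite divpK ?dvdp_gcdr.
exists (a %/ g), (b %/ g); split.
- by apply: contra b0 => /eqP z; rewrite eb z mul0r.
- by apply: coprimep_div_gcd; rewrite b0 orbT.
- by rewrite ex {1}ea {1}eb !rmorphM -mulf_div divff ?mulr1 // ioE.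
Qed.

Lemma der_eq0 x : der io nm dn x = 0 -> exists y, x = y ^+ 2.
Proof.
have [a [b [b0 _ ->]]] := reduced_frac x.
have B : io b != 0 by rewrite ioE.
rewrite (der_frac io_inj dn_neq0 fracE k2) // => /eqP.
rewrite mulf_eq0 invr_eq0 expf_eq0 /= (negbTE B) orbF ioE -derivM => /eqP /(deriv_eq0 k2) [c ec].
exists (io c / io b); rewrite exprMn -rmorphXn -ec rmorphM; by field.
Qed.

(** In lowest terms u^2 + u and w^2 + w have square denominators b^2, d^2 and numerators N1, N2 that
    must divide each other. Then t N1 = (b + d)^2, so N1 = a (a + b) = c (c + d) is t times a square
    in two coprime factorisations. *)
Lemma wp_absurd u w : u ^+ 2 + u != 0 ->
  t * (u ^+ 2 + u) * (w ^+ 2 + w) = (u ^+ 2 + u) + (w ^+ 2 + w) -> False.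
Proof.
have [a [b [b0 ab ->]]] := reduced_frac u.
have [c [d [d0 cd ->]]] := reduced_frac w.
have B : io b != 0 by rewrite ioE.
have D : io d != 0 by rewrite ioE.
have e1 : (io a / io b) ^+ 2 + io a / io b = io (a * (a + b)) / io b ^+ 2.
  by rewrite rmorphM rmorphD; field.
have e2 : (io c / io d) ^+ 2 + io c / io d = io (c * (c + d)) / io d ^+ 2.
  by rewrite rmorphM rmorphD; field.
rewrite e1 e2; set N1 := a * (a + b); set N2 := c * (c + d).
have B2 : io b ^+ 2 != 0 by rewrite expf_neq0.
have D2 : io d ^+ 2 != 0 by rewrite expf_neq0.
move=> nz E; have N10 : N1 != 0.
  by apply: contraNneq nz => ->; rewrite rmorph0 mul0r.
have EP : tp * N1 * N2 = N1 * d ^+ 2 + N2 * b ^+ 2.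
  apply: io_inj; rewrite rmorphD (rmorphM io (tp * N1)) (rmorphM io tp) (rmorphM io N1) (rmorphM io N2) !rmorphXn.
  transitivity (t * (io N1 / io b ^+ 2) * (io N2 / io d ^+ 2) * (io b ^+ 2 * io d ^+ 2)).
    by field; rewrite B D.
  by rewrite E; field; rewrite B D.
have cb := coprimep_sqrM b0 ab; have cd' := coprimep_sqrM d0 cd.
have N12 : N1 = N2.
  apply: (dvdp_eqF k2).
    have : N1 %| N2 * b ^+ 2.
      have : N1 %| N1 * d ^+ 2 + N2 * b ^+ 2 by rewrite -EP mulrAC dvdp_mull.
      by rewrite dvdp_addr // dvdp_mulr.
    by rewrite Gauss_dvdpl // coprimep_sym.
  have : N2 %| N1 * d ^+ 2.
    have : N2 %| N1 * d ^+ 2 + N2 * b ^+ 2 by rewrite -EP dvdp_mull.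
    by rewrite dvdp_addl // dvdp_mulr.
  by rewrite Gauss_dvdpl // coprimep_sym.
have S : tp * N1 = (b + d) ^+ 2.
  rewrite -N12 in EP; apply: (mulIf N10); rewrite EP (psqrD k2); ring.
have [s [Ns bd]] := tmul_sqr stp S.
have cop (x y : {poly k}) : coprimep x y -> coprimep x (x + y).
  by rewrite -{3}(mul1r x) coprimep_addl_mul.
have caa := cop _ _ ab.
have [m [n [mn cmn s1 _]]] := coprime_tsqr k2 stp caa Ns.
have [m1 [n1 [mn1 cmn1 s2 _]]] : exists m n : {poly k}, [/\ m * n = s, coprimep (tp * m) n,
   c + (c + d) = tp * m ^+ 2 + n ^+ 2 & (c = tp * m ^+ 2 /\ c + d = n ^+ 2) \/ (c + d = tp * m ^+ 2 /\ c = n ^+ 2)].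
  by apply: (coprime_tsqr k2 stp) => //; rewrite -?Ns ?N12 //; exact: cop.
have s0 : s != 0 by apply: contraNneq N10 => z; rewrite Ns z expr0n mulr0.
have m0 : m != 0 by apply: contraNneq s0 => z; rewrite -mn z mul0r.
have n0 : n != 0 by apply: contraNneq s0 => z; rewrite -mn z mulr0.
apply: (two_factorisations_absurd k2 stp m0 n0 cmn cmn1); first by rewrite mn mn1.
move: bd; rewrite -mulrA mn => <-; move: s1 s2; rewrite !addrA !(paddKK k2) !add0r => -> ->.
rewrite !(psqrD k2); ring.
Qed.

(* With u0 a normalised second t-torsion point and n = t (u + 1) + 1 for a normalised
   (t + 1)-torsion point u, the torsion equations become [E2 n (u0 + (n + 1) / t)]. *)
Definition E2 n u := n != 0 /\ t ^+ 2 * (u ^+ 2 + u) = n + t + (t + 1) / n.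

Lemma E2_sym n u : E2 n u -> E2 ((t + 1) / n) u.
Proof.
case=> n0 e; split; first by rewrite mulf_neq0 ?invr_eq0.
by rewrite e; field; rewrite ?t10 ?n0.
Qed.

Lemma E2_frac a b u : b != 0 -> coprimep a b -> ~~ ((tp + 1) %| a) ->
  E2 (io a / io b) u -> exists m, io a / io b = m ^+ 2.
Proof.
move=> b0 ab ta [n0]; have a0 : a != 0 by apply: contraNneq n0 => ->; rewrite rmorph0 mul0r.
have [x [y [y0 xy ->]]] := reduced_frac u.
have A : io a != 0 by rewrite ioE.
have B : io b != 0 by rewrite ioE.
have Y : io y != 0 by rewrite ioE.
move=> E; have [|a1 [b1 [-> ->]]] := E2_poly k2 stp a0 b0 y0 ab xy ta.
  apply: io_inj; rewrite !(rmorphM, rmorphD, rmorphXn, rmorph1).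
  transitivity (t ^+ 2 * ((io x / io y) ^+ 2 + io x / io y) * (io a * io b * io y ^+ 2)).
    by field.
  by rewrite E; field; rewrite A B.
by exists (io a1 / io b1); rewrite !rmorphXn exprMn exprVn.
Qed.

(** The involution n -> (t + 1) / n of the curve removes a factor t + 1 from the numerator, after
    which [E2_frac] applies. *)
Lemma E2_sqr n u : E2 n u ->
  exists m, E2 (m ^+ 2) u /\ (n = m ^+ 2 \/ n = (t + 1) / m ^+ 2).
Proof.
move=> h; have [a [b [b0 ab e]]] := reduced_frac n.
have n0 := h.1; have a0 : a != 0 by apply: contraNneq n0 => z; rewrite e z rmorph0 mul0r.
have [/dvdpP[a1 ea]|ta] := boolP ((tp + 1) %| a); last first.
  by rewrite e in h; have [m em] := E2_frac b0 ab ta h; exists m; rewrite -em; split=> //; left.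
have a10 : a1 != 0 by apply: contraNneq a0 => z; rewrite ea z mul0r.
have A : io a1 != 0 by rewrite ioE.
have B : io b != 0 by rewrite ioE.
have e' : (t + 1) / n = io b / io a1.
  by rewrite e ea rmorphM rmorphD rmorph1; field; rewrite A B t10.
have ba : coprimep b a1.
  by move: ab; rewrite ea coprimepMl coprimep_sym => /andP[].
have tb : ~~ ((tp + 1) %| b).
  by apply: (coprimep_dvd (irredp_size2 (size_t1 stp)) ab); rewrite ea dvdp_mull.
have h' := E2_sym h; rewrite e' in h'.
have [m em] := E2_frac a10 ba tb h'; exists m; rewrite -em; split=> //; right.
by rewrite -e'; field; rewrite ?t10 ?n0.
Qed.

(** Differentiating the equation with n = m^2 gives t^2 u' = 1 + 1/m^2, so u + t ((m + 1) / (t m))^2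
    has derivative 0 and is a square z^2. In terms of z the whole equation is a square, and its root
    is the claim. *)
Lemma E2_der m u : E2 (m ^+ 2) u -> exists z, t * (z ^+ 2 + z) = (m + 1) ^+ 3 / m ^+ 2.
Proof.
set d := der io nm dn; case=> m20 E.
have m0 : m != 0 by move: m20; rewrite expf_eq0.
have dD x y : d (x + y) = d x + d y := derD io_inj dn_neq0 fracE k2 x y.
have dM x y : d (x * y) = d x * y + x * d y := derM io_inj dn_neq0 fracE k2 x y.
have dS x : d (x ^+ 2) = 0 := der_sqr io_inj dn_neq0 fracE k2 x.
have dt : d t = 1 by rewrite /d (der_io io_inj dn_neq0 fracE k2) dtp rmorph1.
have d1 : d 1 = 0 by rewrite -(expr1n _ 2) dS.
have du : t ^+ 2 * d u = 1 + m^-1 ^+ 2.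
  have := congr1 d E.
  by rewrite dM !dD dM !dD -exprVn !dS dt d1 !mul0r !add0r !addr0 mulr0 addr0 mul1r.
have [z ez] : exists z, u + t * ((m + 1) / (t * m)) ^+ 2 = z ^+ 2.
  apply: der_eq0; rewrite -/d dD dM dS dt mulr0 addr0 mul1r.
  apply: (mulfI (expf_neq0 2 t0)); rewrite mulrDr du mulr0; field: c2; exact/andP.
have uE : u = z ^+ 2 + t * ((m + 1) / (t * m)) ^+ 2.
  by rewrite -ez -addrA (addKK c2) addr0.
exists z; apply/eqP; rewrite -(add_eq0 c2).
set Z := _ + _; suff : Z ^+ 2 == 0 by rewrite expf_eq0.
rewrite /Z (sqrK2D c2 (t * (z ^+ 2 + z))); apply/eqP.
have S3 : (m + 1) ^+ 3 = m ^+ 3 + m ^+ 2 + m + 1 by rewrite exprS (sqrK2D c2) expr1n; ring.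
have -> : ((m + 1) ^+ 3 / m ^+ 2) ^+ 2 = (m ^+ 6 + m ^+ 4 + m ^+ 2 + 1) / m ^+ 4.
  by rewrite S3 exprMn !(sqrK2D c2) -!exprM expr1n exprVn -exprM.
have : t ^+ 2 * (u ^+ 2 + u) + (m ^+ 2 + t + (t + 1) / m ^+ 2) = 0 by rewrite E (addKK c2).
rewrite uE (sqrK2D c2) => <-.
have M2 : (m + 1) ^+ 2 = m ^+ 2 + 1 by rewrite (sqrK2D c2) expr1n.
have M4 : (m + 1) ^+ 4 = m ^+ 4 + 1 by rewrite (exprM _ 2 2) M2 (sqrK2D c2) expr1n -exprM.
have -> : (t * ((m + 1) / (t * m)) ^+ 2) ^+ 2 = (m ^+ 4 + 1) / (t ^+ 2 * m ^+ 4).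
  rewrite -M4; field; exact/andP.
have -> : t * ((m + 1) / (t * m)) ^+ 2 = (m ^+ 2 + 1) / (t * m ^+ 2).
  rewrite -M2; field; exact/andP.
by rewrite exprMn (sqrK2D c2); field: c2; exact/andP.
Qed.

(** The denominator y of z satisfies y^2 = d a^2 b with d dividing t, so b is a square or t times a
    square: [odd_case] and [even_case]. *)
Lemma wp_cube a b z : a != 0 -> b != 0 -> coprimep a b ->
  t * (z ^+ 2 + z) = (io a / io b + 1) ^+ 3 / (io a / io b) ^+ 2 ->
  a = b \/ (0 < dg a)%N /\ exists y, t * (y ^+ 2 + y) = io a / io b + 1.
Proof.
move=> a0 b0 ab; have [x [y [y0 xy ->]]] := reduced_frac z.
have A : io a != 0 by rewrite ioE.
have B : io b != 0 by rewrite ioE.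
have Y : io y != 0 by rewrite ioE.
move=> E.
have EP : tp * (x * (x + y)) * (a ^+ 2 * b) = y ^+ 2 * (a + b) ^+ 3.
  apply: io_inj; rewrite !(rmorphM, rmorphD, rmorphXn).
  transitivity (t * ((io x / io y) ^+ 2 + io x / io y) * (io a ^+ 2 * io b * io y ^+ 2)).
    by field.
  by rewrite E; field; rewrite A B.
have ab20 : a ^+ 2 * b != 0 by rewrite mulf_neq0 ?expf_neq0.
have c1 : coprimep (a ^+ 2 * b) ((a + b) ^+ 3).
  apply: coprimep_irr => // p ip; rewrite irredp_dvdM // => /orP[/(irredpX ip) h|h] /(irredpX ip) h'.
    by have := coprimep_dvd ip ab h; rewrite -(dvdp_addr _ h) h'.
  by have := coprimep_dvd ip ab; rewrite -(dvdp_addl _ h) h' h => /(_ isT).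
have /dvdpP [d yd] : a ^+ 2 * b %| y ^+ 2.
  by rewrite -(Gauss_dvdpl _ c1) -EP dvdp_mull.
have cy := coprimep_sqrM y0 xy.
have dt : d %| tp.
  have : y ^+ 2 %| tp * (a ^+ 2 * b) by rewrite -(Gauss_dvdpl _ cy) mulrAC EP dvdp_mulr.
  by rewrite yd dvdp_mul2r.
have /dvdpP [y1 ey] : a %| y.
  by rewrite -(@dvdp_pexp2r _ _ _ 2) // yd mulrCA dvdp_mulr.
have a20 : a ^+ 2 != 0 by rewrite expf_neq0.
have y1d : d * b = y1 ^+ 2.
  by apply: (mulfI a20); rewrite mulrCA -yd ey; ring.
have EP2 : tp * (x * (x + y)) = d * (a + b) ^+ 3.
  by apply: (mulIf ab20); rewrite EP yd; ring.
case: (dvdp_t k2 stp dt) => ed; rewrite ed ?mul1r in y1d EP2.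
  have e0 : y1 != 0 by apply: contraNneq b0 => e0; rewrite y1d e0 expr0n.
  have cae : coprimep a y1 by move: ab; rewrite y1d coprimep_pexpr.
  have [|e|[da [r er]]] := @odd_case _ k2 _ stp a y1 x a0 e0 cae.
  - by rewrite -y1d -EP2 ey; ring.
  - by left; rewrite e y1d.
  right; split=> //; exists (io r / io y1).
  have e1 : io y1 != 0 by rewrite ioE.
  have -> : t * ((io r / io y1) ^+ 2 + io r / io y1) = io (tp * (r ^+ 2 + y1 * r)) / io y1 ^+ 2.
    by rewrite !(rmorphM, rmorphD, rmorphXn); field.
  by rewrite er y1d !(rmorphD, rmorphXn); field.
have [e [be ye]] := tmul_sqr stp y1d.
have e0 : e != 0 by apply: contraNneq b0 => e0; rewrite be e0 expr0n mulr0.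
have cae : coprimep a (tp * e).
  by apply: coprimep_dvdl ab; rewrite be expr2 mulrA dvdp_mulr.
have [|da [r er]] := @even_case _ k2 _ stp a e x a0 e0 cae.
  by apply: (mulfI tp0); rewrite -be -EP2 ey ye; ring.
right; split=> //; exists (io r / (t * io e)).
have e1 : io e != 0 by rewrite ioE.
have -> : t * ((io r / (t * io e)) ^+ 2 + io r / (t * io e)) = io (r ^+ 2 + tp * e * r) / (t * io e ^+ 2).
  by rewrite !(rmorphM, rmorphD, rmorphXn); field; rewrite t0 e1.
by rewrite er be !(rmorphM, rmorphD, rmorphXn); field; rewrite t0 e1.
Qed.

Lemma E2_descent m z y : m != 0 ->
  t * (z ^+ 2 + z) = (m + 1) ^+ 3 / m ^+ 2 -> t * (y ^+ 2 + y) = m + 1 ->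
  exists m', E2 (m' ^+ 2) y /\ t * m = m' ^+ 2 + (t + 1) / m' ^+ 2.
Proof.
move=> m0 Ez Ey; set n := t * m * (z + y + (t * m)^-1).
have S3 : (m + 1) ^+ 3 = m ^+ 3 + m ^+ 2 + m + 1 by rewrite exprS (sqrK2D c2) expr1n; ring.
have tm : t * m != 0 by rewrite mulf_neq0.
(* Equivalently n + (t + 1) / n = t m, and t^2 (y^2 + y) = t (m + 1) becomes a new instance of
   [E2]. *)
have N : n ^+ 2 + t * m * n = t + 1.
  have -> : n ^+ 2 + t * m * n = t * m ^+ 2 * (t * (z ^+ 2 + z) + t * (y ^+ 2 + y)) + 1 + t * m.
    by rewrite /n exprMn !(sqrK2D c2); field; rewrite t0 m0.
  by rewrite Ez Ey S3; field: c2.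
have n0 : n != 0.
  by apply: contraNneq t10 => e; rewrite -N e expr0n mulr0 addr0.
have N' : t * m = n + (t + 1) / n.
  rewrite -N; field: c2; exact: n0.
have h : E2 n y.
  split=> //; rewrite addrAC -N'; rewrite expr2 -mulrA Ey; ring.
have [m' [h1 h2]] := E2_sqr h; exists m'; split=> //; rewrite N'.
have m20 := h1.1; have m'0 : m' != 0 by move: m20; rewrite expf_eq0.
by case: h2 => ->; rewrite // addrC; congr (_ + _); field; rewrite ?t10 ?m'0.
Qed.

(** Descent on the height deg a + deg b of m = a / b. From t m = m'^2 + (t + 1) / m'^2 the square of
    a' b' divides b (t + 1), which roughly halves the height; and m' = 1 gives back m = 1. *)
Lemma E2_eq1 m u : E2 (m ^+ 2) u -> m = 1.
Proof.
have [a [b [b0 ab ->]]] := reduced_frac m.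
suff H N a' b' w : (dg a' + dg b' < N)%N -> b' != 0 -> coprimep a' b' ->
    E2 ((io a' / io b') ^+ 2) w -> io a' / io b' = 1 by exact: (H _ a b u (ltnSn _)).
elim: N a' b' w {a b b0 ab m u} => // N IH a b u dN b0 ab h.
have B : io b != 0 by rewrite ioE.
have m20 := h.1; have m0 : io a / io b != 0 by move: m20; rewrite expf_eq0.
have a0 : a != 0 by apply: contraNneq m0 => ->; rewrite rmorph0 mul0r.
have [z Ez] := E2_der h.
have [->|[da [y Ey]]] := wp_cube a0 b0 ab Ez; first by rewrite divff.
have [m' [h1 h2]] := E2_descent m0 Ez Ey.
have [a' [b' [b'0 ab' em]]] := reduced_frac m'.
have m'20 := h1.1; have m'0 : m' != 0 by move: m'20; rewrite expf_eq0.
have a'0 : a' != 0 by apply: contraNneq m'0 => z0; rewrite em z0 rmorph0 mul0r.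
have A' : io a' != 0 by rewrite ioE.
have B' : io b' != 0 by rewrite ioE.
have m'1 : m' = 1.
  rewrite em; apply: (IH a' b' y); rewrite -?em //.
  have EP : tp * a * (a' * b') ^+ 2 = b * (a' ^+ 4 + (tp + 1) * b' ^+ 4).
    apply: io_inj; rewrite !(rmorphM, rmorphD, rmorphXn, rmorph1).
    transitivity (t * (io a / io b) * (io b * (io a' * io b') ^+ 2)); first by field.
    by rewrite h2 em; field; rewrite A' B'.
  have d1 : a' ^+ 2 %| b * (tp + 1).
    have : a' ^+ 2 %| b * (tp + 1) * b' ^+ 4.
      rewrite -(@dvdp_addr _ (b * a' ^+ 4)); last by rewrite (exprD _ 2 2) mulrA dvdp_mull.
      by rewrite -mulrA -mulrDr -EP exprMn mulrA dvdp_mulr // dvdp_mull.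
    by rewrite Gauss_dvdpl // coprimep_expl ?coprimep_expr.
  have d2 : b' ^+ 2 %| b * (tp + 1).
    apply: dvdp_mulr; have : b' ^+ 2 %| b * a' ^+ 4.
      rewrite -(@dvdp_addl _ (b * ((tp + 1) * b' ^+ 4))); last by rewrite (exprD _ 2 2); do 3!apply: dvdp_mull.
      by rewrite -mulrDr -EP exprMn mulrA dvdp_mull.
    by rewrite Gauss_dvdpl // coprimep_expl ?coprimep_expr // coprimep_sym.
  have d3 : a' ^+ 2 * b' ^+ 2 %| b * (tp + 1).
    by rewrite Gauss_dvdp ?d1 // coprimep_expl ?coprimep_expr.
  have t1 : tp + 1 != 0 by rewrite -size_poly_gt0 size_t1.
  have := dvdp_dg d3 (mulf_neq0 b0 t1).
  rewrite dgM ?expf_neq0 // !dgX dgM // [dg (tp + 1)]/dg (size_t1 stp) /=.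
  move: da dN; move: (dg a) (dg b) (dg a') (dg b') => i j i' j'.
  clear; lia.
move: h2; rewrite m'1 expr1n divr1 => e; apply: (mulfI t0); rewrite e; ring: c2.
Qed.

Variables g D : K.
Hypothesis D0 : D != 0.
Notation f := (phi t g D).

Section Scale.
Variable x0 : K.
Hypotheses (x00 : x0 != 0) (fx0 : f x0 = 0).
Notation c := (D * x0 ^+ 3).

Lemma phi_wp y : f y = x0 * (t * ((y / x0) ^+ 2 + y / x0) + c * ((y / x0) ^+ 2 + y / x0) ^+ 2).
Proof.
rewrite -[LHS]addr0 -(mulr0 ((y / x0) ^+ 2)) -fx0 (sqrK2D c2) -exprM.
by rewrite /phi; field: c2.
Qed.

Lemma wp_eq y z : f y = z -> t * ((y / x0) ^+ 2 + y / x0) + c * ((y / x0) ^+ 2 + y / x0) ^+ 2 = z / x0.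
Proof. by rewrite phi_wp => <-; rewrite [RHS]mulrC mulKf. Qed.

Lemma c_neq0 : c != 0. Proof. by rewrite mulf_neq0 ?expf_neq0. Qed.

Lemma wp_root z : z != 0 -> z != x0 -> f z = 0 -> let s := (z / x0) ^+ 2 + z / x0 in
  s != 0 /\ t = c * s.
Proof.
move=> z0 zx fz s.
have s0 : s != 0.
  have -> : s = z / x0 * (z / x0 + 1) by rewrite /s; ring.
  rewrite !mulf_neq0 ?invr_eq0 // (add_eq0 c2).
  by apply: contra zx => /eqP e; rewrite -(divfK x00 z) e mul1r.
split=> //; have := wp_eq fz; rewrite mul0r -/s => e.
apply/eqP; rewrite -(add_eq0 c2); apply/eqP/(mulIf s0).
by rewrite mul0r -e; ring.
Qed.

(** With T = u^2 + u, s = u0^2 + u0 and t = c s, the equation t T + c T^2 = 1 becomes t T (T + s) =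
    T + (T + s), and T + s belongs to u + u0: this is the equation of [wp_absurd]. *)
Lemma torsion_T2_T_absurd x z : f x = x0 -> z != 0 -> z != x0 -> f z = 0 -> False.
Proof.
move=> /wp_eq; rewrite divff // => E z0 zx fz.
have [s0 ts] := wp_root z0 zx fz.
move: E s0 ts; set u := x / x0; set u0 := z / x0 => E s0 ts.
apply: (@wp_absurd u (u + u0)).
  apply: contra_eq_neq E => ->; rewrite expr0n /= !mulr0 addr0 eq_sym; exact: oner_neq0.
rewrite (sqrK2D c2); set T := u ^+ 2 + u in E *.
have -> : u ^+ 2 + u0 ^+ 2 + (u + u0) = T + (u0 ^+ 2 + u0) by rewrite /T; ring.
set s := u0 ^+ 2 + u0 in s0 ts *.
transitivity ((t * T + c * T ^+ 2) * s); last by rewrite E mul1r; ring: c2.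
have -> : c * T ^+ 2 = t / s * T ^+ 2 by rewrite {1}ts; field.
by field.
Qed.

Lemma torsion_T_T_T1_absurd z w : z != 0 -> z != x0 -> f z = 0 -> w != 0 -> f w = w -> False.
Proof.
move=> z0 zx fz w0 /wp_eq.
have [s0 ts] := wp_root z0 zx fz.
move: s0 ts; have u0_ : w / x0 != 0 by rewrite mulf_neq0 ?invr_eq0.
set u := w / x0 in u0_ *; set v := z / x0; set s := v ^+ 2 + v => s0 ts E.
set n := t * (u + 1) + 1.
have N : s * n = t * u * (u + 1) ^+ 2.
  apply: (mulfI u0_); apply/eqP; rewrite -(add_eq0 c2); apply/eqP.
  transitivity ((t * (u ^+ 2 + u) + c * (u ^+ 2 + u) ^+ 2 + u) * s); last by rewrite E (addKK c2) mul0r.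
  have -> : c * (u ^+ 2 + u) ^+ 2 = t / s * (u ^+ 2 + u) ^+ 2 by rewrite {1}ts; field.
  by rewrite /n; field: c2.
have u1 : u + 1 != 0.
  apply: contraNneq s0 => e; have : s * n = 0 by rewrite N e expr0n mulr0.
  by rewrite /n e mulr0 add0r mulr1 => ->.
have n0 : n != 0.
  have := mulf_neq0 (mulf_neq0 t0 u0_) (expf_neq0 2 u1); rewrite -N.
  by apply: contraNneq => ->; rewrite mulr0.
have h : E2 n (v + (n + 1) / t).
  split=> //; rewrite (sqrK2D c2).
  have -> : v ^+ 2 + ((n + 1) / t) ^+ 2 + (v + (n + 1) / t) = s + ((n + 1) / t) ^+ 2 + (n + 1) / t.
    by rewrite /s; ring.
  have -> : s = t * u * (u + 1) ^+ 2 / n by rewrite -N; field.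
  have e1 : t * (u + 1) = n + 1 by rewrite /n; ring: c2.
  have e2 : t * u = n + 1 + t by rewrite /n; ring: c2.
  transitivity (t * u * (t * (u + 1)) ^+ 2 / n + (n + 1) ^+ 2 + t * (n + 1)).
    by field; exact/andP.
  by rewrite e1 e2 (sqrK2D c2) expr1n; field: c2.
(* Only n = 1 and n = t + 1 remain; they mean u = 1 and u = 0, both degenerate. *)
have [m [h1 h2]] := E2_sqr h; have m1 := E2_eq1 h1.
move: h2; rewrite m1 expr1n divr1; case=> e.
  have : t * (u + 1) = 0 by apply: (addIr 1); rewrite add0r.
  by apply/eqP; rewrite mulf_neq0.
have : t * u = 0.
  have -> : t * u = n + (t + 1) by rewrite /n; ring: c2.
  by rewrite e (addKK c2).
by apply/eqP; rewrite mulf_neq0.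
Qed.
End Scale.
End LinearTorsion.

(* Dividing by the t-torsion point x0 gives the 2-isogeny y |-> (y / x0)^2 + y / x0, whose
   target is the module with parameters (c + t^2, c^2), c = D x0^3. *)
Section Isogeny.
Variables (k : finFieldType) (K : fieldType) (io : {rmorphism {poly k} -> K}).
Variables (nm dn : K -> {poly k}).
Hypothesis io_inj : injective io.
Hypothesis dn_neq0 : forall x, dn x != 0.
Hypothesis fracE : forall x, x = io (nm x) / io (dn x).
Hypothesis k2 : forall c : k, c != 0 -> c = 1.
Variable tp : {poly k}.
Hypothesis stp : size tp = 2%N.
Hypothesis dtp : tp^`() = 1.
Notation t := (io tp).
Variables g D : K.
Hypothesis D0 : D != 0.
Notation f := (phi t g D).
Variable x0 : K.
Hypotheses (x00 : x0 != 0) (fx0 : f x0 = 0).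
Notation c := (D * x0 ^+ 3).
Notation f' := (phi t (c + t ^+ 2) (c ^+ 2)).
Notation wp y := ((y / x0) ^+ 2 + y / x0).

Let c2 := char2 io k2.
Let c0 : c != 0 := c_neq0 D0 x00.

Lemma isogeny_phi y : f' (wp y) = wp (f y).
Proof.
rewrite (phi_wp k2 x00 fx0 y) [x0 * _ / x0]mulrC mulKf // (sqrK2D c2 (t * _)).
rewrite /phi; ring.
Qed.

Lemma wp_x0 : wp x0 = 0.
Proof. by rewrite divff // expr1n (addKK c2). Qed.

(** [t / c] spans the kernel of the complementary isogeny s -> x0 (t s + c s^2). So the target
    always has this rational t-torsion point, and a preimage of x0 supplies a second one. *)
Lemma isogeny_root : f' (t / c) = 0 /\ t / c != 0.
Proof.
split; last by rewrite mulf_neq0 ?invr_eq0 ?(io_eq0 io_inj) ?(size2_neq0 stp).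
rewrite /phi; field: c2; rewrite D0 x00 //.
Qed.

Lemma wp_image y : f y = x0 -> wp y != 0 /\ t / c != wp y.
Proof.
move/(wp_eq k2 x00 fx0); rewrite divff // => E; split; apply: contra_eq_neq E.
  move=> ->; by rewrite expr0n /= !mulr0 addr0 eq_sym oner_neq0.
move=> <-; suff -> : t * (t / c) + c * (t / c) ^+ 2 = 0 by rewrite eq_sym oner_neq0.
field: c2; rewrite D0 x00 //.
Qed.

Lemma torsion_T3_absurd x y : f x = y -> f y = x0 -> False.
Proof.
move=> fx fy; have [n1 n2] := wp_image fy; have [r1 r2] := isogeny_root.
have h1 : f' (wp y) = 0 by rewrite isogeny_phi fy wp_x0.
have h2 : f' (wp x) = wp y by rewrite isogeny_phi fx.
exact: (torsion_T2_T_absurd io_inj dn_neq0 fracE k2 stp n1 h1 h2 r2 n2 r1).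
Qed.

Lemma torsion_T2_T1_absurd x w : f x = x0 -> w != 0 -> f w = w -> False.
Proof.
move=> fx w0 fw; have [n1 n2] := wp_image fx; have [r1 r2] := isogeny_root.
have h1 : f' (wp x) = 0 by rewrite isogeny_phi fx wp_x0.
have h2 : wp w != 0.
  apply: contraNneq w0 => e; have := phi_wp k2 x00 fx0 w.
  by rewrite e expr0n /= !mulr0 addr0 mulr0 fw => ->.
have h3 : f' (wp w) = wp w by rewrite isogeny_phi fw.
exact: (torsion_T_T_T1_absurd io_inj dn_neq0 fracE k2 stp dtp n1 h1 r2 n2 r1 h2 h3).
Qed.

End Isogeny.

(** * The A-module structure and the list of torsion points *)

Section Action.
Variables (k : finFieldType) (K : fieldType) (io : {rmorphism {poly k} -> K}).
Hypothesis k2 : forall c : k, c != 0 -> c = 1.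
Variables g D : K.
Implicit Types (x y z : K) (a b c p l : {poly k}).

Definition act a x : K :=
  \sum_(i < size a) io (a`_i)%:P * iter i (phi (io 'X) g D) x.

Notation f := (phi (io 'X) g D).
Let c2 := char2 io k2.

Lemma actE n a x : (size a <= n)%N ->
  act a x = \sum_(i < n) io (a`_i)%:P * iter i f x.
Proof.
move=> sn; rewrite /act (big_ord_widen n (fun i => io (a`_i)%:P * iter i f x)) //.
rewrite big_mkcond; apply: eq_bigr => i _; case: ltnP => // h.
by rewrite nth_default // rmorph0 mul0r.
Qed.

Lemma act0 x : act 0 x = 0.
Proof. by rewrite /act size_poly0 big_ord0. Qed.

Lemma act_add a b x : act (a + b) x = act a x + act b x.
Proof.
set n := maxn (size a) (size b).
rewrite !(@actE n) ?leq_maxl ?leq_maxr ?size_polyD // -big_split /=.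
by apply: eq_bigr => i _; rewrite coefD polyCD rmorphD mulrDl.
Qed.

Lemma actC (c : k) x : act c%:P x = io c%:P * x.
Proof.
by rewrite (@actE 1) ?size_polyC ?leq_b1 // big_ord_recl big_ord0 addr0 coefC.
Qed.

Lemma act1 x : act 1 x = x.
Proof. by rewrite -polyC1 actC rmorph1 mul1r. Qed.

Lemma iterfD i x y : iter i f (x + y) = iter i f x + iter i f y.
Proof. by elim: i => //= i ->; rewrite phiD. Qed.

Lemma actD a x y : act a (x + y) = act a x + act a y.
Proof.
by rewrite /act -big_split /=; apply: eq_bigr => i _; rewrite iterfD mulrDr.
Qed.

Lemma actx0 a : act a 0 = 0.
Proof. by apply: (addIr (act a 0)); rewrite -actD !add0r. Qed.

Lemma f_sum n (F : nat -> K) : f (\sum_(i < n) F i) = \sum_(i < n) f (F i).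
Proof.
elim: n => [|n IH]; first by rewrite !big_ord0 phi0.
by rewrite !big_ord_recr /= phiD // IH.
Qed.

Lemma f_const (c : k) x : f (io c%:P * x) = io c%:P * f x.
Proof.
have [->|/k2 ->] := eqVneq c 0; first by rewrite rmorph0 !mul0r phi0.
by rewrite rmorph1 !mul1r.
Qed.

Lemma actXM a x : act (a * 'X) x = f (act a x).
Proof.
rewrite (@actE (size a).+1); last by rewrite (leq_trans (size_polyMleq _ _)) // size_polyX addn2.
rewrite big_ord_recl coefMX /= rmorph0 mul0r add0r /act.
rewrite (f_sum _ (fun i => io (a`_i)%:P * iter i f x)).
by apply: eq_bigr => i _; rewrite coefMX /= f_const.
Qed.

Lemma actM a b x : act (a * b) x = act a (act b x).
Proof.
elim/poly_ind: a => [|a c IH]; first by rewrite mul0r !act0.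
rewrite mulrDl mulrAC !act_add !actXM IH actC; congr (_ + _).
have [->|/k2 ->] := eqVneq c 0; first by rewrite !rmorph0 !mul0r act0.
by rewrite !rmorph1 !mul1r.
Qed.

Lemma actX x : act 'X x = f x.
Proof. by have := actXM 1 x; rewrite mul1r act1. Qed.

Lemma actX1 x : act ('X + 1) x = phi (io ('X + 1)) g D x.
Proof. by rewrite act_add actX act1 /phi rmorphD rmorph1; ring. Qed.

Lemma act_gen a x : gen (io 'X) g D x (act a x).
Proof.
elim/poly_ind: a => [|a c IH]; first by rewrite act0; exact: gen0.
rewrite act_add actXM actC; apply: genD; first exact: genf.
have [->|/k2 ->] := eqVneq c 0; first by rewrite rmorph0 mul0r; exact: gen0.
by rewrite rmorph1 mul1r; exact: gen_id.
Qed.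

(* That is, x and y generate a copy of A/p (+) A/p'. *)
Definition spans (s : seq K) p p' := exists x y, [/\ x \in s, y \in s &
  forall b c, (act b x + act c y == 0) = (p %| b) && (p' %| c)].

Lemma spans_order s p p' : spans s p p' ->
  exists2 x, x \in s & forall b, (act b x == 0) = (p %| b).
Proof.
by case=> x [y [xs _ h]]; exists x => // b; have := h b 0; rewrite act0 addr0 dvdp0 andbT.
Qed.

End Action.

Section Torsion.
Variables (k : finFieldType) (K : fieldType) (io : {rmorphism {poly k} -> K}).
Hypothesis k2 : forall c : k, c != 0 -> c = 1.
Variables g D : K.
Implicit Types (x y z : K) (a b c p l : {poly k}).
Notation act := (act io g D).
Let c2 := char2 io k2.

Definition tor x := exists a, a != 0 /\ act a x = 0.

Lemma tor0 : tor 0.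
Proof. by exists 1; rewrite oner_neq0 actx0. Qed.

Lemma torD x y : tor x -> tor y -> tor (x + y).
Proof.
move=> [a [a0 ax]] [b [b0 by_]]; exists (a * b); split; first by rewrite mulf_neq0.
have e1 : act (a * b) y = 0 by rewrite actM // by_ actx0.
have e2 : act (a * b) x = 0 by rewrite mulrC actM // ax actx0.
by rewrite actD // e1 e2 addr0.
Qed.

Lemma tor_act a x : tor x -> tor (act a x).
Proof.
move=> [b [b0 bx]]; exists b; split=> //.
by rewrite -actM // mulrC actM // bx actx0.
Qed.

Variables (m n : {poly k}) (iso : K -> {poly k} * {poly k}).
Hypotheses (m0 : m != 0) (n0 : n != 0).
Definition inR (w : {poly k} * {poly k}) := (size w.1 < size m)%N /\ (size w.2 < size n)%N.
Hypothesis iso_in : forall x, tor x -> inR (iso x).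
Hypothesis iso_inj : forall x y, tor x -> tor y -> iso x = iso y -> x = y.
Hypothesis iso_surj : forall w, inR w -> exists x, tor x /\ iso x = w.
Hypothesis isoD : forall x y, tor x -> tor y ->
  iso (x + y) = (((iso x).1 + (iso y).1) %% m, ((iso x).2 + (iso y).2) %% n).
Hypothesis isoM : forall a x, tor x ->
  iso (act a x) = ((a * (iso x).1) %% m, (a * (iso x).2) %% n).

(** Induction over the finitely many candidate pairs, extracting one preimage for each reduced pair.
    The finiteness behind [bounded] and [escape] comes from here. *)
Lemma torsion_seq : exists s : seq K, forall x, (x \in s) <-> tor x.
Proof.
suff [s [h1 h2]] : exists s : seq K, (forall x, x \in s -> tor x) /\
   forall x, tor x -> iso x \in
     [seq (rVpoly r.1, rVpoly r.2) | r <- enum [the finType of ('rV[k]_(size m) * 'rV[k]_(size n))%type]] ->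
     x \in s.
  exists s => x; split; [exact: h1|move=> tx; apply: h2 => //].
  have [i1 i2] := iso_in tx; apply/mapP.
  exists (poly_rV (iso x).1, poly_rV (iso x).2); first by rewrite mem_enum.
  by rewrite /= !poly_rV_K ?(ltnW i1) ?(ltnW i2) //; case: (iso x).
elim: [seq _ | _ <- _] => [|w L [s [h1 h2]]]; first by exists [::].
have [hw|hw] := boolP ((size w.1 < size m)%N && (size w.2 < size n)%N).
  have [|z [tz ez]] := @iso_surj w; first by case/andP: hw.
  exists (z :: s); split=> [x|x tx]; rewrite !inE; first by case/orP=> [/eqP ->|/h1].
  case/orP=> [/eqP e|h]; first by rewrite (iso_inj tx tz) ?eqxx // ez.
  by rewrite h2 // orbT.
exists s; split=> // x tx; rewrite inE => /orP[/eqP e|]; last exact: h2.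
by have [i1 i2] := iso_in tx; move: hw; rewrite -e i1 i2.
Qed.

Lemma iso0 : iso 0 = (0, 0).
Proof. by have := isoM 0 tor0; rewrite act0 !mul0r !mod0p. Qed.

Lemma torsion_pair s p p' : (forall x, (x \in s) <-> tor x) -> p %| n -> p' %| m ->
  spans io g D s p p'.
Proof.
move=> hs pn pm.
have [p0 p'0] : p != 0 /\ p' != 0.
  by split; [apply: contraTneq pn|apply: contraTneq pm] => ->; rewrite dvd0p.
(* n / p has annihilator p modulo n. The reduction modulo n matters when p is constant, where n / p
   is not a reduced representative. *)
have [|x [tx ex]] := @iso_surj (0, (n %/ p) %% n).
  by split; rewrite /= ?ltn_modp // size_poly0 size_poly_gt0.
have [|y [ty ey]] := @iso_surj ((m %/ p') %% m, 0).
  by split; rewrite /= ?ltn_modp // size_poly0 size_poly_gt0.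
have dv (q r b : {poly k}) : q %| r -> q != 0 -> r != 0 -> (r %| b * (r %/ q)) = (q %| b).
  move=> qr q0 r0; rewrite -{1}(divpK qr) mulrC dvdp_mul2r //.
  by apply: contraNneq r0 => z; rewrite -(divpK qr) z mul0r.
exists x, y; split; [exact/hs|exact/hs|move=> b c].
have tb := tor_act b tx; have tc := tor_act c ty.
have E : iso (act b x + act c y) = ((c * (m %/ p')) %% m, (b * (n %/ p)) %% n).
  by rewrite isoD // !isoM // ex ey /= !mulr0 !mod0p add0r addr0 !modp_id !modp_mul.
apply/eqP/andP => [e|[h1 h2]].
  move: E; rewrite e iso0 => -[e1 e2]; split.
    by rewrite -(dv p n b) // /dvdp -e2.
  by rewrite -(dv p' m c) // /dvdp -e1.
apply: iso_inj; [exact: torD|exact: tor0|].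
rewrite E iso0; congr (_, _); apply/modp_eq0P; by rewrite dv.
Qed.

Lemma torsion_closed s : (forall x, (x \in s) <-> tor x) -> closed_mod (io 'X) g D s.
Proof.
move=> hs; split=> [x y /hs tx /hs ty|x /hs tx]; apply/hs; first exact: torD.
by rewrite -actX //; exact: tor_act.
Qed.

End Torsion.

(** * Irreducible polynomials of degree at most 2 and the possible shapes *)

Section SmallPolynomials.
Variable k : finFieldType.
Hypothesis k2 : forall c : k, c != 0 -> c = 1.
Implicit Types (a b c p q l : {poly k}).
Let c2 := char2p k2.

Definition Qp : {poly k} := 'X ^+ 2 + 'X + 1.
Definition is_lin l := l = 'X \/ l = 'X + 1.

Lemma is_linS l : is_lin l -> is_lin (l + 1).
Proof. by case=> ->; [right|left; ring: c2]. Qed.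

Lemma lin_size l : is_lin l -> size l = 2%N.
Proof. by case=> ->; rewrite ?size_t1 ?size_polyX. Qed.

Lemma lin_deriv l : is_lin l -> l^`() = 1.
Proof. by case=> ->; rewrite ?derivD derivX // -polyC1 derivC addr0. Qed.

Lemma lin_irr l : is_lin l -> irreducible_poly l.
Proof. by move/lin_size/irredp_size2. Qed.

Lemma lin_neq0 l : is_lin l -> l != 0.
Proof. by move/lin_irr/irredp_neq0. Qed.

Lemma lin_dg l : is_lin l -> dg l = 1%N.
Proof. by rewrite /dg => /lin_size ->. Qed.

Lemma lin_Q l : is_lin l -> Qp = l ^+ 2 + l + 1.
Proof.
case=> -> //; rewrite /Qp (psqrD k2) expr1n -[LHS]addr0 -(paddKK k2 1); ring.
Qed.

Lemma dgQ : dg Qp = 2%N.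
Proof.
have dX : dg ('X : {poly k}) = 1%N by rewrite /dg size_polyX.
rewrite /Qp dgD_gt; first by rewrite dgD_gt dgX dX.
by rewrite (@dgD_gt _ ('X ^+ 2)) dgX dX // /dg size_poly1.
Qed.

Lemma Q_neq0 : Qp != 0.
Proof. by apply: contra_eq_neq dgQ => ->; rewrite dg0. Qed.

Lemma lin_mod l p : is_lin l -> ~~ (l %| p) -> l %| p + 1.
Proof.
move=> hl lp; have e := divp_eq p l.
have -> : p + 1 = p %/ l * l; last exact: dvdp_mull.
have r1 : p %% l = 1.
  apply: (unit_eq1 k2); move: lp; rewrite /dvdp -size_poly_gt0.
  have := ltn_modp p l; rewrite (lin_neq0 hl) (lin_size hl).
  by case: (size _) => [|[|]].
by rewrite {1}e r1 -addrA (paddKK k2) addr0.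
Qed.

(** If neither X nor X + 1 divides p, both divide p + 1, and the degree leaves p = X (X + 1) + 1. *)
Lemma irredp_small p : irreducible_poly p -> (dg p <= 2)%N -> is_lin p \/ p = Qp.
Proof.
move=> ip dp.
have hX : is_lin 'X by left.
have hX1 := is_linS hX.
have [h|h0] := boolP ('X %| p).
  by left; rewrite -(irredp_eq k2 (lin_irr hX) ip h).
have [h|h1] := boolP (('X + 1) %| p).
  by left; rewrite -(irredp_eq k2 (lin_irr hX1) ip h).
right; have : 'X * ('X + 1) %| p + 1.
  rewrite Gauss_dvdp ?lin_mod //.
  rewrite -[X in coprimep X _](mulr1 'X).
  by rewrite mulr1 -{2}['X]mul1r coprimep_addl_mul coprimep1.
case/dvdpP => c ec.
have p1 : p = c * ('X * ('X + 1)) + 1 by rewrite -ec -addrA (paddKK k2) addr0.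
have sp := ip.1.
have c0 : c != 0.
  by apply: contraTneq sp => c0; rewrite p1 c0 mul0r add0r size_poly1.
have X0 := lin_neq0 hX; have X10 := lin_neq0 hX1.
have dc : dg (p + 1) = (dg c + 2)%N.
  by rewrite ec dgM ?mulf_neq0 // dgM // (lin_dg hX) (lin_dg hX1).
have dp1 : (dg (p + 1)%R <= 2)%N by apply: dgD_le => //; rewrite /dg size_poly1.
have -> : p = 'X * ('X + 1) + 1; last by rewrite /Qp; ring.
rewrite p1; congr (_ + _); have -> : c = 1; last by rewrite mul1r.
by apply: (unit_eq1 k2); rewrite (sizeE c0); lia.
Qed.

Lemma dvdp_factor n p : p %| n -> n != 0 -> exists q, [/\ n = p * q, q != 0 & dg n = (dg p + dg q)%N].
Proof.
case/dvdpP=> q -> ; rewrite mulf_eq0 negb_or => /andP[q0 p0].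
by exists q; split=> //; rewrite mulrC // dgM.
Qed.

Lemma exists_factor (n : {poly k}) : (0 < dg n)%N -> exists2 p, irreducible_poly p & p %| n.
Proof. by rewrite /dg => h; apply: exists_irredp; case: (size n) h => [|[]]. Qed.

Lemma shapes m n : m != 0 -> n != 0 -> m %| n -> (2 < dg m + dg n)%N ->
  (forall p, irreducible_poly p -> p %| n -> (dg p <= 2)%N) ->
  [\/ Qp ^+ 2 %| n, Qp %| n /\ Qp %| m | exists2 l, is_lin l & Qp * l %| n] \/
  exists2 l, is_lin l & [\/ l ^+ 3 %| n, l ^+ 2 %| n /\ l %| m,
     l ^+ 2 * (l + 1) %| n | l * (l + 1) %| n /\ l %| m].
Proof.
move=> m0 n0 mn dmn small.
have dm := dvdp_dg mn n0.
have fac q : q %| n -> (0 < dg q)%N -> exists2 p, p %| q & is_lin p \/ p = Qp.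
  move=> qn /exists_factor [p ip pq]; exists p => //.
  by apply: irredp_small => //; apply: small => //; exact: dvdp_trans qn.
have other l l' : is_lin l -> is_lin l' -> l' = l \/ l' = l + 1.
  by case=> ->; case=> ->; [left|right|right; ring: c2|left].
have [hQ|nQ] := boolP (Qp %| n).
  left; have [hm|hm] := boolP (Qp %| m); first by constructor 2.
  have [r [er r0 dr]] := dvdp_factor hQ n0.
  have rn : r %| n by rewrite er dvdp_mull.
  have [dr0|dr0] := posnP (dg r).
    have [p pm hp] : exists2 p, p %| m & is_lin p \/ p = Qp.
      apply: fac => //; rewrite dgQ in dr; lia.
    have pn := dvdp_trans pm mn.
    case: hp => [hl|hp]; last by move: hm; rewrite -hp pm.
    constructor 3; exists p => //; rewrite er.
    have r1 : r = 1 by apply: (unit_eq1 k2); rewrite sizeE // dr0.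
    move: pn; rewrite er r1 mulr1 (lin_Q hl) expr2 dvdp_addr.
      by move/dvdp_dg => /(_ (oner_neq0 _)); rewrite (lin_dg hl) /dg size_poly1.
    by rewrite dvdp_add // dvdp_mulr.
  have [p pr hp] := fac r rn dr0.
  have pp : Qp * p %| n by rewrite er dvdp_mul.
  case: hp => [hl|hp]; first by constructor 3; exists p.
  by constructor 1; rewrite expr2 -{2}hp.
right.
have lfac q : q %| n -> (0 < dg q)%N -> exists2 p, p %| q & is_lin p.
  move=> qn dq; have [p pq [hl|hp]] := fac q qn dq; first by exists p.
  by move: nQ; rewrite -hp (dvdp_trans pq qn).
(* If n has degree at most 2, then m is non-constant and n has degree exactly 2: one linear factor
   comes from m and two from n. Otherwise three linear factors are taken from n. *)
have [n3|n3] := ltnP 2 (dg n); last first.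
  have [p pm hl] : exists2 p, p %| m & is_lin p by apply: lfac => //; lia.
  have [q [e q0 d]] := dvdp_factor (dvdp_trans pm mn) n0.
  have qn : q %| n by rewrite e dvdp_mull.
  have [p2 pq2 hl2] : exists2 p, p %| q & is_lin p.
    by apply: lfac => //; have := lin_dg hl; lia.
  have pp : p * p2 %| n by rewrite e dvdp_mul.
  exists p => //; have [e2|e2] := other _ _ hl hl2.
  - by constructor 2; rewrite expr2 -{2}e2.
  - by constructor 4; rewrite -e2.
have [p1 pq1 hl1] : exists2 p, p %| n & is_lin p by apply: lfac => //; lia.
have [q1 [e1 q10 d1]] := dvdp_factor pq1 n0.
have qn1 : q1 %| n by rewrite e1 dvdp_mull.
have [p2 pq2 hl2] : exists2 p, p %| q1 & is_lin p.
  by apply: lfac => //; have := lin_dg hl1; lia.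
have [q2 [e2 q20 d2]] := dvdp_factor pq2 q10.
have qn2 : q2 %| n by rewrite e1 e2 !dvdp_mull.
have [p3 pq3 hl3] : exists2 p, p %| q2 & is_lin p.
  by apply: lfac => //; have := lin_dg hl1; have := lin_dg hl2; lia.
have ppp : p1 * (p2 * p3) %| n by rewrite e1 e2 !dvdp_mul.
have [h2|h2] := other _ _ hl1 hl2; have [h3|h3] := other _ _ hl1 hl3; rewrite h2 h3 in ppp.
- exists p1 => //; constructor 1; by rewrite exprS expr2.
- exists p1 => //; constructor 3; by rewrite expr2 -mulrA.
- exists p1 => //; constructor 3; by rewrite expr2 -mulrA [p1 * (p1 + 1)]mulrC.
- exists (p1 + 1); first exact: is_linS.
  constructor 3; have -> : p1 + 1 + 1 = p1 by ring: c2.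
  by rewrite expr2 mulrC.
Qed.

End SmallPolynomials.

Section Scaling.
Variables (k : finFieldType) (K : fieldType) (io : {rmorphism {poly k} -> K}).
Hypothesis k2 : forall c : k, c != 0 -> c = 1.
Variables g D : K.
Hypothesis D0 : D != 0.

(** Conjugation by h divides the coefficient of tau by h and that of tau^2 by h^3; h = g normalises
    the former. *)
Lemma scale_module : exists h g' D', [/\ h != 0, D' != 0, g' = 0 \/ g' = 1 &
  forall t x, phi t g' D' (h * x) = h * phi t g D x].
Proof.
have [g0|g0] := eqVneq g 0.
  exists 1, 0, D; split; rewrite ?oner_neq0 //; first by left.
  by move=> t x; rewrite !mul1r g0.
exists g, 1, (D / g ^+ 3); split=> //; first by rewrite mulf_neq0 ?invr_eq0 ?expf_neq0.
  by right.
by move=> t x; rewrite /phi; field.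
Qed.

Variables h g' D' : K.
Hypothesis h0 : h != 0.
Hypothesis hphi : forall t x, phi t g' D' (h * x) = h * phi t g D x.

Lemma act_scale a x : act io g' D' a (h * x) = h * act io g D a x.
Proof.
elim/poly_ind: a => [|a c IH]; first by rewrite !act0 mulr0.
by rewrite !act_add !actXM // !actC IH hphi [RHS]mulrDr [h * (io _ * x)]mulrCA.
Qed.

Lemma spans_scale s p p' : spans io g D s p p' -> spans io g' D' (map ( *%R h) s) p p'.
Proof.
case=> x [y [xs ys H]]; exists (h * x), (h * y); split; rewrite ?map_f // => b c.
by rewrite !act_scale -mulrDr mulf_eq0 (negbTE h0) H.
Qed.

Lemma closed_scale t s : closed_mod t g D s -> closed_mod t g' D' (map ( *%R h) s).
Proof.
move=> [sD sf]; split=> [_ _ /mapP[x xs ->] /mapP[y ys ->]|_ /mapP[x xs ->]].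
  by rewrite -mulrDr map_f // sD.
by rewrite hphi map_f // sf.
Qed.
End Scaling.

(** * Each shape is excluded for the rational function field *)

Section Cases.
Variables (k : finFieldType) (K : fieldType) (io : {rmorphism {poly k} -> K}).
Variables (nm dn : K -> {poly k}).
Hypothesis io_inj : injective io.
Hypothesis dn_neq0 : forall x, dn x != 0.
Hypothesis fracE : forall x, x = io (nm x) / io (dn x).
Hypothesis k2 : forall c : k, c != 0 -> c = 1.
Implicit Types (x y z : K) (a b c p l : {poly k}).

Let c2 := char2 io k2.
Let c2p := char2p k2.
Let ioE := io_eq0 io_inj.
Let Pl := {p : {poly k} | irreducible_poly p}.
Let vp (i : Pl) := vpi nm dn (sval i).
Let vi := vinf nm dn.
Let d := der io nm dn.

Let mup (i : Pl) := is_mu_pi (svalP i).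
Let hd : derivation d.
Proof. by split; [exact: derD|exact: derM]. Qed.
Let hvp (i : Pl) : is_val (vp i) := is_val_val io_inj dn_neq0 fracE (mup i).
Let hvi : is_val vi := is_val_val io_inj dn_neq0 fracE (is_mu_inf k).
Let hd1 (i : Pl) x : vge (vp i) (vp i x - 1) (d x) :=
  (der_vpi_both io_inj dn_neq0 fracE k2 x (svalP i)).1.
Let hd0 (i : Pl) x : 0 <= vp i x -> vge (vp i) 0 (d x) :=
  (der_vpi_both io_inj dn_neq0 fracE k2 x (svalP i)).2.
Let hdi x : vge vi (vi x + 1) (d x) := der_vinf io_inj dn_neq0 fracE k2 x.
Let PF x : x != 0 -> (forall i, 0 <= vp i x) -> vi x <= 0.
Proof.
move=> x0 h; apply: (product_formula io_inj dn_neq0 fracE) => // p ip.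
exact: (h (exist _ p ip)).
Qed.
Let ht a (i : Pl) : vge (vp i) 0 (io a).
Proof.
have [->|a0] := eqVneq a 0; first by rewrite rmorph0 vge0.
rewrite vgeE ?ioE // /vp /vpi (val_io io_inj dn_neq0 fracE (mup i)) //.
Qed.
Let dt l : is_lin l -> d (io l) = 1.
Proof. by move=> hl; rewrite /d der_io // lin_deriv // rmorph1. Qed.
Let vit l : is_lin l -> vi (io l) = -1.
Proof.
move=> hl; rewrite /vi /vinf (val_io io_inj dn_neq0 fracE (is_mu_inf k)) ?lin_neq0 //.
by rewrite (lin_size hl).
Qed.

(* Both places have residue field F_2, so the quotient of two elements of equal
   valuation is congruent to 1. *)
Lemma residue_sum (v : K -> int) : is_val v ->
  (forall z, z != 0 -> z + 1 != 0 -> v z = 0 -> 0 < v (z + 1)) ->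
  forall x y, x != 0 -> y != 0 -> x + y != 0 -> v x = v y -> v x < v (x + y).
Proof.
move=> hv H x y x0 y0 xy0 e.
have z0 : x / y != 0 by rewrite mulf_neq0 ?invr_eq0.
have E : x + y = y * (x / y + 1) by rewrite mulrDr mulrCA divff // !mulr1.
have z1 : x / y + 1 != 0 by apply: contraNneq xy0 => z; rewrite E z mulr0.
have vz : v (x / y) = 0 by rewrite (valM hv) ?invr_eq0 // (valV hv) // e subrr.
by rewrite E (valM hv) // e ltrDl; exact: H.
Qed.

Lemma residue_inf z : z != 0 -> z + 1 != 0 -> vi z = 0 -> 0 < vi (z + 1).
Proof.
have [a [b [b0 ab ->]]] := reduced_frac io_inj dn_neq0 fracE z.
have B : io b != 0 by rewrite ioE.
have -> : io a / io b + 1 = io (a + b) / io b by rewrite rmorphD; field.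
rewrite !mulf_eq0 !negb_or invr_eq0 !ioE b0 !andbT => a0 ab0.
rewrite /vi /vinf !(val_frac io_inj dn_neq0 fracE (is_mu_inf k)) //.
have la : lead_coef a = 1 by apply: k2; rewrite lead_coef_eq0.
have lb : lead_coef b = 1 by apply: k2; rewrite lead_coef_eq0.
move=> e; have sab : size a = size b.
  have := sizeE a0; have := sizeE b0; move: e; rewrite /dg.
  by case: (size a) => // i; case: (size b) => // j; lia.
suff : (size (a + b)%R < size b)%N.
  have := sizeE ab0; have := sizeE b0; rewrite /dg.
  by case: (size (a + b)) => // i; case: (size b) => // j; lia.
have sb0 : (0 < size b)%N by rewrite size_poly_gt0.
rewrite -(prednK sb0) ltnS; apply/leq_sizeP => j hj.
rewrite coefD; have [lt|ge] := ltnP (size b).-1 j.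
  have sj : (size b <= j)%N by rewrite -(prednK sb0).
  by rewrite !nth_default ?addr0 ?sab.
have -> : j = (size b).-1 by apply/eqP; rewrite eqn_leq ge hj.
by move: la lb; rewrite /lead_coef sab => -> ->; rewrite -mulr2n (char2k k2).
Qed.

Let iX : Pl := exist _ 'X (irredp_size2 (size_polyX k)).

Lemma residue_X z : z != 0 -> z + 1 != 0 -> vp iX z = 0 -> 0 < vp iX (z + 1).
Proof.
have [a [b [b0 ab ->]]] := reduced_frac io_inj dn_neq0 fracE z.
have B : io b != 0 by rewrite ioE.
have -> : io a / io b + 1 = io (a + b) / io b by rewrite rmorphD; field.
rewrite !mulf_eq0 !negb_or invr_eq0 !ioE b0 !andbT => a0 ab0.
rewrite /vp /vpi !(val_frac io_inj dn_neq0 fracE (mup iX)) //= => e.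
have iX' := svalP iX; rewrite /= in iX'.
have hX : is_lin ('X : {poly k}) by left.
have na : ~~ ('X %| a).
  apply/negP => Xa; have := coprimep_dvd iX' ab Xa.
  by rewrite -(pmult_gt0 iX') //; move: Xa; rewrite -(pmult_gt0 iX') //; lia.
have nb : ~~ ('X %| b).
  by move: na; rewrite -!(pmult_gt0 iX') //; lia.
have Xab : 'X %| a + b.
  have -> : a + b = (a + 1) + (b + 1) by ring: c2p.
  by rewrite dvdp_add // lin_mod.
move: nb Xab; rewrite -!(pmult_gt0 iX') //; lia.
Qed.

Variables g D : K.
Hypothesis D0 : D != 0.
Notation f := (phi (io 'X) g D).
Notation act := (act io g D).

Lemma act_lin l x : is_lin l -> act l x = phi (io l) g D x.
Proof. by case=> ->; [rewrite actX|rewrite actX1]. Qed.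

Section Linear.
Variables (s : seq K) (l : {poly k}).
Hypothesis hl : is_lin l.
Notation fl := (phi (io l) g D).

Let sl := lin_size hl.
Let dl := lin_deriv hl.
Let l0 := lin_neq0 hl.
Let l10 := lin_neq0 (is_linS k2 hl).
Let dgl := lin_dg hl.
Let dgl1 := lin_dg (is_linS k2 hl).

Let ndvd a b : b != 0 -> (dg b < dg a)%N -> (a %| b) = false.
Proof. by move=> b0 h; apply/negP => /dvdp_eq0 /(_ h) e; rewrite e eqxx in b0. Qed.

Lemma spans_T3_absurd p : ~ spans io g D s (l ^+ 3) p.
Proof.
case/spans_order => x _ hx.
have x00 : act (l * l) x != 0 by rewrite hx ndvd ?mulf_neq0 // dgX dgM // dgl.
have fx0 : fl (act (l * l) x) = 0.
  by apply/eqP; rewrite -act_lin // -actM // hx exprS expr2 dvdpp.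
apply: (torsion_T3_absurd io_inj dn_neq0 fracE k2 sl D0 x00 fx0 (x := x) (erefl _)).
by rewrite -!act_lin // actM.
Qed.

Lemma spans_T2_T_absurd : ~ spans io g D s (l ^+ 2) l.
Proof.
case=> x [y [_ _ h]].
have hx b : (act b x == 0) = (l ^+ 2 %| b).
  by have := h b 0; rewrite act0 addr0 dvdp0 andbT.
have hy b : (act b y == 0) = (l %| b).
  by have := h 0 b; rewrite act0 add0r dvdp0.
have x00 : act l x != 0 by rewrite hx ndvd // dgX dgl.
have fx0 : fl (act l x) = 0.
  by apply/eqP; rewrite -act_lin // -actM // hx expr2 dvdpp.
apply: (torsion_T2_T_absurd io_inj dn_neq0 fracE k2 sl x00 fx0 (x := x) (z := y)).
- by rewrite -act_lin.
- by rewrite -(act1 io g D y) hy ndvd ?oner_neq0 // dgl /dg size_poly1.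
- rewrite eq_sym -(add_eq0 c2) -(act1 io g D y) h negb_and.
  by rewrite [l ^+ 2 %| l]ndvd // dgX dgl.
- by apply/eqP; rewrite -act_lin // hy dvdpp.
Qed.

Lemma spans_T2_T1_absurd p : ~ spans io g D s (l ^+ 2 * (l + 1)) p.
Proof.
case/spans_order => v _ hv.
have dv : dg (l ^+ 2 * (l + 1)) = 3%N by rewrite dgM ?expf_neq0 // dgX dgl dgl1.
have x00 : act (l * (l + 1)) v != 0.
  by rewrite hv ndvd ?mulf_neq0 // dv dgM // dgl dgl1.
have fx0 : fl (act (l * (l + 1)) v) = 0.
  by apply/eqP; rewrite -act_lin // -actM // hv mulrA expr2 dvdpp.
apply: (torsion_T2_T1_absurd io_inj dn_neq0 fracE k2 sl dl D0 x00 fx0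
  (x := act (l + 1) v) (w := act (l ^+ 2) v)).
- by rewrite -act_lin // actM.
- by rewrite hv ndvd ?expf_neq0 // dv dgX dgl.
- apply/eqP; rewrite -(add_eq0 c2) -act_lin // -actM // -act_add hv.
  suff -> : l * l ^+ 2 + l ^+ 2 = l ^+ 2 * (l + 1) by [].
  by ring.
Qed.

Lemma spans_T_T_T1_absurd : ~ spans io g D s (l * (l + 1)) l.
Proof.
case=> v [y [_ _ h]].
have hv b : (act b v == 0) = (l * (l + 1) %| b).
  by have := h b 0; rewrite act0 addr0 dvdp0 andbT.
have hy b : (act b y == 0) = (l %| b).
  by have := h 0 b; rewrite act0 add0r dvdp0.
have dv : dg (l * (l + 1)) = 2%N by rewrite dgM // dgl dgl1.
have x00 : act (l + 1) v != 0 by rewrite hv ndvd // dv dgl1.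
have fx0 : fl (act (l + 1) v) = 0.
  by apply/eqP; rewrite -act_lin // -actM // hv dvdpp.
apply: (torsion_T_T_T1_absurd io_inj dn_neq0 fracE k2 sl dl x00 fx0 (z := y) (w := act l v)).
- by rewrite -(act1 io g D y) hy ndvd ?oner_neq0 // dgl /dg size_poly1.
- rewrite eq_sym -(add_eq0 c2) -(act1 io g D y) h negb_and.
  by rewrite [_ %| l + 1]ndvd // dv dgl1.
- by apply/eqP; rewrite -act_lin // hy dvdpp.
- by rewrite hv ndvd // dv dgl.
- apply/eqP; rewrite -(add_eq0 c2) -act_lin // -actM // -act_add hv.
  suff -> : l * l + l = l * (l + 1) by [].
  by ring.
Qed.
End Linear.

Section Nonlinear.
Hypothesis g01 : g = 0 \/ g = 1.
Variable s : seq K.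
Hypothesis hs : closed_mod (io 'X) g D s.

Let sD := hs.1.
Let act_in a x : x \in s -> act a x \in s.
Proof. by move=> xs; apply: (gen_closed c2 hs xs); exact: act_gen. Qed.

Let hX : is_lin ('X : {poly k}). Proof. by left. Qed.

Let closed_lin l : is_lin l -> closed_mod (io l) g D s.
Proof. by move=> hl; split=> // x xs; rewrite -act_lin //; exact: act_in. Qed.

(** Such a combination is [act a x] with a of degree at most 2, and p divides neither a nor a X.
    This supplies the side conditions of [simple_absurd]. *)
Lemma low_degree_neq0 p x : irreducible_poly p -> (2 < dg p)%N ->
  (forall b, (act b x == 0) = (p %| b)) ->
  forall b0 b1 b2 : bool, [|| b0, b1 | b2] ->
  x *+ b0 + f x *+ b1 + f (f x) *+ b2 != 0 /\
  f (x *+ b0 + f x *+ b1 + f (f x) *+ b2) != 0.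
Proof.
move=> ip dp hx b0 b1 b2 hb.
set a : {poly k} := 1 *+ b0 + 'X *+ b1 + 'X^2 *+ b2.
have -> : x *+ b0 + f x *+ b1 + f (f x) *+ b2 = act a x.
  rewrite /a !act_add; congr (_ + _ + _).
  - by case: b0 {a hb}; rewrite ?mulr0n ?mulr1n ?act0 ?act1.
  - by case: b1 {a hb}; rewrite ?mulr0n ?mulr1n ?act0 ?actX.
  - by case: b2 {a hb}; rewrite ?mulr0n ?mulr1n ?act0 // expr2 actXM // actX.
have a0 : a != 0.
  apply/eqP => e; have c i : a`_i = 0 by rewrite e coef0.
  case/or3P: hb => hb; [have := c 0%N|have := c 1%N|have := c 2%N];
    rewrite /a hb !coefD !coefMn coef1 coefX coefXn /= !mul0rn ?addr0 ?add0r;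
    by move/eqP; rewrite oner_eq0.
have da : (dg a <= 2)%N.
  have d1 : dg (1 : {poly k}) = 0%N by rewrite /dg size_poly1.
  have dX : dg ('X : {poly k}) = 1%N by rewrite /dg size_polyX.
  rewrite /a; apply: dgD_le; last by case: (b2); rewrite ?mulr0n ?mulr1n ?dg0 // dgX dX.
  apply: dgD_le; first by case: (b0); rewrite ?mulr0n ?mulr1n ?dg0 // d1.
  by case: (b1); rewrite ?mulr0n ?mulr1n ?dg0 // dX.
have pa : ~~ (p %| a).
  by apply/negP => h; have := dvdp_dg h a0; lia.
split; first by rewrite hx.
rewrite -actXM // hx irredp_dvdM // negb_or pa.
by apply/negP => h; have := dvdp_dg h (lin_neq0 hX); rewrite (lin_dg hX); lia.
Qed.

Lemma spans_irr_absurd p p' : irreducible_poly p -> (2 < dg p)%N -> ~ spans io g D s p p'.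
Proof.
move=> ip dp /spans_order [x xs hx].
have N := low_degree_neq0 ip dp hx.
have x0 : x != 0 by rewrite -(act1 io g D x) hx; apply/negP => /dvdp_dg /(_ (oner_neq0 _)); rewrite [dg 1]/dg size_poly1 leqn0 => /eqP e; rewrite e in dp.
pose P y := exists b, y = act b x.
apply: (simple_absurd c2 hd hvp hvi hd1 hd0 hdi PF (ht 'X) (dt hX) D0 g01 hs (P := P) (x := x)).
- by move=> _ _ [a ->] [b ->]; exists (a + b); rewrite act_add.
- by move=> _ [a ->]; exact: act_in.
- by move=> _ [a ->]; exists (a * 'X); rewrite actXM.
(* A nonzero element of A/p generates it: a is inverted modulo p by a Bezout relation. *)
- move=> _ _ [a ->] [b ->]; rewrite hx => pa.
  have /Bezout_eq1_coprimepP [[u v] /= e] : coprimep a p.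
    by rewrite coprimep_sym irreducible_poly_coprime.
  have -> : act b x = act (b * u) (act a x).
    rewrite -actM //; apply/eqP; rewrite -(add_eq0 c2) -act_add hx.
    have -> : b + b * u * a = b * v * p.
      by rewrite -{1}(mulr1 b) -e; ring: c2p.
    by rewrite dvdp_mull.
  exact: act_gen.
- by exists 1; rewrite act1.
- done.
- by have [] := N true false false isT; rewrite ?mulr0n ?mulr1n ?addr0.
- by have [] := N true true false isT; rewrite ?mulr0n ?mulr1n ?addr0.
- by have [] := N false false true isT; rewrite ?mulr0n ?mulr1n ?addr0 ?add0r.
- by have [] := N true false true isT; rewrite ?mulr0n ?mulr1n ?addr0 ?add0r.
- by have [] := N false true true isT; rewrite ?mulr0n ?mulr1n ?addr0 ?add0r.
- by have [] := N true true true isT; rewrite ?mulr0n ?mulr1n ?addr0 ?add0r.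
- by have [] := N false false true isT; rewrite ?mulr0n ?mulr1n ?addr0 ?add0r.
- by have [] := N true false true isT; rewrite ?mulr0n ?mulr1n ?addr0 ?add0r ?(phiD c2).
- by have [] := N false true true isT; rewrite ?mulr0n ?mulr1n ?addr0 ?add0r ?(phiD c2).
- by have [] := N true true true isT; rewrite ?mulr0n ?mulr1n ?addr0 ?add0r ?(phiD c2).
Qed.

Let QfE x : Qf (io 'X) g D x = act (Qp k) x.
Proof. by rewrite /Qp !act_add act1 expr2 actXM // !actX. Qed.

Let cycle l x : is_lin l -> act (Qp k) x = 0 ->
  phi (io l) g D (act l (act l x)) = x /\ act l (act l x) = x + act l x.
Proof.
move=> hl hx; split; apply/eqP; rewrite -(add_eq0 c2).
  (* (l + 1) Q = l^3 + 1 for both linear l, so l acts with order 3 on the Q-torsion. *)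
  have : act (l + 1) (act (Qp k) x) = 0 by rewrite hx actx0.
  rewrite -actM // => <-; rewrite -act_lin // -!actM //; apply/eqP.
  rewrite -{2}(act1 io g D x) -act_add; congr act.
  by rewrite (lin_Q k2 hl); ring: c2p.
rewrite -hx (lin_Q k2 hl) !act_add act1 expr2 actM //; apply/eqP; ring.
Qed.

Lemma spans_Q2_absurd p : ~ spans io g D s (Qp k ^+ 2) p.
Proof.
case/spans_order => x xs hx; set v := act (Qp k) x.
have Qv : act (Qp k) v = 0 by apply/eqP; rewrite -actM // hx -expr2.
have [h1 h2] := cycle hX Qv.
apply: (square_absurd c2 hd hvp hvi hd1 hd0 hdi PF (ht 'X) (dt hX) D0 g01 hs
  (v1 := v) (v2 := act 'X v) (v3 := act 'X (act 'X v)) (x := x)) => //.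
- by rewrite actX.
- by rewrite -actX.
- rewrite hx; apply/negP => /dvdp_dg /(_ (Q_neq0 k)); by rewrite dgX dgQ.
- exact: act_in.
Qed.

Lemma spans_QQ_absurd : ~ spans io g D s (Qp k) (Qp k).
Proof.
case=> x [y [xs ys h]].
have hx b : (act b x == 0) = (Qp k %| b).
  by have := h b 0; rewrite act0 addr0 dvdp0 andbT.
have hy b : (act b y == 0) = (Qp k %| b).
  by have := h 0 b; rewrite act0 add0r dvdp0.
have n1 : (Qp k %| 1) = false.
  by apply/negP => /dvdp_dg /(_ (oner_neq0 _)); rewrite dgQ /dg size_poly1.
apply: (full_Q_absurd c2 hvp (ht 'X) D0 g01 hs (i0 := iX)
   (residue_sum (hvp iX) residue_X) (x := x) (y := y)) => //.
- by rewrite -(act1 io g D x) hx n1.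
- by rewrite -(act1 io g D y) hy n1.
- by apply/eqP; rewrite QfE hx.
- by apply/eqP; rewrite QfE hy.
have nX : (Qp k %| 'X) = false.
  by apply/negP => /dvdp_dg /(_ (lin_neq0 hX)); rewrite dgQ (lin_dg hX).
have nX2 : (Qp k %| 'X * 'X) = false.
  apply/negP; have -> : 'X * 'X = Qp k + ('X + 1) by rewrite /Qp; ring: c2p.
  have h1 := is_linS k2 hX.
  by rewrite dvdp_addr // => /dvdp_dg /(_ (lin_neq0 h1)); rewrite dgQ (lin_dg h1).
have R (u a : K) : a \in [:: u; f u; f (f u)] -> exists b, a = act b u /\ (Qp k %| b) = false.
  rewrite !inE => /or3P[] /eqP ->; [exists 1|exists 'X|exists ('X * 'X)]; split=> //.
  - by rewrite act1.
  - by rewrite actX.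
  - by rewrite actXM // actX.
by move=> a b /R [a' [-> ha]] /R [b' [-> hb]]; rewrite h ha.
Qed.

Lemma spans_Ql_absurd l p : is_lin l -> ~ spans io g D s (Qp k * l) p.
Proof.
move=> hl /spans_order [x xs hx]; set v := act l x.
have Qv : act (Qp k) v = 0 by apply/eqP; rewrite -actM // hx dvdpp.
have dQl : dg (Qp k * l) = 3%N by rewrite dgM ?Q_neq0 ?lin_neq0 // dgQ lin_dg.
have [h1 h2] := cycle hl Qv.
apply: (mixed_absurd c2 hd hvp hvi hd1 hd0 hdi PF (ht l) (dt hl) D0 g01 (closed_lin hl)
  (residue_sum hvi residue_inf) (vit hl)
  (v1 := v) (v2 := act l v) (v3 := act l (act l v)) (x0 := act (Qp k) x)) => //.
- by rewrite act_lin.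
- by rewrite -act_lin.
- by rewrite hx; apply/negP => /dvdp_dg /(_ (lin_neq0 hl)); rewrite dQl lin_dg.
- exact: act_in.
- exact: act_in.
- by rewrite hx; apply/negP => /dvdp_dg /(_ (Q_neq0 k)); rewrite dQl dgQ.
- by apply/eqP; rewrite -act_lin // -actM // mulrC hx.
Qed.
End Nonlinear.
End Cases.

(** * Assembly, and transfer to the fraction field of F_2[T] *)

Section Main.
Variables (k : finFieldType) (K : fieldType) (io : {rmorphism {poly k} -> K}).
Variables (nm dn : K -> {poly k}).
Hypothesis io_inj : injective io.
Hypothesis dn_neq0 : forall x, dn x != 0.
Hypothesis fracE : forall x, x = io (nm x) / io (dn x).
Hypothesis k2 : forall c : k, c != 0 -> c = 1.

Theorem torsion_degree (g D : K) (m n : {poly k}) (s : seq K) : D != 0 ->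
  m != 0 -> n != 0 -> m %| n -> closed_mod (io 'X) g D s ->
  (forall p p', p %| n -> p' %| m -> spans io g D s p p') ->
  (dg m + dg n <= 2)%N.
Proof.
move=> D0 m0 n0 mn hs hsp; rewrite leqNgt; apply/negP => dmn.
have [h [g' [D' [h0 D'0 g01 hphi]]]] := scale_module g D0.
have hs' := closed_scale hphi hs.
have hsp' (p p' : {poly k}) (pn : p %| n) (pm : p' %| m) := spans_scale k2 h0 hphi (hsp p p' pn pm).
have small p : irreducible_poly p -> p %| n -> (dg p <= 2)%N.
  move=> ip pn; rewrite leqNgt; apply/negP => dp.
  exact: (spans_irr_absurd io_inj dn_neq0 fracE k2 D'0 g01 hs' ip dp (hsp' _ _ pn (dvd1p _))).
case: (shapes k2 m0 n0 mn dmn small) => [[Q2|[Qn Qm]|[l hl Ql]]|[l hl [h3|[h2 hm]|h21|[h11 hm]]]].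
- exact: (spans_Q2_absurd io_inj dn_neq0 fracE k2 D'0 g01 hs' (hsp' _ _ Q2 (dvd1p _))).
- exact: (spans_QQ_absurd io_inj dn_neq0 fracE k2 D'0 g01 hs' (hsp' _ _ Qn Qm)).
- exact: (spans_Ql_absurd io_inj dn_neq0 fracE k2 D'0 g01 hs' hl (hsp' _ _ Ql (dvd1p _))).
- exact: (spans_T3_absurd io_inj dn_neq0 fracE k2 D0 hl (hsp _ _ h3 (dvd1p _))).
- exact: (spans_T2_T_absurd io_inj dn_neq0 fracE k2 hl (hsp _ _ h2 hm)).
- exact: (spans_T2_T1_absurd io_inj dn_neq0 fracE k2 D0 hl (hsp _ _ h21 (dvd1p _))).
- exact: (spans_T_T_T1_absurd io_inj dn_neq0 fracE k2 hl (hsp _ _ h11 hm)).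
Qed.

End Main.

Section FractionField.
Variable R : idomainType.

Lemma frac_numden (x : {fraction R}) :
  x = FracField.tofrac (\n_(repr x)) / FracField.tofrac (\d_(repr x)).
Proof.
set y := repr x; have d0 : \d_y != 0 := denom_ratioP y.
have o0 : (1 : R) != 0 := oner_neq0 R.
have e : FracField.tofrac (\d_y) * x = FracField.tofrac \n_y.
  rewrite -[x]reprK -/y /GRing.mul /= !piE /FracField.mulf.
  apply/eqmodP; rewrite /= FracField.equivfE !numden_Ratio ?mulf_neq0 //.
  by rewrite !mul1r mulr1 mulrC.
by rewrite -e mulrC mulKf // tofrac_eq0.
Qed.

Lemma tofrac_inj : injective (@FracField.tofrac R).
Proof. by move=> a b /eqP; rewrite tofrac_eq => /eqP. Qed.
End FractionField.

Lemma F2_neq0 (c : 'F_2) : c != 0 -> c = 1.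
Proof. by case: c => [[|[|]]] // i _; apply: val_inj. Qed.

(* m, n : monic generators of the nonzero ideals; deg = size - 1 *)
Theorem theorem1p4 (g D : F) (m n : A) :
  D != 0 ->
  m \is monic -> n \is monic -> m %| n ->
  torsion_iso g D m n ->
  ((size m).-1 + (size n).-1 <= 2)%N.
Proof.
move=> D0 mm mn dv [iso [h1 h2 h3 h4 h5]].
pose io : {rmorphism A -> F} := @FracField.tofrac A.
have m0 := monic_neq0 mm; have n0 := monic_neq0 mn.
have [s hs] := torsion_seq (io := io) h1 h2 h3.
apply: (torsion_degree (io := io) (@tofrac_inj _) (fun x => denom_ratioP (repr x))
  (@frac_numden _) F2_neq0 D0 m0 n0 dv (torsion_closed F2_neq0 hs)) => p p' pn pm.
exact: (torsion_pair F2_neq0 m0 n0 h2 h3 h4 h5 hs pn pm).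
Qed.
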